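(* Let $(z_1,w_1),\dots,(z_n,w_n)\in\mathbb D^2$, with $z_1,\dots,z_n$ distinct and $w_1,\dots,w_n$ distinct, and let $G\in H^\infty(\mathbb D^2)$. Let $b_1$ and $b_2$ be the finite Blaschke products with simple zeros at $z_1,\dots,z_n$ and at $w_1,\dots,w_n$, respectively. Put $b(x,y)=b_1(x)b_2(y)$ and $\phi=\bar bG$ on $\mathbb T^2$. Consider the conditions: (i) For every $y\in\mathbb T$ the matrix $\big((1-G(z_j,y)\overline{G(z_k,y)})(1-z_j\bar z_k)^{-1}\big)_{j,k=1}^n$ is positive semidefinite, and for every $x\in\mathbb T$ the matrix $\big((1-G(x,w_j)\overline{G(x,w_k)})(1-w_j\bar w_k)^{-1}\big)_{j,k=1}^n$ is positive semidefinite. (ii) The Hankel operator $\Gamma_\phi$ is bounded with $\|\Gamma_\phi\|\le1$. (iii) There is $F\in H^2(\mathbb D^2)$ with $F(z_k,w)=G(z_k,w)$ for all $w\in\mathbb D$ and $F(z,w_k)=G(z,w_k)$ for all $z\in\mathbb D$, for $k=1,\dots,n$, and with $\|\bar bF\|_{\mathrm{BMO}_r}\le1$ (computed for boundary values on $\mathbb T^2$). (iv) There exist $F_1,F_2\in L^\infty(\mathbb T^2)$ with $\|F_1\|_\infty\le1$ and $\|F_2\|_\infty\le1$, where $F_1$ is analytic in the first variable ($\hat F_1(m,n)=0$ for $m<0$) and $F_2$ is analytic in the second variable ($\hat F_2(m,n)=0$ for $n<0$), such that for $k=1,\dots,n$ one has $F_1(z_k,y)=G(z_k,y)$ for a.e.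 $y\in\mathbb T$ and $F_2(x,w_k)=G(x,w_k)$ for a.e. $x\in\mathbb T$. Here $F_1(z,y)$ and $F_2(x,w)$ denote the analytic extensions in the analytic variable. Then (ii) implies (iii) and (ii) implies (iv). Each of (iii) and (iv) implies that $\Gamma_\phi$ is bounded with $\|\Gamma_\phi\|\le\sqrt2$. Finally, (i) and (iv) are equivalent.
   Context: $\mathbb T=\mathbb R/2\pi\mathbb Z$ carries normalized Lebesgue measure, with $x\in\mathbb T$ identified with $e^{ix}$. Functions in $H^\infty(\mathbb D^2)$ and $H^2(\mathbb D^2)$ are identified with their boundary values on $\mathbb T^2$. $P$ is the orthogonal projection of $L^2(\mathbb T^2)$ onto $H^2(\mathbb T^2)$, and for $\phi\in L^2(\mathbb T^2)$ the (big) Hankel operator is $\Gamma_\phi f=(I-P)(\phi f)$, defined for $f\in H^2(\mathbb T^2)$. $P_x$ and $P_y$ are the orthogonal projections onto $H^2_x=\{\hat f(m,n)=0 \text{ for } m<0\}$ and $H^2_y=\{\hat f(m,n)=0 \text{ for } n<0\}$. $\mathrm{BMO}_r(\mathbb T^2)$ is the set of $\psi\in L^2(\mathbb T^2)$ for which there exist $\varphi_0,\varphi_1,\varphi_2\in L^\infty(\mathbb T^2)$ with $(I-P_x)\psi=(I-P_x)\varphi_1$, $(I-P_y)\psi=(I-P_y)\varphi_2$ and $P_xP_y\psi=P_xP_y\varphi_0$. The norm $\|\psi\|_{\mathrm{BMO}_r}$ is the infimum of $\max_j\|\varphi_j\|_\infty$ over such choices.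
   Formalization: In condition (i), ''for every y'' and ''for every x'' are read as ''for almost every'', since the boundary values G(z_j,y) and G(x,w_j) of a bounded analytic G exist only almost everywhere (e.g. G(z,w)=c(1-w)^i has no boundary value at w=1). *)

(* Defs.v *)
From HB Require Import structures.
From mathcomp Require Import all_boot all_order all_algebra.
From mathcomp Require Import all_classical all_reals all_analysis.
From mathcomp Require Import complex.
Import Order.TTheory GRing.Theory Num.Theory.

Set Implicit Arguments.
Unset Strict Implicit.
Unset Printing Implicit Defensive.

Local Open Scope ring_scope.
Local Open Scope classical_set_scope.

Section Bidisc.
Variable R : realType.

(* The torus T^2 is modelled by the square [0,2pi]^2 in R^2, x <-> e^{ix}. *)
Definition T2 := (measurableTypeR R * measurableTypeR R)%type.
Definition leb : {measure set (measurableTypeR R) -> \bar R} := @lebesgue_measure R.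
Definition mu2 : {measure set T2 -> \bar R} := (leb \x leb)%E.
Definition sqT : set R := `[0, 2 * pi].
Definition sqT2 : set T2 := sqT `*` sqT.

Notation C := R[i].

Definition cabs (z : C) : R := Num.sqrt (complex.Re z ^+ 2 + complex.Im z ^+ 2).
Definition expi (t : R) : C := (cos t +i* sin t)%C.

Definition cint1 (f : R -> C) : C :=
  (((2 * pi)^-1 * Rintegral leb sqT (fun t => complex.Re (f t)))
   +i* ((2 * pi)^-1 * Rintegral leb sqT (fun t => complex.Im (f t))))%C.
Definition cint2 (f : T2 -> C) : C :=
  ((((2 * pi) ^+ 2)^-1 * Rintegral mu2 sqT2 (fun p => complex.Re (f p)))
   +i* (((2 * pi) ^+ 2)^-1 * Rintegral mu2 sqT2 (fun p => complex.Im (f p))))%C.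

Definition cmeas (f : T2 -> C) : Prop :=
  measurable_fun setT (fun p => complex.Re (f p)) /\ measurable_fun setT (fun p => complex.Im (f p)).

Definition L2 (f : T2 -> C) : Prop :=
  cmeas f /\ mu2.-integrable sqT2 (fun p => ((cabs (f p)) ^+ 2)%:E).
Definition norm2 (f : T2 -> C) : R :=
  Num.sqrt (((2 * pi) ^+ 2)^-1 * Rintegral mu2 sqT2 (fun p => (cabs (f p)) ^+ 2)).
Definition inner (f g : T2 -> C) : C := cint2 (fun p => f p * (g p)^*%C).

Definition Linf_le (f : T2 -> C) (c : R) : Prop :=
  cmeas f /\ {ae mu2, forall p, sqT2 p -> cabs (f p) <= c}.
Definition Linf (f : T2 -> C) : Prop := exists c, Linf_le f c.

Definition fhat (f : T2 -> C) (m n : int) : C :=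
  cint2 (fun p => f p * expi (- (m%:~R * p.1 + n%:~R * p.2))).

Definition H2 (f : T2 -> C) : Prop :=
  L2 f /\ forall m n : int, (m < 0 \/ n < 0) -> fhat f m n = 0.
Definition H2x (f : T2 -> C) : Prop :=
  L2 f /\ forall m n : int, m < 0 -> fhat f m n = 0.
Definition H2y (f : T2 -> C) : Prop :=
  L2 f /\ forall m n : int, n < 0 -> fhat f m n = 0.

(* boundary values of H^infty(D^2) *)
Definition Hinf (f : T2 -> C) : Prop :=
  Linf f /\ forall m n : int, (m < 0 \/ n < 0) -> fhat f m n = 0.

Definition fmul (f g : T2 -> C) : T2 -> C := fun p => f p * g p.
Definition fsub (f g : T2 -> C) : T2 -> C := fun p => f p - g p.

Definition is_projH2 (g h : T2 -> C) : Prop :=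
  H2 h /\ forall u, H2 u -> inner (fsub g h) u = 0.

Definition hankel_norm_le (phi : T2 -> C) (c : R) : Prop :=
  forall f, H2 f -> forall h, is_projH2 (fmul phi f) h ->
    norm2 (fsub (fmul phi f) h) <= c * norm2 f.

(* ||psi||_{BMO_r} <= c  (infimum over admissible (phi0,phi1,phi2) is <= c).
   (I-P_x)psi = (I-P_x)phi1  <->  psi - phi1 in H^2_x,
   (I-P_y)psi = (I-P_y)phi2  <->  psi - phi2 in H^2_y,
   P_x P_y psi = P_x P_y phi0 <-> hat(psi - phi0)(m,n) = 0 for m,n >= 0. *)
Definition bmo_r_le (psi : T2 -> C) (c : R) : Prop :=
  forall eps : R, 0 < eps -> exists phi0 phi1 phi2 : T2 -> C,
    [/\ Linf_le phi0 (c + eps), Linf_le phi1 (c + eps), Linf_le phi2 (c + eps)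
       & [/\ H2x (fsub psi phi1), H2y (fsub psi phi2) &
        forall m n : int, 0 <= m -> 0 <= n -> fhat (fsub psi phi0) m n = 0]].

(* Cauchy-integral extensions to the disc in the analytic variable(s) *)
Definition ext1 (f : T2 -> C) (z : C) (y : R) : C :=
  cint1 (fun x => f (x, y) / (1 - z * expi (- x))).
Definition ext2 (f : T2 -> C) (x : R) (w : C) : C :=
  cint1 (fun y => f (x, y) / (1 - w * expi (- y))).
Definition ext12 (f : T2 -> C) (z w : C) : C :=
  cint2 (fun p => f p / ((1 - z * expi (- p.1)) * (1 - w * expi (- p.2)))).

Definition blaschke n (a : 'I_n -> C) (t : R) : C :=
  \prod_(j < n) ((expi t - a j) / (1 - (a j)^*%C * expi t)).

Definition psd n (M : 'M[C]_n) : Prop :=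
  forall v : 'cV[C]_n, 0 <= ((map_mx (fun x => x^*%C) v)^T *m M *m v) 0 0.

End Bidisc.

(* Main.v *)
Require Import Defs.
From HB Require Import structures.
From mathcomp Require Import all_boot all_order all_algebra.
From mathcomp Require Import all_classical all_reals all_analysis.
From mathcomp Require Import complex measurable_realfun ring lra.
Import Order.TTheory GRing.Theory Num.Theory.
Import numFieldNormedType.Exports.
Local Open Scope ring_scope.
Local Open Scope classical_set_scope.

(* Everything runs through Fourier coefficients; no Nehari or commutant lifting theorem is used.

   Bounds: if [phi - phi1] is analytic in x, [phi - phi2] is analytic in y and |phi_i| <= c, then
   [(I - P)(phi f)] has the coefficients of [phi1 f] at m < 0 and those of [phi2 f] at m >= 0 > n,
   and 2 Re <phi_i f, t_i> <= |phi_i f|^2 + |t_i|^2 for the two parts of an approximating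
   trigonometric polynomial gives the constant sqrt 2.  In (iii) and (iv) such [phi_i] exist because
   an analytic function vanishing at the nodes remains analytic after division by the Blaschke
   product; this is a statement about coefficients: w = f / (1 - z e^{-ix}) satisfies
   w^(m) - z w^(m+1) = f^(m), and w^ is bounded.

   (i) <-> (iv) is the Nevanlinna-Pick theorem on almost every slice.  The interpolant is produced by
   the Schur algorithm, whose output is a rational function depending measurably on the data, and the
   Pick matrix of a bounded f is positive because |conj f g - h|^2 >= 0 for two combinations g, h of
   Szego kernels.

   (ii) -> (i): test the Hankel form against g = sum_k c_k 1_E(y) / (1 - conj z_k e^{ix}) with
   f = sum_k c_k conj G(z_k, y) 1_E(y) / (1 - conj z_k e^{ix}); then <G f, g> = |f|^2, so the bound
   says that the integral over E of the Pick form of c is nonnegative; take E to be the set where it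
   is negative.  (ii) -> (iii) uses F = G - b P(conj b G). *)

Set Implicit Arguments.
Unset Strict Implicit.
Unset Printing Implicit Defensive.

(** * Complex-valued functions and their integrals *)

(** The Hankel condition quantifies over functions [h] that are projections of [phi f], so it can be
    used only once such an [h] is exhibited. For [u] in H^infinity the projection of [conj b u] is
    built explicitly, one Blaschke factor at a time, and comes out bounded. The [F] of (iii) is
    merely in H^2: its zeros are read off Fourier coefficients with the frequency in the other
    variable frozen, and slices are reserved for bounded functions. The test functions for (ii)
    contain an indicator in y and are analytic in x only; trigonometric approximation and a
    character in y move them into H^2.

    The 2 under the root counts symbols: the frequencies outside the positive quadrant are shared
    between [phi1] and [phi2], and each share costs at most c^2 |f|^2. The implication from (ii) to
    (iii) passes through (i) and (iv), whose interpolants provide the bounded symbols that BMO_r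
    asks for, namely [phi_i = conj b F_i], with [phi0 = 0]. Many statements on the second variable
    follow from the first by exchanging coordinates. *)

Section ComplexModulus.
Variable R : realType.
Local Notation C := R[i].
Local Notation Re := (@complex.Re R).
Local Notation Im := (@complex.Im R).
Implicit Types z w : C.

Lemma cabsE z : (cabs z)%:C%C = `|z|.
Proof. by rewrite normc_def. Qed.

Lemma cabsM z w : cabs (z * w) = cabs z * cabs w.
Proof. by apply: complexI; rewrite rmorphM /= !cabsE normrM. Qed.

Lemma cabs_ge0 z : 0 <= cabs z. Proof. exact: sqrtr_ge0. Qed.

Lemma cabsD z w : cabs (z + w) <= cabs z + cabs w.
Proof. by rewrite -lecR rmorphD /= !cabsE ler_normD. Qed.

Lemma cabsN z : cabs (- z) = cabs z.
Proof. by apply: complexI; rewrite !cabsE normrN. Qed.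

Lemma cabsV z : cabs z^-1 = (cabs z)^-1.
Proof. by apply: complexI; rewrite fmorphV /= !cabsE normfV. Qed.

Lemma cabsJ z : cabs z^*%C = cabs z.
Proof. by case: z => a b; rewrite /cabs /= sqrrN. Qed.

Lemma cabs0 : cabs (0 : C) = 0.
Proof. by apply: complexI; rewrite cabsE normr0. Qed.

Lemma cabs1 : cabs (1 : C) = 1.
Proof. by apply: complexI; rewrite cabsE normr1. Qed.

Lemma cabsX z k : cabs (z ^+ k) = cabs z ^+ k.
Proof. by apply: complexI; rewrite rmorphXn /= !cabsE normrX. Qed.

Lemma cabs_real (r : R) : cabs r%:C%C = `|r|.
Proof. by rewrite /cabs /= expr0n addr0 sqrtr_sqr. Qed.

Lemma cabs_eq0 z : (cabs z == 0) = (z == 0).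
Proof. by rewrite -(inj_eq (@complexI R)) cabsE normr_eq0. Qed.

Lemma cabs_sqr z : cabs z ^+ 2 = Re z ^+ 2 + Im z ^+ 2.
Proof. by rewrite sqr_sqrtr // addr_ge0 // sqr_ge0. Qed.

Lemma cabs_sqrJ z : ((cabs z) ^+ 2)%:C%C = z * z^*%C.
Proof. by rewrite rmorphXn /= cabsE sqr_normc. Qed.

Lemma Re_mulJ z : Re (z * z^*%C) = cabs z ^+ 2.
Proof. by rewrite -cabs_sqrJ. Qed.

Lemma normr_Re_le z : `|Re z| <= cabs z.
Proof. by rewrite -sqrtr_sqr ler_wsqrtr // lerDl sqr_ge0. Qed.

Lemma normr_Im_le z : `|Im z| <= cabs z.
Proof. by rewrite -sqrtr_sqr ler_wsqrtr // lerDr sqr_ge0. Qed.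

Lemma cabs_le_ReIm z : cabs z <= `|Re z| + `|Im z|.
Proof.
case: z => a b /=.
have -> : (a +i* b)%C = a%:C%C + 'i%C * b%:C%C by simpc.
apply: le_trans (cabsD _ _) _.
rewrite cabsM !cabs_real [cabs 'i%C](_ : _ = 1) ?mul1r //.
by rewrite /cabs /= expr0n expr1n add0r sqrtr1.
Qed.

Lemma ltc_norm1 z : (`|z| < 1) = (cabs z < 1).
Proof. by rewrite -cabsE -[1]/(1%:C%C) ltcR. Qed.

Lemma cabs_sum I (s : seq I) (P : pred I) (F : I -> C) :
  cabs (\sum_(i <- s | P i) F i) <= \sum_(i <- s | P i) cabs (F i).
Proof.
elim/big_rec2: _ => [|i x y _ h]; first by rewrite cabs0.
by apply: le_trans (cabsD _ _) _; rewrite lerD2l.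
Qed.

Lemma cReD z w : Re (z + w) = Re z + Re w.
Proof. by case: z w => ? ? [? ?]. Qed.
Lemma cImD z w : Im (z + w) = Im z + Im w.
Proof. by case: z w => ? ? [? ?]. Qed.
Lemma cReM z w : Re (z * w) =
  Re z * Re w - Im z * Im w.
Proof. by case: z w => ? ? [? ?]. Qed.
Lemma cImM z w : Im (z * w) =
  Re z * Im w + Im z * Re w.
Proof. by case: z w => ? ? [? ?]. Qed.
Lemma cReV z : Re z^-1 = Re z * (cabs z ^+ 2)^-1.
Proof. by rewrite cabs_sqr; case: z. Qed.
Lemma cImV z : Im z^-1 = - Im z * (cabs z ^+ 2)^-1.
Proof. by rewrite cabs_sqr; case: z => a b /=; rewrite mulNr. Qed.

Lemma cReJ z : Re z^*%C = Re z. Proof. by case: z. Qed.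
Lemma cImJ z : Im z^*%C = - Im z. Proof. by case: z. Qed.

(* Unlike the generic [rmorph] lemmas these leave a term on which [conjc] stays folded. *)
Lemma cconjD z w : (z + w)^*%C = z^*%C + w^*%C. Proof. exact: rmorphD. Qed.
Lemma cconjN z : (- z)^*%C = - z^*%C. Proof. exact: rmorphN. Qed.
Lemma cconjB z w : (z - w)^*%C = z^*%C - w^*%C. Proof. exact: rmorphB. Qed.
Lemma cconjM z w : (z * w)^*%C = z^*%C * w^*%C. Proof. exact: rmorphM. Qed.
Lemma cconjV z : (z^-1)^*%C = (z^*%C)^-1. Proof. exact: conjc_inv. Qed.
Lemma cconj_sum I (s : seq I) (P : pred I) (F : I -> C) :
  (\sum_(i <- s | P i) F i)^*%C = \sum_(i <- s | P i) (F i)^*%C.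
Proof. exact: rmorph_sum. Qed.
Lemma cconj_prod I (s : seq I) (P : pred I) (F : I -> C) :
  (\prod_(i <- s | P i) F i)^*%C = \prod_(i <- s | P i) (F i)^*%C.
Proof. exact: rmorph_prod. Qed.

End ComplexModulus.

Section ComplexMeasurable.
Context d (T : measurableType d) (R : realType).
Local Notation C := R[i].
Local Notation Re := (@complex.Re R).
Local Notation Im := (@complex.Im R).
Implicit Types f g : T -> C.

(** Over a general measurable space, so that the circle and the torus share one set of lemmas; on
    the torus it unfolds to [cmeas]. *)
Definition mfunC f := measurable_fun setT (fun p => Re (f p)) /\
  measurable_fun setT (fun p => Im (f p)).

Lemma mfunC_cst (c : C) : mfunC (fun=> c).
Proof. by split; exact: measurable_cst. Qed.

Lemma mfunCD f g : mfunC f -> mfunC g -> mfunC (fun p => f p + g p).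
Proof.
move=> [f1 f2] [g1 g2]; split.
- by under eq_fun do rewrite cReD; exact: measurable_funD.
- by under eq_fun do rewrite cImD; exact: measurable_funD.
Qed.

Lemma mfunCM f g : mfunC f -> mfunC g -> mfunC (fun p => f p * g p).
Proof.
move=> [f1 f2] [g1 g2]; split.
- by under eq_fun do rewrite cReM; apply: measurable_funB; exact: measurable_funM.
- by under eq_fun do rewrite cImM; apply: measurable_funD; exact: measurable_funM.
Qed.

Lemma mfunCN f : mfunC f -> mfunC (fun p => - f p).
Proof.
move=> hf; under [X in mfunC X]eq_fun do rewrite -mulN1r.
by apply: mfunCM => //; exact: mfunC_cst.
Qed.

Lemma mfunCB f g : mfunC f -> mfunC g -> mfunC (fun p => f p - g p).
Proof. by move=> hf hg; apply: mfunCD => //; exact: mfunCN. Qed.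

Lemma mfunCJ f : mfunC f -> mfunC (fun p => (f p)^*%C).
Proof.
move=> [f1 f2]; split.
- by under eq_fun do rewrite cReJ.
- under eq_fun do rewrite cImJ.
  exact: measurable_funN.
Qed.

Lemma mfunC_sum I (s : seq I) (F : I -> T -> C) :
  (forall i, mfunC (F i)) -> mfunC (fun p => \sum_(i <- s) F i p).
Proof.
move=> h; elim: s => [|i s ih].
  by under [X in mfunC X]eq_fun do rewrite big_nil; exact: mfunC_cst.
by under [X in mfunC X]eq_fun do rewrite big_cons; exact: mfunCD.
Qed.

Lemma mfunC_prod I (s : seq I) (F : I -> T -> C) :
  (forall i, mfunC (F i)) -> mfunC (fun p => \prod_(i <- s) F i p).
Proof.
move=> h; elim: s => [|i s ih].
  by under [X in mfunC X]eq_fun do rewrite big_nil; exact: mfunC_cst.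
by under [X in mfunC X]eq_fun do rewrite big_cons; exact: mfunCM.
Qed.

Lemma measurable_cabs_sqr f : mfunC f -> measurable_fun setT (fun p => cabs (f p) ^+ 2).
Proof.
move=> [f1 f2]; under eq_fun do rewrite cabs_sqr.
by apply: measurable_funD; exact: measurable_funX.
Qed.

(** The inverse is the power with exponent -1, a measurable function agreeing with it on nonnegative
    reals. This is why [mfunCV] divides by the squared modulus. *)
Lemma measurable_funV_ge0 (h : T -> R) : (forall x, 0 <= h x) ->
  measurable_fun setT h -> measurable_fun setT (fun x => (h x)^-1).
Proof.
move=> h0 mh; under eq_fun => x do rewrite -powR_inv1//.
exact: (measurableT_comp (@measurable_powR R (-1)) mh).
Qed.

Lemma mfunCV f : mfunC f -> mfunC (fun p => (f p)^-1).
Proof.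
move=> hf; have [f1 f2] := hf.
have hV : measurable_fun setT (fun p => (cabs (f p) ^+ 2)^-1).
  by apply: measurable_funV_ge0 => [x|]; [exact: sqr_ge0|exact: measurable_cabs_sqr].
split.
- by under eq_fun do rewrite cReV; exact: measurable_funM.
- under eq_fun do rewrite cImV.
  by apply: measurable_funM => //; exact: measurable_funN.
Qed.

Lemma mfunC_if (b : T -> bool) f g : measurable_fun setT b ->
  mfunC f -> mfunC g -> mfunC (fun p => if b p then f p else g p).
Proof.
move=> mb [f1 f2] [g1 g2]; split.
- under eq_fun do rewrite (fun_if Re).
  by apply: measurable_fun_ifT.
- under eq_fun do rewrite (fun_if Im).
  by apply: measurable_fun_ifT.
Qed.

End ComplexMeasurable.

Section Expi.
Variable R : realType.
Local Notation C := R[i].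

Lemma expi0 : expi 0 = 1 :> C.
Proof. by rewrite /expi cos0 sin0. Qed.

Lemma expiD (s t : R) : expi (s + t) = expi s * expi t.
Proof. by rewrite /expi cosD sinD; simpc; congr (_ +i* _)%C; ring. Qed.

Lemma expiN (t : R) : expi (- t) = (expi t)^*%C.
Proof. by rewrite /expi cosN sinN. Qed.

Lemma cabs_expi (t : R) : cabs (expi t) = 1.
Proof. by rewrite /cabs /= cos2Dsin2 sqrtr1. Qed.

Lemma mfunC_expi d (T : measurableType d) (h : T -> R) :
  measurable_fun setT h -> mfunC (fun p => expi (h p)).
Proof.
by move=> mh; split => /=; apply: measurableT_comp => //;
  apply: continuous_measurable_fun; [exact: continuous_cos|exact: continuous_sin].
Qed.

End Expi.
Section ComplexIntegral.
Context d (T : measurableType d) (R : realType).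
Variables (mu : {measure set T -> \bar R}) (D : set T).
Hypothesis mD : measurable D.
Hypothesis finD : (mu D < +oo)%E.
Local Notation C := R[i].
Implicit Types f g : T -> C.
Local Notation Re := (@complex.Re R).
Local Notation Im := (@complex.Im R).

Definition Cint f : C :=
  (Rintegral mu D (fun p => Re (f p)) +i* Rintegral mu D (fun p => Im (f p)))%C.

Definition integrableC f := mfunC f /\
  (mu.-integrable D (fun p => (Re (f p))%:E) /\ mu.-integrable D (fun p => (Im (f p))%:E)).

(** On the torus this unfolds to [Linf_le], and [L2C] to [L2]. *)
Definition ess_boundedC f (c : R) :=
  mfunC f /\ {ae mu, forall p, D p -> cabs (f p) <= c}.

Definition L2C f :=
  mfunC f /\ mu.-integrable D (fun p => (cabs (f p) ^+ 2)%:E).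

Lemma integrable_ae_le (h k : T -> R) : measurable_fun setT h ->
  mu.-integrable D (EFin \o k) -> {ae mu, forall p, D p -> `|h p| <= k p} ->
  mu.-integrable D (EFin \o h).
Proof.
move=> mh ik hk.
have mhD : measurable_fun D (EFin \o h).
  by apply/measurable_EFinP; exact: measurable_funS mh.
have mkD := measurable_int mu ik.
apply/integrableP; split => //.
case/integrableP: (ik) => _; apply: le_lt_trans.
apply: ae_ge0_le_integral => //.
- by apply: measurableT_comp.
- by apply: measurableT_comp.
- apply: filterS hk => p hp Dp; rewrite lee_fin.
  by apply: le_trans (hp Dp) _; exact: ler_norm.
Qed.

Lemma integrable_cabs f : integrableC f ->
  mu.-integrable D (fun p => (`|Re (f p)| + `|Im (f p)|)%:E).
Proof.
move=> [mf [h1 h2]].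
under [X in _.-integrable _ X]eq_fun do rewrite EFinD.
by apply: integrableD => //; exact: integrable_norm.
Qed.

Lemma integrableC_dom f (k : T -> R) : mfunC f -> mu.-integrable D (EFin \o k) ->
  {ae mu, forall p, D p -> cabs (f p) <= k p} -> integrableC f.
Proof.
move=> mf ik fk; split => //; split; apply: (integrable_ae_le _ ik) => //;
  try exact: mf.1; try exact: mf.2; apply: filterS fk => p h /h; apply: le_trans.
- exact: normr_Re_le.
- exact: normr_Im_le.
Qed.

Lemma integrable_cstD (c : R) : mu.-integrable D (EFin \o (fun=> c)).
Proof.
apply: measurable_bounded_integrable => //; exists `|c|; split; first by rewrite num_real.
by move=> x hx p Dp /=; exact: ltW.
Qed.

Lemma integrableC_bounded f c : ess_boundedC f c -> integrableC f.
Proof. by move=> [mf fc]; exact: (integrableC_dom mf (integrable_cstD c)). Qed.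

Lemma integrableC_mulb f g c : integrableC f -> ess_boundedC g c ->
  integrableC (fun p => f p * g p).
Proof.
move=> hf [mg gc].
have ik := integrable_cabs hf.
have ik' : mu.-integrable D (EFin \o (fun p => `|c| * (`|Re (f p)| + `|Im (f p)|))).
  by have := integrableZl mD `|c| ik; apply: eq_integrable => //.
apply: (integrableC_dom _ ik'); first by apply: mfunCM => //; exact: hf.1.
apply: filterS gc => p h /h hp; rewrite cabsM mulrC.
apply: ler_pM; rewrite ?cabs_ge0 ?cabs_le_ReIm //.
by apply: le_trans hp _; exact: ler_norm.
Qed.

Lemma integrableCD f g : integrableC f -> integrableC g ->
  integrableC (fun p => f p + g p).
Proof.
move=> [mf [f1 f2]] [mg [g1 g2]]; split; first exact: mfunCD.
split.
- by under [X in _.-integrable _ X]eq_fun do rewrite cReD EFinD; exact: integrableD.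
- by under [X in _.-integrable _ X]eq_fun do rewrite cImD EFinD; exact: integrableD.
Qed.

Lemma ess_boundedC_cst c : ess_boundedC (fun=> c) (cabs c).
Proof. by split; [exact: mfunC_cst|exact: aeW]. Qed.

Lemma integrableCZ (c : C) f : integrableC f -> integrableC (fun p => c * f p).
Proof.
move=> hf; under [X in integrableC X]eq_fun do rewrite mulrC.
exact: integrableC_mulb (ess_boundedC_cst c).
Qed.

Lemma integrableCN f : integrableC f -> integrableC (fun p => - f p).
Proof.
by move=> hf; under [X in integrableC X]eq_fun do rewrite -mulN1r; exact: integrableCZ.
Qed.

Lemma integrableCB f g : integrableC f -> integrableC g ->
  integrableC (fun p => f p - g p).
Proof. by move=> hf hg; apply: integrableCD => //; exact: integrableCN. Qed.

Lemma integrableC0 : integrableC (fun=> 0).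
Proof. exact: (integrableC_bounded (ess_boundedC_cst 0)). Qed.

Lemma integrableC_sum I (s : seq I) (F : I -> T -> C) :
  (forall i, integrableC (F i)) -> integrableC (fun p => \sum_(i <- s) F i p).
Proof.
move=> h; elim: s => [|i s ih].
  by under [X in integrableC X]eq_fun do rewrite big_nil; exact: integrableC0.
by under [X in integrableC X]eq_fun do rewrite big_cons; exact: integrableCD.
Qed.

Lemma CintD f g : integrableC f -> integrableC g ->
  Cint (fun p => f p + g p) = Cint f + Cint g.
Proof.
move=> [mf [f1 f2]] [mg [g1 g2]]; rewrite /Cint.
under [X in (X +i* _)%C = _]eq_Rintegral do rewrite cReD.
under [X in (_ +i* X)%C = _]eq_Rintegral do rewrite cImD.
by rewrite !RintegralD.
Qed.

Lemma CintZ (c : C) f : integrableC f -> Cint (fun p => c * f p) = c * Cint f.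
Proof.
move=> [mf [f1 f2]]; rewrite /Cint.
under [X in (X +i* _)%C = _]eq_Rintegral do rewrite cReM.
under [X in (_ +i* X)%C = _]eq_Rintegral do rewrite cImM.
have hZ (r : R) (h : T -> R) : mu.-integrable D (fun p => (h p)%:E) ->
    mu.-integrable D (EFin \o (fun p => r * h p)).
  by move=> ih; have := integrableZl mD r ih; apply: eq_integrable.
rewrite RintegralB ?RintegralD; try exact: hZ; rewrite // !RintegralZl //.
by case: c.
Qed.

Lemma CintN f : integrableC f -> Cint (fun p => - f p) = - Cint f.
Proof.
by move=> hf; rewrite -mulN1r -CintZ //; congr Cint; apply/funext => p; rewrite mulN1r.
Qed.

Lemma CintB f g : integrableC f -> integrableC g ->
  Cint (fun p => f p - g p) = Cint f - Cint g.
Proof. by move=> hf hg; rewrite CintD ?CintN //; exact: integrableCN. Qed.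

Lemma Cint_sum I (s : seq I) (F : I -> T -> C) : (forall i, integrableC (F i)) ->
  Cint (fun p => \sum_(i <- s) F i p) = \sum_(i <- s) Cint (F i).
Proof.
move=> h; elim: s => [|i s ih].
  rewrite big_nil -[RHS](mul0r (Cint (fun=> 0))) -CintZ; last exact: integrableC0.
  by congr Cint; apply/funext => p; rewrite big_nil mul0r.
rewrite big_cons -ih -CintD //; last exact: integrableC_sum.
by congr Cint; apply/funext => p; rewrite big_cons.
Qed.

Lemma CintJ f : integrableC f -> Cint (fun p => (f p)^*%C) = (Cint f)^*%C.
Proof.
move=> [_ [h1 h2]]; rewrite /Cint /=; congr (_ +i* _)%C.
- by apply: eq_Rintegral => p _; rewrite cReJ.
- rewrite -mulN1r -RintegralZl //.
  by apply: eq_Rintegral => p _; rewrite cImJ mulN1r.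
Qed.

Lemma ae_eq_Cint f g : mfunC f -> mfunC g ->
  {ae mu, forall p, D p -> f p = g p} -> Cint f = Cint g.
Proof.
have haux (h k : T -> R) : measurable_fun setT h -> measurable_fun setT k ->
    {ae mu, forall p, D p -> h p = k p} -> Rintegral mu D h = Rintegral mu D k.
  move=> mh mk hk; congr fine; apply: ae_eq_integral => //.
  - by apply/measurable_EFinP; exact: measurable_funS mh.
  - by apply/measurable_EFinP; exact: measurable_funS mk.
  - by apply: filterS hk => p h0 /h0 ->.
move=> [f1 f2] [g1 g2] fg; congr (_ +i* _)%C; apply: haux => //;
  by apply: filterS fg => p h /h ->.
Qed.

(** A single bound serves all multipliers of modulus at most 1. Applied to characters, it bounds all
    Fourier coefficients at once, as [geometric_zero] requires. The real and imaginary parts are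
    estimated separately, hence [M + M]. *)
Lemma Cint_bound f : integrableC f ->
  exists M : R, forall u : T -> C, mfunC u -> (forall p, cabs (u p) <= 1) ->
    cabs (Cint (fun p => f p * u p)) <= M.
Proof.
move=> hf; have ik := integrable_cabs hf.
pose M := Rintegral mu D (fun p => `|Re (f p)| + `|Im (f p)|).
exists (M + M) => u mu_ u1.
have bu : ess_boundedC u 1 by split => //; exact: aeW.
have [_ [h1 h2]] := integrableC_mulb hf bu.
have hle p : cabs (f p * u p) <= `|Re (f p)| + `|Im (f p)|.
  by rewrite cabsM -[leRHS]mulr1 ler_pM ?cabs_ge0 ?cabs_le_ReIm.
apply: le_trans (cabs_le_ReIm _) _; rewrite /Cint /=; apply: lerD.
- apply: le_trans (le_normr_Rintegral mD h1) _.
  apply: le_Rintegral => //; first exact: integrable_norm.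
  by move=> p _; apply: le_trans (hle p); exact: normr_Re_le.
- apply: le_trans (le_normr_Rintegral mD h2) _.
  apply: le_Rintegral => //; first exact: integrable_norm.
  by move=> p _; apply: le_trans (hle p); exact: normr_Im_le.
Qed.

Lemma L2C_mulb f g c : L2C f -> ess_boundedC g c -> L2C (fun p => f p * g p).
Proof.
move=> [mf hf] [mg gc]; split; first exact: mfunCM.
have ik' : mu.-integrable D (EFin \o (fun p => `|c| ^+ 2 * cabs (f p) ^+ 2)).
  by have := integrableZl mD (`|c| ^+ 2) hf; apply: eq_integrable.
apply: (integrable_ae_le _ ik'); first by apply: measurable_cabs_sqr; exact: mfunCM.
apply: filterS gc => p h /h hp; rewrite ger0_norm ?sqr_ge0 //.
rewrite cabsM exprMn mulrC ler_wpM2r ?sqr_ge0 // ler_sqr ?nnegrE ?cabs_ge0 //.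
by apply: le_trans hp _; exact: ler_norm.
Qed.

Lemma L2C_bounded f c : ess_boundedC f c -> L2C f.
Proof.
move=> [mf fc]; split => //.
apply: (integrable_ae_le _ (integrable_cstD (`|c| ^+ 2))).
  exact: measurable_cabs_sqr.
apply: filterS fc => p h /h hp; rewrite ger0_norm ?sqr_ge0 //.
rewrite ler_sqr ?nnegrE ?cabs_ge0 //.
by apply: le_trans hp _; exact: ler_norm.
Qed.

Lemma cabsM_le z w : cabs (z * w) <= cabs z ^+ 2 + cabs w ^+ 2 :> R.
Proof.
rewrite cabsM; have := sqr_ge0 (cabs z - cabs w).
have := cabs_ge0 z; have := cabs_ge0 w; nra.
Qed.

Lemma integrable_sum2 f g : L2C f -> L2C g ->
  mu.-integrable D (EFin \o (fun p => cabs (f p) ^+ 2 + cabs (g p) ^+ 2)).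
Proof.
move=> [mf hf] [mg hg].
by have := integrableD mD hf hg; apply: eq_integrable.
Qed.

Lemma integrableC_L2 f g : L2C f -> L2C g -> integrableC (fun p => f p * g p).
Proof.
move=> hf hg; apply: (integrableC_dom _ (integrable_sum2 hf hg)).
  by apply: mfunCM; [exact: hf.1|exact: hg.1].
by apply: aeW => p _; exact: cabsM_le.
Qed.

Lemma L2CJ f : L2C f -> L2C (fun p => (f p)^*%C).
Proof.
move=> [mf hf]; split; first exact: mfunCJ.
by under [X in _.-integrable _ X]eq_fun do rewrite cabsJ.
Qed.

Lemma L2C_integrable f : L2C f -> integrableC f.
Proof.
move=> hf; have := integrableC_L2 hf (L2C_bounded (ess_boundedC_cst 1)).
by under [X in integrableC X -> _]eq_fun do rewrite mulr1.
Qed.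

Lemma L2CD f g : L2C f -> L2C g -> L2C (fun p => f p + g p).
Proof.
move=> hf hg; have mfg := mfunCD hf.1 hg.1; split => //.
have ik' : mu.-integrable D (EFin \o (fun p => 2 * (cabs (f p) ^+ 2 + cabs (g p) ^+ 2))).
  by have := integrableZl mD 2 (integrable_sum2 hf hg); apply: eq_integrable.
apply: (integrable_ae_le _ ik'); first exact: measurable_cabs_sqr.
apply: aeW => p _; rewrite ger0_norm ?sqr_ge0 //.
have h := cabsD (f p) (g p).
apply: (@le_trans _ _ ((cabs (f p) + cabs (g p)) ^+ 2)).
  by rewrite ler_sqr ?nnegrE ?addr_ge0 ?cabs_ge0.
by have := sqr_ge0 (cabs (f p) - cabs (g p)); nra.
Qed.

Lemma L2CZ c f : L2C f -> L2C (fun p => c * f p).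
Proof.
move=> hf; under [X in L2C X]eq_fun do rewrite mulrC.
exact: L2C_mulb (ess_boundedC_cst c).
Qed.

Lemma L2CB f g : L2C f -> L2C g -> L2C (fun p => f p - g p).
Proof.
move=> hf hg; under [X in L2C X]eq_fun do rewrite -mulN1r.
by apply: L2CD => //; exact: L2CZ.
Qed.

Lemma L2C_sum I (s : seq I) (F : I -> T -> C) :
  (forall i, L2C (F i)) -> L2C (fun p => \sum_(i <- s) F i p).
Proof.
move=> h; elim: s => [|i s ih].
  by under [X in L2C X]eq_fun do rewrite big_nil; exact: (L2C_bounded (ess_boundedC_cst 0)).
by under [X in L2C X]eq_fun do rewrite big_cons; exact: L2CD.
Qed.

End ComplexIntegral.

(** * Density of trigonometric polynomials *)

Section L2Density.
Import HBNNSimple HBSimple.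
Context d (T : measurableType d) (R : realType).
Variables (mu : {measure set T -> \bar R}) (D : set T).
Hypothesis mD : measurable D.
Hypothesis finD : (mu D < +oo)%E.
Variable P : (T -> R) -> Prop.
Hypothesis P_meas : forall u, P u -> measurable_fun setT u.
Hypothesis P_bnd : forall u, P u -> exists M : R, forall x, `|u x| <= M.
Hypothesis P_cst : forall c, P (fun=> c).
Hypothesis P_add : forall u v, P u -> P v -> P (fun x => u x + v x).
Hypothesis P_mul : forall u v, P u -> P v -> P (fun x => u x * v x).
Implicit Types f g u v : T -> R.

Definition dist2 f g : \bar R := \int[mu]_(x in D) ((f x - g x) ^+ 2)%:E.

(** The closure of the algebra [P] in square mean. It is stable under dominated limits and bounded
    products, so the sets whose indicator lies in it form a sigma-algebra; density reduces to
    finding generators of the measurable sets among them. *)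
Definition L2_closure f := measurable_fun setT f /\
  forall eps : R, 0 < eps -> exists2 u, P u & (dist2 f u <= eps%:E)%E.

Lemma measurable_EFinD f : measurable_fun setT f -> measurable_fun D (EFin \o f).
Proof. by move=> mf; apply/measurable_EFinP; exact: measurable_funS mf. Qed.

(** From (s + t)^2 <= 2 s^2 + 2 t^2, which spares square roots and the Cauchy-Schwarz inequality. *)
Lemma dist2_trans f g (h : T -> R) : measurable_fun setT f -> measurable_fun setT g ->
  measurable_fun setT h -> forall a b : R, 0 <= a -> 0 <= b ->
  (dist2 f g <= a%:E)%E -> (dist2 g h <= b%:E)%E ->
  (dist2 f h <= (2 * a + 2 * b)%:E)%E.
Proof.
move=> mf mg mh a b a0 b0 fg gh.
have m2 (k l : T -> R) : measurable_fun setT k -> measurable_fun setT l ->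
    measurable_fun D (fun x => ((k x - l x) ^+ 2)%:E).
  move=> mk ml; apply: (@measurable_EFinD (fun x => (k x - l x) ^+ 2)).
  by apply: measurable_funX; exact: measurable_funB.
apply: (@le_trans _ _ (2%:E * dist2 f g + 2%:E * dist2 g h)%E); last first.
  have -> : (2 * a + 2 * b)%:E = (2%:E * a%:E + 2%:E * b%:E)%E by [].
  by apply: leeD; rewrite lee_pmul2l.
rewrite /dist2 -!ge0_integralZl //; try exact: m2; try by move=> x _; rewrite lee_fin sqr_ge0.
rewrite -ge0_integralD //; try by move=> x _; rewrite mule_ge0 // lee_fin sqr_ge0.
- apply: ge0_le_integral => //; try by move=> x _; rewrite lee_fin sqr_ge0.
  + exact: m2.
  + by apply: emeasurable_funD; apply: measurable_funeM; exact: m2.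
  + move=> x _; rewrite lee_fin; have := sqr_ge0 (f x - g x - (g x - h x)); nra.
- by apply: measurable_funeM; exact: m2.
- by apply: measurable_funeM; exact: m2.
Qed.

Lemma L2_closure_dist f : measurable_fun setT f ->
  (forall eps : R, 0 < eps -> exists2 u, L2_closure u & (dist2 f u <= eps%:E)%E) ->
  L2_closure f.
Proof.
move=> mf h; split => // eps e0.
have e4 : 0 < eps / 4 by lra.
have [u [mu_ hu] fu] := h _ e4.
have [v Pv uv] := hu _ e4.
exists v => //.
have := dist2_trans mf mu_ (P_meas Pv) (ltW e4) (ltW e4) fu uv.
by move=> /le_trans; apply; rewrite lee_fin; lra.
Qed.

Lemma dist2_refl f : dist2 f f = 0%E.
Proof. by rewrite /dist2 integral0_eq // => x _; rewrite subrr expr0n. Qed.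

Lemma L2_closureP u : P u -> L2_closure u.
Proof.
move=> Pu; split; first exact: P_meas.
by move=> e e0; exists u => //; rewrite dist2_refl lee_fin ltW.
Qed.

(** Dominated convergence for the squared errors: the limit is then within any eps of a member of
    the closure, and [L2_closure_dist] applies. *)
Lemma L2_closure_lim (f_ : nat -> T -> R) f (g : T -> R) :
  (forall n, L2_closure (f_ n)) -> measurable_fun setT f ->
  mu.-integrable D (EFin \o g) ->
  (forall n x, D x -> (f x - f_ n x) ^+ 2 <= g x) ->
  {ae mu, forall x, D x -> (fun n => f_ n x) @ \oo --> f x} ->
  L2_closure f.
Proof.
move=> hf mf ig dom cv; apply: L2_closure_dist => // eps e0.
have mfn n : measurable_fun setT (f_ n) by case: (hf n).
have [||||| _ _ H] := @dominated_convergence _ _ _ mu D mD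
    (fun n x => ((f x - f_ n x) ^+ 2)%:E) (fun=> 0%:E) (EFin \o g).
- move=> n; apply: (@measurable_EFinD (fun x => (f x - f_ n x) ^+ 2)).
  by apply: measurable_funX; exact: measurable_funB.
- exact: measurable_cst.
- apply: filterS cv => x h Dx; apply: cvg_EFin; first exact: nearW.
  rewrite -[0](mulr0 (0 : R)) -{1 2}(subrr (f x)).
  rewrite [X in X @ _ --> _](_ : _ = (fun n => (f x - f_ n x) * (f x - f_ n x))); last first.
    by apply/funext => n /=; rewrite expr2.
  by apply: cvgM; apply: cvgB; try exact: h; exact: cvg_cst.
- exact: ig.
- apply: aeW => x n Dx /=; rewrite lee_fin ger0_norm ?sqr_ge0 //; exact: dom.
rewrite integral0 in H.
have /fine_cvgP [fin cvf] := H.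
have : \forall n \near \oo, fine (\int[mu]_(x in D) ((f x - f_ n x) ^+ 2)%:E) < eps.
  have := cvgr_lt _ cvf eps; apply; exact: e0.
move=> near1.
have [n [h1 h2]] : exists n, (\int[mu]_(x in D) ((f x - f_ n x) ^+ 2)%:E)%E \is a fin_num
   /\ fine (\int[mu]_(x in D) ((f x - f_ n x) ^+ 2)%:E) < eps.
  have : \forall n \near \oo, (\int[mu]_(x in D) ((f x - f_ n x) ^+ 2)%:E)%E \is a fin_num
   /\ fine (\int[mu]_(x in D) ((f x - f_ n x) ^+ 2)%:E) < eps.
    near=> n; split; near: n => //.
  by move=> [N _ hN]; exists N; exact: (hN N (leqnn N)).
by exists (f_ n) => //; rewrite /dist2 -(fineK h1) lee_fin ltW.
Unshelve. all: by end_near.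
Qed.

Lemma P_scale c u : P u -> P (fun x => c * u x).
Proof. by move=> Pu; apply: (P_mul (P_cst c)). Qed.

Lemma L2_closureD f g : L2_closure f -> L2_closure g -> L2_closure (fun x => f x + g x).
Proof.
move=> [mf hf] [mg hg].
have mfg : measurable_fun setT (fun x => f x + g x) by exact: measurable_funD.
split => // eps e0; have e4 : 0 < eps / 4 by lra.
have [u Pu fu] := hf _ e4; have [v Pv gv] := hg _ e4.
exists (fun x => u x + v x); first exact: P_add.
have := @dist2_trans (fun x => f x + g x) (fun x => u x + g x) (fun x => u x + v x).
move=> /(_ mfg (measurable_funD (P_meas Pu) mg) (measurable_funD (P_meas Pu) (P_meas Pv))).
move=> /(_ _ _ (ltW e4) (ltW e4)).
have -> : dist2 (fun x => f x + g x) (fun x => u x + g x) = dist2 f u.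
  by apply: eq_integral => x _; congr ((_ ^+ 2)%:E); ring.
have -> : dist2 (fun x => u x + g x) (fun x => u x + v x) = dist2 g v.
  by apply: eq_integral => x _; congr ((_ ^+ 2)%:E); ring.
by move=> /(_ fu gv) /le_trans; apply; rewrite lee_fin; lra.
Qed.

Lemma dist2_mul f g (w : T -> R) (M a : R) : 0 < M -> 0 <= a -> (forall x, `|w x| <= M) ->
  measurable_fun setT f -> measurable_fun setT g -> measurable_fun setT w ->
  (dist2 f g <= (a / M ^+ 2)%:E)%E ->
  (dist2 (fun x => w x * f x)%R (fun x => w x * g x)%R <= a%:E)%E.
Proof.
move=> M0 a0 wM mf mg mw fg.
have m2 (k l : T -> R) : measurable_fun setT k -> measurable_fun setT l ->
    measurable_fun D (fun x => ((k x - l x) ^+ 2)%:E).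
  move=> mk ml; apply: (@measurable_EFinD (fun x => (k x - l x) ^+ 2)).
  by apply: measurable_funX; exact: measurable_funB.
apply: (@le_trans _ _ ((M ^+ 2)%:E * dist2 f g)%E); last first.
  apply: (@le_trans _ _ ((M ^+ 2)%:E * (a / M ^+ 2)%:E)%E).
    by rewrite lee_pmul2l // lte_fin exprn_gt0.
  by rewrite -EFinM lee_fin mulrC divfK // expf_neq0 // gt_eqF.
rewrite /dist2 -ge0_integralZl //; last first.
- by rewrite lee_fin sqr_ge0.
- by move=> x _; rewrite lee_fin sqr_ge0.
- exact: m2.
apply: ge0_le_integral => //; try by move=> x _; rewrite lee_fin sqr_ge0.
- by apply: m2; exact: measurable_funM.
- by apply: measurable_funeM; exact: m2.
- move=> x _; rewrite -EFinM lee_fin -mulrBr exprMn ler_wpM2r ?sqr_ge0 //.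
  by rewrite -(real_normK (num_real (w x))) ler_sqr ?nnegrE // ltW.
Qed.

Lemma L2_closureZ c f : L2_closure f -> L2_closure (fun x => c * f x).
Proof.
move=> [mf hf].
have mcf : measurable_fun setT (fun x => c * f x).
  by apply: measurable_funM => //; exact: measurable_cst.
split => // eps e0.
pose M := `|c| + 1; have M0 : 0 < M by rewrite ltr_wpDl.
have e1 : 0 < eps / M ^+ 2 by rewrite divr_gt0 // exprn_gt0.
have [u Pu fu] := hf _ e1.
exists (fun x => c * u x); first exact: P_scale.
apply: (@dist2_mul f u (fun=> c) M) => //; [exact: ltW| |exact: P_meas].
by move=> _; rewrite lerDl.
Qed.

(** In fg - uv = f(g - v) + (f - u)v the error f - u is multiplied by [v]. So [g] is approximated
    before [f], and the precision asked of [u] depends on the bound [K1] of the chosen [v]. *)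
Lemma L2_closureM f g (M : R) : (forall x, `|f x| <= M) ->
  L2_closure f -> L2_closure g -> L2_closure (fun x => f x * g x).
Proof.
move=> fM' [mf hf] [mg hg].
pose M1 := `|M| + 1; have M10 : 0 < M1 by rewrite ltr_wpDl.
have fM x : `|f x| <= M1.
  by rewrite (le_trans (fM' x)) // (le_trans (ler_norm _)) // lerDl.
have mfg : measurable_fun setT (fun x => f x * g x) by exact: measurable_funM.
split => // eps e0; have e4 : 0 < eps / 4 by lra.
have e5 : 0 < eps / 4 / M1 ^+ 2 by rewrite divr_gt0 // exprn_gt0.
have [v Pv gv] := hg _ e5.
have [K vK'] := P_bnd Pv.
pose K1 := `|K| + 1; have K10 : 0 < K1 by rewrite ltr_wpDl.
have vK x : `|v x| <= K1.
  by rewrite (le_trans (vK' x)) // (le_trans (ler_norm _)) // lerDl.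
have e6 : 0 < eps / 4 / K1 ^+ 2 by rewrite divr_gt0 // exprn_gt0.
have [u Pu fu] := hf _ e6.
exists (fun x => u x * v x); first exact: P_mul.
have h1 := dist2_mul M10 (ltW e4) fM mg (P_meas Pv) mf gv.
have h2 := dist2_mul K10 (ltW e4) vK mf (P_meas Pu) (P_meas Pv) fu.
have := @dist2_trans (fun x => f x * g x) (fun x => f x * v x) (fun x => u x * v x).
move=> /(_ mfg (measurable_funM mf (P_meas Pv)) (measurable_funM (P_meas Pu) (P_meas Pv))).
move=> /(_ _ _ (ltW e4) (ltW e4) h1).
have <- : dist2 (fun x => v x * f x) (fun x => v x * u x)
    = dist2 (fun x => f x * v x) (fun x => u x * v x).
  by apply: eq_integral => x _; congr ((_ ^+ 2)%:E); ring.
by move=> /(_ h2) /le_trans; apply; rewrite lee_fin; lra.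
Qed.

Lemma L2_closure_ae f g : measurable_fun setT f -> L2_closure g ->
  {ae mu, forall x, D x -> f x = g x} -> L2_closure f.
Proof.
move=> mf [mg hg] fg; apply: L2_closure_dist => // eps e0.
exists g; first by split.
rewrite (_ : dist2 f g = 0%E) ?lee_fin ?ltW //.
rewrite -(dist2_refl g); apply: ae_eq_integral => //.
- apply: (@measurable_EFinD (fun x => (f x - g x) ^+ 2)).
  by apply: measurable_funX; exact: measurable_funB.
- apply: (@measurable_EFinD (fun x => (g x - g x) ^+ 2)).
  by apply: measurable_funX; exact: measurable_funB.
- by apply: filterS fg => x h Dx; rewrite (h Dx).
Qed.

Definition L2_closure_sets : set (set T) :=
  [set A | measurable A /\ L2_closure (\1_A : T -> R)].

Lemma indic_le1 (A : set T) x : `|(\1_A x : R)| <= 1.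
Proof. by rewrite indicE; case: (_ \in _); rewrite ?normr1 ?normr0. Qed.

Lemma L2_closure_setC A : L2_closure_sets A -> L2_closure_sets (~` A).
Proof.
move=> [mA hA]; split; first exact: measurableC.
have -> : (\1_(~` A) : T -> R) = (fun x => 1 + (-1) * \1_A x).
  by apply/funext => x; rewrite !indicE in_setC; case: (x \in A) => /=; ring.
by apply: L2_closureD; [exact/L2_closureP/P_cst|exact: L2_closureZ].
Qed.

Lemma L2_closure_setI A B : L2_closure_sets A -> L2_closure_sets B ->
  L2_closure_sets (A `&` B).
Proof.
move=> [mA hA] [mB hB]; split; first exact: measurableI.
rewrite indicI; exact: (L2_closureM (indic_le1 A)).
Qed.

Lemma L2_closure_setU A B : L2_closure_sets A -> L2_closure_sets B ->
  L2_closure_sets (A `|` B).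
Proof.
move=> hA hB; rewrite -[A `|` B]setCK setCU; apply: L2_closure_setC.
by apply: L2_closure_setI; exact: L2_closure_setC.
Qed.

Lemma L2_closure_bigcup (F : nat -> set T) : (forall n, L2_closure_sets (F n)) ->
  L2_closure_sets (\bigcup_n F n).
Proof.
move=> hF; have mF : measurable (\bigcup_n F n).
  by apply: bigcup_measurable => n _; case: (hF n).
split => //.
have hS n : L2_closure_sets (\bigcup_(i < n) F i).
  rewrite bigcup_mkord; elim/big_ind: _ => //.
  - split => //; rewrite indic0; exact/L2_closureP/P_cst.
  - by move=> A B; exact: L2_closure_setU.
(* 4 bounds the square of a difference of two reals of modulus at most 1. *)
apply: (@L2_closure_lim (fun n => \1_(\bigcup_(i < n) F i)) _ (fun=> 4)).
- by move=> n; case: (hS n).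
- exact: measurable_indic.
- exact: integrable_cstD.
- move=> n x _; have := indic_le1 (\bigcup_n F n) x.
  have := indic_le1 (\bigcup_(i < n) F i) x.
  by rewrite !ler_norml => /andP[? ?] /andP[? ?]; nra.
- apply: aeW => x _; apply: cvg_near_cst.
  have [[k _ Fk]|nF] := pselect ((\bigcup_n F n) x).
    near=> n; rewrite !indicE !mem_set //; first by exists k.
    by exists k => //=; near: n; exact: nbhs_infty_gt.
  near=> n; rewrite !indicE !memNset // => -[k _ Fk]; apply: nF; by exists k.
Unshelve. all: by end_near.
Qed.

Lemma L2_closure_sigma_algebra : sigma_algebra setT L2_closure_sets.
Proof.
split.
- split => //; rewrite indic0; exact/L2_closureP/P_cst.
- by move=> A hA; rewrite setTD; exact: L2_closure_setC.
- exact: L2_closure_bigcup.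
Qed.

Lemma P_exp u k : P u -> P (fun x => u x ^+ k).
Proof.
move=> Pu; elim: k => [|k ih]; first exact: P_cst.
by under [X in P X]eq_fun do rewrite exprS; exact: P_mul.
Qed.

(* The Stone-type polynomials (1 - s^N)^(N 2^N) separate s < 1/2 from s >= 1/2. *)
Lemma L2_closure_ltr u c : P u -> L2_closure_sets [set x | u x < c].
Proof.
move=> Pu; have mu_ := P_meas Pu.
have mA : measurable [set x | u x < c].
  have := mu_ measurableT _ (measurable_itv (Interval -oo%O (BLeft c))).
  by rewrite setTI; congr measurable; apply/seteqP; split => x /=; rewrite in_itv.
split => //.
have [M hM] := P_bnd Pu.
pose K := `|M| + `|c| + 1.
have K0 : 0 < K by rewrite /K; have := normr_ge0 M; have := normr_ge0 c; lra.
(* An affine image of [u] with values in [0, 1] that sends the threshold [c] to 1/2. *)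
pose s x := 2^-1 + (2 * K)^-1 * (u x + - c).
have s01 x : 0 <= s x <= 1.
  have h : `|u x + - c| <= K.
    apply: le_trans (ler_normB _ _) _; rewrite /K.
    by have := hM x; have := ler_norm M; lra.
  have h2 : `|(2 * K)^-1 * (u x + - c)| <= 2^-1.
    rewrite normrM gtr0_norm ?invr_gt0 ?mulr_gt0 // mulrC ler_pdivrMr ?mulr_gt0 //.
    by rewrite mulKf.
  by move: h2; rewrite ler_norml /s => /andP[? ?]; apply/andP; split; lra.
have Ps : P s.
  apply: P_add; first exact: P_cst.
  by apply: P_scale; apply: P_add => //; exact: P_cst.
have slt x : (s x < 2^-1) = (u x < c).
  by rewrite /s gtrDl pmulr_rlt0 ?invr_gt0 ?mulr_gt0 // subr_lt0.
pose q N x := (1 + -1 * s x ^+ N) ^+ (N * 2 ^ N).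
have Pq N : P (q N).
  by apply: P_exp; apply: P_add; [exact: P_cst|apply: P_scale; exact: P_exp].
have q01 N x : 0 <= q N x <= 1.
  have /andP[s0 s1] := s01 x.
  have := exprn_ge0 N s0; have := exprn_ile1 N s0 s1 => h1 h0.
  by rewrite /q exprn_ge0 ?exprn_ile1 //; lra.
apply: (@L2_closure_lim q _ (fun=> 1)).
- by move=> n; exact: L2_closureP.
- exact: measurable_indic.
- exact: integrable_cstD.
- move=> n x _; have /andP[q0 q1] := q01 n x.
  by rewrite indicE; case: (_ \in _) => /=; nra.
- apply: aeW => x _; rewrite indicE.
  have /andP[s0 s1] := s01 x.
  have [ux|ux] := ltP (u x) c.
    rewrite mem_set //=.
    have sx : s x < 2^-1 by rewrite slt.
    (* Bernoulli's inequality gives q_N >= 1 - N t^N with t = 2s < 1. Writing t = r^2, one factor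
       r^N absorbs N because N r^N (1 - r) <= 1, and the other still tends to 0. *)
    pose t := 2 * s x; have t0 : 0 <= t by rewrite mulr_ge0.
    have t1 : t < 1 by rewrite /t; lra.
    pose r := Num.sqrt t.
    have r0 : 0 <= r by exact: sqrtr_ge0.
    have rr : r ^+ 2 = t by rewrite sqr_sqrtr.
    have r1 : r < 1 by rewrite -(ltr_pXn2r (ltn0Sn 1)) ?nnegrE // rr expr1n.
    have hN N : N%:R * r ^+ N * (1 - r) <= 1.
      have -> : N%:R * r ^+ N * (1 - r) = \sum_(i < N) r ^+ N * (1 - r).
        by rewrite sumr_const card_ord -[RHS]mulr_natl mulrA.
      apply: (@le_trans _ _ (\sum_(i < N) r ^+ i * (1 - r))).
        apply: ler_sum => i _; rewrite ler_wpM2r ?subr_ge0 ?(ltW r1) //.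
        by apply: ler_wiXn2l => //; [exact: ltW|exact: ltnW].
      rewrite -mulr_suml.
      by have := subrX1 r N; have := exprn_ge0 N r0; nra.
    have lowb N : 1 - (1 - r)^-1 * r ^+ N <= q N x.
      have h1 : 1 - N%:R * t ^+ N <= q N x.
        have -> : N%:R * t ^+ N = (N * 2 ^ N)%:R * s x ^+ N.
          by rewrite /t exprMn natrM natrX mulrA.
        rewrite /q; have := exprn_ile1 N s0 s1; have := exprn_ge0 N s0.
        move: (s x ^+ N) (N * 2 ^ N)%N => a k a0 a1.
        elim: k => [|k ih]; first by rewrite mul0r subr0 expr0.
        rewrite exprS -natr1.
        have k0 : (0 : R) <= k%:R by exact: ler0n.
        have : (1 + -1 * a) * (1 - k%:R * a) <= (1 + -1 * a) * (1 + -1 * a) ^+ k.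
          by apply: ler_wpM2l => //; lra.
        by apply: le_trans; nra.
      apply: le_trans h1; rewrite lerD2l lerN2.
      have -> : t ^+ N = r ^+ N * r ^+ N by rewrite -exprD addnn -mul2n exprM rr.
      rewrite mulrA mulrC [leRHS]mulrC ler_wpM2l ?exprn_ge0 //.
      by rewrite -[leRHS]mul1r ler_pdivlMr ?subr_gt0.
    apply: (@squeeze_cvgr _ _ _ _ (fun N => 1 - (1 - r)^-1 * r ^+ N) (fun=> 1)).
    + by near=> N; rewrite lowb /=; case/andP: (q01 N x).
    + rewrite -[X in _ --> X](subr0 1); apply: cvgB; first exact: cvg_cst.
      rewrite -[X in _ --> X](mulr0 (1 - r)^-1); apply: cvgM; first exact: cvg_cst.
      by apply: cvg_expr; rewrite ger0_norm.
    + exact: cvg_cst.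
  rewrite memNset /=; last by apply/negP; rewrite -leNgt.
  have sx : 2^-1 <= s x by rewrite leNgt slt -leNgt.
  (* With a = s^N and k = N 2^N, (1 - a)^k (1 + a)^k <= 1, while (1 + a)^k >= 1 + k a >= 1 + N
     because 2s >= 1. *)
  apply: (@squeeze_cvgr _ _ _ _ (fun=> 0) (fun N => N.+1%:R^-1)).
  + near=> N; have /andP[-> _] /= := q01 N x.
    rewrite -[leRHS]mul1r ler_pdivlMr ?ltr0n // /q.
    have hN : N%:R <= (N * 2 ^ N)%:R * s x ^+ N.
      rewrite natrM natrX -mulrA -exprMn -[leLHS]mulr1 ler_wpM2l //.
      by rewrite exprn_ege1 //; lra.
    have := exprn_ile1 N s0 s1; have := exprn_ge0 N s0.
    move: (s x ^+ N) (N * 2 ^ N)%N hN => a k hN a0 a1.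
    have h2 : 1 + k%:R * a <= (1 + a) ^+ k.
      elim: (k) => [|j ih]; first by rewrite mul0r addr0 expr0.
      rewrite exprS -natr1.
      have : (1 + a) * (1 + j%:R * a) <= (1 + a) * (1 + a) ^+ j.
        by apply: ler_wpM2l => //; lra.
      have j0 : (0 : R) <= j%:R by exact: ler0n.
      by apply: le_trans; nra.
    have h3 : (1 + -1 * a) ^+ k * (1 + a) ^+ k <= 1.
      by rewrite -exprMn; apply: exprn_ile1; nra.
    have h4 : N.+1%:R <= (1 + a) ^+ k by rewrite -natr1; lra.
    apply: le_trans h3; apply: ler_wpM2l => //.
    by apply: exprn_ge0; lra.
  + exact: cvg_cst.
  + exact: cvg_harmonic.
Unshelve. all: by end_near.
Qed.

Lemma L2_closure_set_ae A B : measurable A -> L2_closure_sets B ->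
  {ae mu, forall x, D x -> A x <-> B x} -> L2_closure_sets A.
Proof.
move=> mA [mB hB] AB; split => //; apply: (L2_closure_ae _ hB).
  exact: measurable_indic.
apply: filterS AB => x h Dx; rewrite !indicE; congr ((nat_of_bool _)%:R).
by apply/idP/idP => /[!inE] /(h Dx).
Qed.

Hypothesis gen : forall A, measurable A -> L2_closure_sets A.

(** The positive and negative parts are limits of simple functions lying below them, so the squared
    errors are dominated by the square of the part itself. *)
Lemma L2_closure_fun f : measurable_fun setT f ->
  mu.-integrable D (fun x => (f x ^+ 2)%:E) -> L2_closure f.
Proof.
have hpos g : (forall x, 0 <= g x) -> measurable_fun setT g ->
    mu.-integrable D (fun x => (g x ^+ 2)%:E) -> L2_closure g.
  move=> g0 mg ig.
  have mEg : measurable_fun setT (EFin \o g) by exact/measurable_EFinP.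
  pose a := nnsfun_approx measurableT mEg.
  have ale n x : a n x <= g x.
    have := @le_approx _ _ _ setT (EFin \o g) n x.
    rewrite -(nnsfun_approxE measurableT mEg) lee_fin; apply => //.
    by move=> t _; rewrite lee_fin.
  apply: (@L2_closure_lim (fun n => a n) g (fun x => g x ^+ 2)) => //.
  - move=> n; have -> : (a n : T -> R) = (fun x => \sum_(r \in range (a n)) r * \1_(a n @^-1` [set r]) x).
      by apply/funext => x; rewrite [LHS]fimfunE.
    have fr : finite_set (range (a n)) by exact: fimfunP.
    under [X in L2_closure X]eq_fun do rewrite fsbig_finite //.
    elim: (finmap.enum_fset _) => [|r s ih].
      under [X in L2_closure X]eq_fun do rewrite big_nil.
      exact/L2_closureP/P_cst.
    under [X in L2_closure X]eq_fun do rewrite big_cons.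
    apply: L2_closureD => //; apply: L2_closureZ.
    by apply: (gen _).2; exact: measurable_sfunP.
  - move=> n x _; have := ale n x; have : 0 <= a n x by [].
    by have := g0 x; nra.
  - apply: aeW => x _.
    have f0 y : [set: T] y -> (0 <= (EFin \o g) y)%E by rewrite lee_fin.
    by have /fine_cvgP[_] := cvg_nnsfun_approx measurableT mEg f0 (I : setT x).
move=> mf i2.
have ipm (g : T -> R) : measurable_fun setT g -> (forall x, `|g x| <= `|f x|) ->
    mu.-integrable D (fun x => (g x ^+ 2)%:E).
  move=> mg gf; apply: (integrable_ae_le mD _ i2).
    exact: measurable_funX.
  apply: aeW => x _; rewrite ger0_norm ?sqr_ge0 //.
  by rewrite -(real_normK (num_real (g x))) -(real_normK (num_real (f x))) ler_sqr ?nnegrE.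
have -> : f = (fun x => f^\+ x + (-1) * f^\- x).
  by apply/funext => x; rewrite mulN1r -{1}(funrposBneg f).
have mp := measurable_funrpos mf; have mn := measurable_funrneg mf.
have hn x : `|f x| = f^\+ x + f^\- x by rewrite -[LHS]/((Num.norm \o f) x) -funrposDneg.
apply: L2_closureD; last apply: L2_closureZ; apply: hpos => //; try exact: funrpos_ge0; try exact: funrneg_ge0.
- by apply: ipm => // x; rewrite hn ger0_norm ?funrpos_ge0 // lerDl funrneg_ge0.
- by apply: ipm => // x; rewrite hn ger0_norm ?funrneg_ge0 // lerDr funrpos_ge0.
Qed.

End L2Density.
Section TrigPolynomials.
Variable R : realType.
Local Notation C := R[i].
Local Notation Im := (@complex.Im R).
Local Notation T2 := (T2 R).
Local Notation mu := (@mu2 R).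
Local Notation D := (@sqT2 R).

Definition chr2 (m n : int) (p : T2) : C := expi (m%:~R * p.1 + n%:~R * p.2).

(** A list of coefficients with frequencies, repetitions allowed: sums are concatenations and
    restriction to a set of frequencies is a filter. *)
Definition tpoly (s : seq (C * (int * int))) (p : T2) : C :=
  \sum_(t <- s) t.1 * chr2 t.2.1 t.2.2 p.

Definition is_tpoly (f : T2 -> C) := exists s, f = tpoly s.

Lemma chr2D m n m' n' p : chr2 m n p * chr2 m' n' p = chr2 (m + m') (n + n') p.
Proof. by rewrite /chr2 -expiD; congr expi; rewrite !intrD; ring. Qed.

Lemma chr2_0 p : chr2 0 0 p = 1.
Proof. by rewrite /chr2 !mul0r addr0 expi0. Qed.

Lemma is_tpoly_cst c : is_tpoly (fun=> c).
Proof.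
by exists [:: (c, (0, 0))]; apply/funext => p; rewrite /tpoly big_seq1 chr2_0 mulr1.
Qed.

Lemma is_tpoly_chr2 m n : is_tpoly (chr2 m n).
Proof.
by exists [:: (1, (m, n))]; apply/funext => p; rewrite /tpoly big_seq1 mul1r.
Qed.

Lemma is_tpolyD f g : is_tpoly f -> is_tpoly g -> is_tpoly (fun p => f p + g p).
Proof.
by move=> [s ->] [t ->]; exists (s ++ t); apply/funext => p; rewrite /tpoly big_cat.
Qed.

Lemma is_tpolyM f g : is_tpoly f -> is_tpoly g -> is_tpoly (fun p => f p * g p).
Proof.
move=> [s ->] [t ->].
exists [seq (a.1 * b.1, (a.2.1 + b.2.1, a.2.2 + b.2.2)) | a <- s, b <- t].
apply/funext => p; rewrite /tpoly big_allpairs_dep big_distrl /=; apply: eq_bigr => a _.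
rewrite big_distrr /=; apply: eq_bigr => b _.
by rewrite -chr2D mulrACA.
Qed.

Lemma measurable_fst_real : measurable_fun setT (fun p : T2 => p.1 : R).
Proof. exact: measurable_fst. Qed.
Lemma measurable_snd_real : measurable_fun setT (fun p : T2 => p.2 : R).
Proof. exact: measurable_snd. Qed.

Lemma mfunC_chr2 m n : mfunC (chr2 m n).
Proof.
by apply: mfunC_expi; apply: measurable_funD; apply: measurable_funM => //.
Qed.

Lemma mfunC_tpoly s : mfunC (tpoly s).
Proof.
apply: (@mfunC_sum _ _ _ _ s (fun t p => t.1 * chr2 t.2.1 t.2.2 p)) => t.
by apply: mfunCM; [exact: mfunC_cst|exact: mfunC_chr2].
Qed.

Lemma cabs_chr2 m n p : cabs (chr2 m n p) = 1.
Proof. exact: cabs_expi. Qed.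

Lemma tpoly_bnd s : exists M : R, forall p, cabs (tpoly s p) <= M.
Proof.
exists (\sum_(t <- s) cabs t.1) => p; apply: le_trans (cabs_sum _ _ _) _.
by apply: ler_sum => t _; rewrite cabsM cabs_chr2 mulr1.
Qed.

Lemma measurable_sqT : measurable (@sqT R : set (measurableTypeR R)).
Proof. exact: measurable_itv. Qed.

Lemma measurable_sqT2 : measurable D.
Proof. by apply: measurableX; exact: measurable_sqT. Qed.

Lemma leb_sqT : leb R (@sqT R) = (2 * pi)%:E.
Proof.
have h := @lebesgue_measure_itv R (Interval (BLeft 0) (BRight (2 * pi))).
apply: etrans h _; rewrite /= lte_fin mulr_gt0 ?pi_gt0 //.
by rewrite -EFinB subr0.
Qed.

Lemma leb_sqT_fin : (leb R (@sqT R) < +oo)%E.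
Proof. by rewrite leb_sqT ltry. Qed.

Lemma mu2_sqT2 : mu D = ((2 * pi) ^+ 2)%:E.
Proof.
have h := @product_measure1E _ _ _ _ R (leb R) (@lebesgue_measure R) _ _ measurable_sqT measurable_sqT.
by apply: etrans h _; rewrite -[X in (_ * X)%E]/(leb R (@sqT R)) leb_sqT expr2.
Qed.

Lemma mu2_sqT2_fin : (mu D < +oo)%E.
Proof. by rewrite mu2_sqT2 ltry. Qed.

(** The density argument uses the order of the reals, hence needs an algebra of real functions;
    complex functions are recovered from their real and imaginary parts. *)
Definition real_tpoly (u : T2 -> R) := is_tpoly (fun p => (u p)%:C%C).

Lemma real_tpoly_meas u : real_tpoly u -> measurable_fun setT u.
Proof.
move=> [s hs]; have [+ _] := mfunC_tpoly s.
by rewrite -hs.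
Qed.

Lemma real_tpoly_bnd u : real_tpoly u -> exists M : R, forall x, `|u x| <= M.
Proof.
move=> [s hs]; have [M hM] := tpoly_bnd s; exists M => p.
by rewrite -cabs_real; have := hM p; rewrite -hs.
Qed.

Lemma real_tpoly_cst c : real_tpoly (fun=> c).
Proof. exact: is_tpoly_cst. Qed.

Lemma real_tpolyD u v : real_tpoly u -> real_tpoly v -> real_tpoly (fun x => u x + v x).
Proof.
move=> hu hv; have := is_tpolyD hu hv; congr is_tpoly.
by apply/funext => p; rewrite rmorphD.
Qed.

Lemma real_tpolyM u v : real_tpoly u -> real_tpoly v -> real_tpoly (fun x => u x * v x).
Proof.
move=> hu hv; have := is_tpolyM hu hv; congr is_tpoly.
by apply/funext => p; rewrite rmorphM.
Qed.

Lemma cos_expi (t : R) : (cos t)%:C%C = 2^-1 * expi t + 2^-1 * expi (- t).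
Proof. by rewrite expiN -mulrDr addcJ mulKf // pnatr_eq0. Qed.

Lemma sin_expi (t : R) : (sin t)%:C%C = (- 'i%C / 2) * expi t + ('i%C / 2) * expi (- t).
Proof.
rewrite expiN.
have -> : - 'i%C / 2 * expi t + 'i%C / 2 * (expi t)^*%C = - ('i%C / 2) * (expi t - (expi t)^*%C).
  by ring.
rewrite subcJ.
have -> : - ('i%C / 2) * (2%:R * (Im (expi t))%:C%C * 'i%C) = - ('i%C ^+ 2) * (Im (expi t))%:C%C :> C.
  by field.
by rewrite sqr_i opprK mul1r.
Qed.

Lemma real_tpoly_cos1 : real_tpoly (fun p => cos p.1).
Proof.
rewrite /real_tpoly; have -> : (fun p : T2 => (cos p.1)%:C%C) =
   (fun p => 2^-1 * chr2 1 0 p + 2^-1 * chr2 (-1) 0 p).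
  by apply/funext => p; rewrite cos_expi /chr2 mul0r !addr0 mul1r mulN1r.
by apply: is_tpolyD; apply: is_tpolyM; try exact: is_tpoly_cst; exact: is_tpoly_chr2.
Qed.

Lemma real_tpoly_cos2 : real_tpoly (fun p => cos p.2).
Proof.
rewrite /real_tpoly; have -> : (fun p : T2 => (cos p.2)%:C%C) =
   (fun p => 2^-1 * chr2 0 1 p + 2^-1 * chr2 0 (-1) p).
  by apply/funext => p; rewrite cos_expi /chr2 mul0r !add0r mul1r mulN1r.
by apply: is_tpolyD; apply: is_tpolyM; try exact: is_tpoly_cst; exact: is_tpoly_chr2.
Qed.

Lemma real_tpoly_sin1 : real_tpoly (fun p => sin p.1).
Proof.
rewrite /real_tpoly; have -> : (fun p : T2 => (sin p.1)%:C%C) =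
   (fun p => (- 'i%C / 2) * chr2 1 0 p + ('i%C / 2) * chr2 (-1) 0 p).
  by apply/funext => p; rewrite sin_expi /chr2 mul0r !addr0 mul1r mulN1r.
by apply: is_tpolyD; apply: is_tpolyM; try exact: is_tpoly_cst; exact: is_tpoly_chr2.
Qed.

Lemma real_tpoly_sin2 : real_tpoly (fun p => sin p.2).
Proof.
rewrite /real_tpoly; have -> : (fun p : T2 => (sin p.2)%:C%C) =
   (fun p => (- 'i%C / 2) * chr2 0 1 p + ('i%C / 2) * chr2 0 (-1) p).
  by apply/funext => p; rewrite sin_expi /chr2 mul0r !add0r mul1r mulN1r.
by apply: is_tpolyD; apply: is_tpolyM; try exact: is_tpoly_cst; exact: is_tpoly_chr2.
Qed.

(** The sign of the sine tells the two half circles apart; the cosine decreases on the first and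
    increases on the second. Half-lines thus become finite combinations of level sets of
    trigonometric polynomials. *)
Lemma ray_trig (a x : R) : 0 <= a < 2 * pi -> 0 <= x < 2 * pi ->
  (a < x) = (if a <= pi then (sin x < 0) || ((0 <= sin x) && (cos x < cos a))
             else (sin x < 0) && (cos a < cos x)).
Proof.
move=> /andP[a0 a2] /andP[x0 x2].
have pi0 := pi_gt0 R.
have sneg t : pi < t -> t < 2 * pi -> sin t < 0.
  move=> t1 t2; rewrite -(subrK pi t) sinDpi oppr_lt0; apply: sin_gt0_pi; lra.
have cper t : cos t = cos (2 * pi - t) :> R.
  by rewrite mulr_natl addrC cosD2pi cosN.
have [api|api] := leP a pi; have [xpi|xpi] := leP x pi.
- have sx : 0 <= sin x by apply: sin_ge0_pi; lra.
  by rewrite [sin x < 0]ltNge sx /= ltr_cos // in_itv /=; apply/andP; split; lra.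
- by rewrite sneg //=; lra.
- have sx : 0 <= sin x by apply: sin_ge0_pi; lra.
  by rewrite [sin x < 0]ltNge sx /=; apply/negbTE; rewrite -leNgt; lra.
- rewrite sneg //= (cper a) (cper x) ltr_cos; first by rewrite ltrD2l ltrN2.
  + by rewrite in_itv /=; lra.
  + by rewrite in_itv /=; lra.
Qed.

Local Notation clsets := (L2_closure_sets mu D real_tpoly).

Let Ccompl := @L2_closure_setC _ _ _ mu D measurable_sqT2 _ real_tpoly_meas real_tpoly_cst
  real_tpolyD real_tpolyM.
Let Cinter := @L2_closure_setI _ _ _ mu D measurable_sqT2 _ real_tpoly_meas real_tpoly_bnd
  real_tpolyM.
Let Clt := @L2_closure_ltr _ _ _ mu D measurable_sqT2 mu2_sqT2_fin _ real_tpoly_meas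
   real_tpoly_bnd real_tpoly_cst real_tpolyD real_tpolyM.

Let Cunion := @L2_closure_setU _ _ _ mu D measurable_sqT2 _ real_tpoly_meas real_tpoly_bnd
  real_tpoly_cst real_tpolyD real_tpolyM.
Let Csigma := @L2_closure_sigma_algebra _ _ _ mu D measurable_sqT2 mu2_sqT2_fin _
  real_tpoly_meas real_tpoly_bnd real_tpoly_cst real_tpolyD real_tpolyM.

Lemma clsets_cst (b : Prop) : clsets [set p : T2 | b].
Proof.
have h0 : clsets set0 by case: Csigma.
have [hb|hb] := pselect b.
- suff -> : [set p : T2 | b] = ~` set0 by exact: Ccompl.
  by rewrite setC0; apply/seteqP; split.
- by suff -> : [set p : T2 | b] = set0 by []; apply/seteqP; split.
Qed.

(** The coordinate value 2 pi must be discarded as a null set: sine and cosine take there the same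
    values as at 0, so [ray_trig] fails. *)
Lemma clsets_ray (pr : T2 -> R) (a : R) : measurable_fun setT pr ->
  real_tpoly (fun p => cos (pr p)) -> real_tpoly (fun p => sin (pr p)) ->
  (forall p, D p -> 0 <= pr p <= 2 * pi) -> {ae mu, forall p, pr p <> 2 * pi} ->
  clsets [set p | a < pr p].
Proof.
move=> mpr hc hs hD hne.
have mray : measurable [set p | a < pr p].
  have := mpr measurableT _ (measurable_itv (Interval (BRight a) +oo%O)).
  by rewrite setTI; congr measurable; apply/seteqP; split => x /=; rewrite in_itv /= andbT.
have hneg u : real_tpoly u -> real_tpoly (fun p => -1 * u p).
  by move=> hu; apply: (real_tpolyM (real_tpoly_cst (-1))).
have Cgt u c : real_tpoly u -> clsets [set x | c < u x].
  move=> /hneg /Clt => /(_ (- c)); congr clsets.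
  by apply/seteqP; split => x /=; rewrite mulN1r ltrN2.
have Cge u c : real_tpoly u -> clsets [set x | c <= u x].
  move=> /Clt => /(_ c) /Ccompl; congr clsets.
  by apply/seteqP; split => x /=; rewrite leNgt => /negP.
have [a0|a0] := ltP a 0.
  apply: (L2_closure_set_ae measurable_sqT2 real_tpoly_meas mray (clsets_cst True)) => //.
  apply: aeW => p /hD /andP[h0 _]; split => //= _; exact: lt_le_trans h0.
have [a2|a2] := leP (2 * pi) a.
  apply: (L2_closure_set_ae measurable_sqT2 real_tpoly_meas mray (clsets_cst False)) => //.
  apply: aeW => p /hD /andP[_ h0]; split => //=.
  by rewrite ltNge (le_trans h0).
pose B := if a <= pi then
   [set p | sin (pr p) < 0] `|` ([set p | 0 <= sin (pr p)] `&` [set p | cos (pr p) < cos a])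
 else [set p | sin (pr p) < 0] `&` [set p | cos a < cos (pr p)].
have hB : clsets B.
  rewrite /B; case: ifP => _.
  - apply: Cunion; first exact: (Clt _ hs).
    by apply: Cinter; [exact: Cge|exact: (Clt _ hc)].
  - by apply: Cinter; [exact: (Clt _ hs)|exact: Cgt].
apply: (L2_closure_set_ae measurable_sqT2 real_tpoly_meas mray hB) => //.
apply: filterS hne => p hp /hD /andP[p0 p2].
rewrite /= (ray_trig (a := a)) ?a0 //; last first.
  by rewrite p0 lt_neqAle p2 andbT; apply/eqP.
rewrite /B; case: ifP => _ /=; split.
- by move=> /orP[->|/andP[-> ->]]; [left|right].
- by move=> [->|[-> ->]] //; rewrite orbT.
- by move=> /andP[].
- by move=> [-> ->].
Qed.

Lemma ae_fst_neq (c : R) : {ae mu, forall p, p.1 <> c}.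
Proof.
exists ([set c] `*` setT); split.
- by apply: measurableX => //; exact: measurable_set1.
- have h := @product_measure1E _ _ _ _ R (leb R) (@lebesgue_measure R) _ _
    (measurable_set1 c) measurableT.
  apply: etrans h _; rewrite (_ : leb R [set c] = 0%E) ?mul0e //.
  exact: lebesgue_measure_set1.
- by move=> p /= /contrapT ->.
Qed.

Lemma ae_snd_neq (c : R) : {ae mu, forall p, p.2 <> c}.
Proof.
exists (setT `*` [set c]); split.
- by apply: measurableX => //; exact: measurable_set1.
- have h := @product_measure1E _ _ _ _ R (leb R) (@lebesgue_measure R) _ _
    measurableT (measurable_set1 c).
  have e : leb R [set c] = 0%E by exact: lebesgue_measure_set1.
  by apply: etrans h _; rewrite -[X in (_ * X)%E]/(leb R [set c]) e mule0.
- by move=> p /= /contrapT ->.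
Qed.

(** The sets with preimage in the class form a sigma-algebra, and the open half-lines generate the
    Borel sets. *)
Lemma clsets_preimage (pr : T2 -> R) : measurable_fun setT pr ->
  (forall a, clsets [set p | a < pr p]) ->
  forall A : set (measurableTypeR R), measurable A -> clsets (pr @^-1` A).
Proof.
move=> mpr hray A.
rewrite (_ : measurable A = (@RGenOInfty.G R).-sigma.-measurable A); last first.
  by rewrite -RGenOInfty.measurableE.
apply: (@smallest_sub _ (sigma_algebra setT) (@RGenOInfty.G R)
  [set A | clsets (pr @^-1` A)]).
- have [h0 hC hU] := Csigma; split.
  + by rewrite /= preimage_set0.
  + move=> B hB /=; rewrite setTD preimage_setC; exact: Ccompl.
  + by move=> F hF /=; rewrite preimage_bigcup; exact: hU.
- move=> _ [a ->] /=; have := hray a; congr clsets.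
  by apply/seteqP; split => x /=; rewrite in_itv /= andbT.
Qed.

Lemma clsets_measurable (A : set T2) : measurable A -> clsets A.
Proof.
have h1 := @clsets_preimage (fun p => p.1) measurable_fst_real (fun a =>
  @clsets_ray (fun p => p.1) a measurable_fst_real real_tpoly_cos1 real_tpoly_sin1 _
   (ae_fst_neq (2 * pi))).
have h2 := @clsets_preimage (fun p => p.2) measurable_snd_real (fun a =>
  @clsets_ray (fun p => p.2) a measurable_snd_real real_tpoly_cos2 real_tpoly_sin2 _
   (ae_snd_neq (2 * pi))).
rewrite measurable_prod_measurableType.
apply: smallest_sub; first exact: Csigma.
move=> _ [B mB] [B' mB'] <-.
rewrite (_ : B `*` B' = (fun p => p.1) @^-1` B `&` (fun p => p.2) @^-1` B') //.
apply: Cinter; [apply: h1|apply: h2] => //.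
- by move=> p [+ _]; rewrite /sqT /= in_itv.
- by move=> p [_ +]; rewrite /sqT /= in_itv.
Qed.

Lemma tpoly_dense (f : T2 -> C) (eps : R) : L2 f -> 0 < eps ->
  exists s, (\int[mu]_(p in D) (cabs (f p - tpoly s p) ^+ 2)%:E <= eps%:E)%E.
Proof.
move=> [[mr mi] h2] e0.
have e2 : 0 < eps / 2 by lra.
have cl (h : T2 -> R) : measurable_fun setT h -> (forall p, `|h p| <= cabs (f p)) ->
    L2_closure mu D real_tpoly h.
  move=> mh hf; apply: (L2_closure_fun measurable_sqT2 real_tpoly_meas real_tpoly_cst
    real_tpolyD real_tpolyM clsets_measurable) => //.
  apply: (integrable_ae_le measurable_sqT2 _ h2).
    exact: measurable_funX.
  apply: aeW => p _; rewrite ger0_norm ?sqr_ge0 // -(real_normK (num_real (h p))).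
  by rewrite ler_sqr ?nnegrE ?cabs_ge0.
have [_ /(_ _ e2)[u [su hu] fu]] := cl _ mr (fun p => normr_Re_le (f p)).
have [_ /(_ _ e2)[v hv fv]] := cl _ mi (fun p => normr_Im_le (f p)).
have [s hs] := is_tpolyD (ex_intro _ su hu) (is_tpolyM (is_tpoly_cst 'i%C) hv).
have mu_ := real_tpoly_meas (ex_intro _ su hu); have mv := real_tpoly_meas hv.
have m2 (k l : T2 -> R) : measurable_fun setT k -> measurable_fun setT l ->
    measurable_fun D (fun x => ((k x - l x) ^+ 2)%:E).
  move=> mk ml; apply: (@measurable_EFinD _ _ _ D (fun x => (k x - l x) ^+ 2)).
  by apply: measurable_funX; exact: measurable_funB.
exists s; rewrite -hs.
have -> : (eps%:E = (eps / 2)%:E + (eps / 2)%:E)%E by rewrite -EFinD; congr EFin; lra.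
apply: (le_trans _ (leeD fu fv)); rewrite /dist2 -ge0_integralD //.
- rewrite le_eqVlt; apply/orP; left; apply/eqP; apply: eq_integral => p _.
  rewrite cabs_sqr -EFinD; congr ((_ ^+ 2 + _ ^+ 2)%:E).
  + by case: (f p) => a b /=; simpc.
  + by case: (f p) => a b /=; simpc.
all: by [exact: m2|exact: measurable_sqT2|move=> p _; rewrite lee_fin sqr_ge0].
Qed.

End TrigPolynomials.

(** * Fubini's theorem on rectangles and null sets of slices *)

Section FubiniRectangle.
Context d1 d2 (T1 : measurableType d1) (T2 : measurableType d2) (R : realType).
Variables (m1 : {sigma_finite_measure set T1 -> \bar R}).
Variables (m2 : {sigma_finite_measure set T2 -> \bar R}).
Variables (A : set T1) (B : set T2).
Hypotheses (mA : measurable A) (mB : measurable B).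
Implicit Types h : T1 * T2 -> R.

(** No integrability is assumed: [Rintegral] is [fine] of an extended integral, and Tonelli's
    theorem makes the integrals of the positive and negative parts measurable in the parameter. *)
Lemma measurable_Rintegral_section h : measurable_fun setT h ->
  measurable_fun setT (fun y => Rintegral m1 A (fun x => h (x, y))).
Proof.
move=> mh.
pose k : T1 * T2 -> \bar R := (EFin \o h) \_ (A `*` setT).
have mk : measurable_fun setT k.
  apply/(measurable_restrictT (EFin \o h)); first exact: measurableX.
  by apply: measurable_funTS; exact/measurable_EFinP.
have mG : measurable_fun setT (fun y => (\int[m1]_x k (x, y))%E).
  have -> : (fun y => (\int[m1]_x k (x, y))%E) =
     (fubini_G m1 (fun p => (k^\+ p)%E) \- fubini_G m1 (fun p => (k^\- p)%E))%E.
    apply/funext => y; rewrite integralE /fubini_G.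
    by congr (_ - _)%E; apply: eq_integral => x _; rewrite ?funeposE ?funenegE.
  apply: emeasurable_funB; apply: measurable_fun_fubini_tonelli_G => //.
  - exact: measurable_funepos.
  - exact: measurable_funeneg.
have -> : (fun y => Rintegral m1 A (fun x => h (x, y)))
   = fine \o (fun y => (\int[m1]_x k (x, y))%E).
  apply/funext => y; rewrite /Rintegral /= integral_mkcond; congr fine.
  apply: eq_integral => x _; rewrite /k /patch.
  by rewrite in_setX in_setT andbT.
by apply: measurableT_comp => //; exact: fine_measurable.
Qed.

(** Extension by zero reduces to the whole product. On the null set of sections with infinite
    integral [Rintegral] takes the default value of [fine], so the identification with the extended
    integral holds almost everywhere only. *)
Lemma Fubini_rect h : measurable_fun setT h ->
  (m1 \x m2)%E.-integrable (A `*` B) (EFin \o h) ->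
  m2.-integrable B (fun y => (Rintegral m1 A (fun x => h (x, y)))%:E) /\
  Rintegral (m1 \x m2)%E (A `*` B) h =
    Rintegral m2 B (fun y => Rintegral m1 A (fun x => h (x, y))).
Proof.
move=> mh ih.
have mAB : measurable (A `*` B) by exact: measurableX.
pose k : T1 * T2 -> \bar R := (EFin \o h) \_ (A `*` B).
have ik : (m1 \x m2)%E.-integrable setT k by exact/(integrable_mkcond _ mAB).
have kE y : (\int[m1]_x k (x, y))%E =
    ((fun y => \int[m1]_(x in A) (h (x, y))%:E)%E \_ B) y.
  rewrite /k /patch; case: ifPn => yB.
    rewrite [RHS]integral_mkcond; apply: eq_integral => x _.
    by rewrite /patch in_setX yB andbT.
  by apply: integral0_eq => x _; rewrite in_setX (negbTE yB) andbF.
have mk : measurable_fun setT k := measurable_int _ ik.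
have iG : m2.-integrable setT (fubini_G m1 k).
  apply/integrableP; split; first exact: (measurable_fubini_G ik).
  apply: (@le_lt_trans _ _ (\int[m2]_y \int[m1]_x `|k (x, y)|)%E); last first.
    have hh := @integrable21ltyP _ _ _ _ _ m1 m2 k mk. exact: (iffLR hh ik).
  have mak : measurable_fun setT (fun p => `|k p|%E) by exact: measurableT_comp.
  apply: ge0_le_integral => //.
  - by apply: measurableT_comp => //; exact: (measurable_fubini_G ik).
  - by apply: (measurable_fun_fubini_tonelli_G (fun p => `|k p|%E)) => //.
  - move=> y _; apply: le_abse_integral => //.
    exact: (measurableT_comp mk (pair2_measurable y)).
have aeG := integrable_ae measurableT iG.
have mR := measurable_Rintegral_section mh.
have aeE : {ae m2, forall y, B y -> (\int[m1]_(x in A) (h (x, y))%:E)%E =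
    (Rintegral m1 A (fun x => h (x, y)))%:E}.
  apply: filterS aeG => y /(_ I); rewrite /fubini_G kE => + By.
  by rewrite /patch mem_set // => /fineK <-.
have mI : measurable_fun B (fun y => (\int[m1]_(x in A) (h (x, y))%:E)%E).
  have := measurable_int _ iG; rewrite /fubini_G.
  under [X in measurable_fun _ X]eq_fun do rewrite kE.
  by move=> /(measurable_restrictT _ mB).
have iI : m2.-integrable B (fun y => (\int[m1]_(x in A) (h (x, y))%:E)%E).
  apply/(integrable_mkcond _ mB); move: iG; rewrite /fubini_G.
  by under [X in integrable _ _ X]eq_fun do rewrite kE.
have mRB : measurable_fun B (fun y => (Rintegral m1 A (fun x => h (x, y)))%:E).
  by apply/measurable_EFinP; exact: measurable_funS mR.
split.
  apply/integrableP; split => //; case/integrableP: iI => _; apply: le_lt_trans.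
  rewrite le_eqVlt; apply/orP; left; apply/eqP; apply: ae_eq_integral => //.
  - exact: measurableT_comp.
  - exact: measurableT_comp.
  - by apply: filterS aeE => y hy /hy ->.
rewrite {1}/Rintegral integral_mkcond -/k -integral21_prod_meas1 // /fubini_G.
under eq_integral do rewrite kE.
rewrite -integral_mkcond; congr fine; apply: ae_eq_integral => //.
Qed.

(** Tonelli's theorem for the indicator of a null set: the measures of its sections integrate to
    0. *)
Lemma ae_section (Q : T1 * T2 -> Prop) :
  {ae (m1 \x m2)%E, forall p, Q p} -> {ae m2, forall y, {ae m1, forall x, Q (x, y)}}.
Proof.
move=> [N [mN N0 hN]].
have mI : measurable_fun setT (fun p : T1 * T2 => (\1_N p : R)%:E).
  by apply/measurable_EFinP; exact: measurable_indic.
have h0 : (\int[m2]_y (m1 (ysection N y)))%E = 0%E.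
  transitivity (\int[(m1 \x m2)%E]_p (\1_N p)%:E)%E; last first.
    by rewrite integral_indic // setIT.
  rewrite (fubini_tonelli2 _ mI); last by move=> p; rewrite lee_fin.
  apply: eq_integral => y _; rewrite /fubini_G.
  transitivity (\int[m1]_x (\1_(ysection N y) x)%:E)%E.
    by rewrite integral_indic ?setIT //; exact: measurable_ysection.
  by apply: eq_integral => x _; rewrite !indicE mem_ysection.
have mS : measurable_fun setT (fun y => m1 (ysection N y)).
  exact: measurable_fun_ysection.
have : ae_eq m2 setT (fun y => m1 (ysection N y)) (cst 0%E).
  apply/(ae_eq_integral_abs m2 measurableT mS).
  by rewrite -h0; apply: eq_integral => y _; rewrite gee0_abs.
apply: filterS => y /(_ I) hy.
exists (ysection N y); split => //; first exact: measurable_ysection.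
by move=> x /= nQ; apply/ysectionP; exact: hN.
Qed.

End FubiniRectangle.

(** * Analyticity in one variable *)

Section Geometric.
Variable R : realType.
Local Notation C := R[i].

Lemma one_sub_neq0 (z u : C) : cabs z < 1 -> cabs u <= 1 -> 1 - z * u != 0.
Proof.
move=> z1 u1; rewrite subr_eq0; apply/eqP => h.
have : cabs (1 : C) < 1.
  rewrite h cabsM; apply: le_lt_trans z1.
  by rewrite -[leRHS]mulr1 ler_wpM2l ?cabs_ge0.
by rewrite cabs1 ltxx.
Qed.

Lemma one_sub_lb (z u : C) : cabs u <= 1 -> 1 - cabs z <= cabs (1 - z * u).
Proof.
move=> u1; have := cabsD (1 - z * u) (z * u); rewrite subrK cabs1 cabsM.
have : cabs z * cabs u <= cabs z by rewrite -[leRHS]mulr1 ler_wpM2l ?cabs_ge0.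
by lra.
Qed.

Lemma one_sub_inv_bnd (z u : C) : cabs z < 1 -> cabs u <= 1 ->
  cabs ((1 - z * u)^-1) <= (1 - cabs z)^-1.
Proof.
move=> z1 u1; rewrite cabsV lef_pV2 ?posrE ?subr_gt0 //; first exact: one_sub_lb.
by apply: lt_le_trans (one_sub_lb z u1); rewrite subr_gt0.
Qed.

(** Iteration gives a_k = z^l a_(k+l), of modulus at most |z|^l M for every l. *)
Lemma geometric_zero (a : nat -> C) (z : C) (M : R) : cabs z < 1 ->
  (forall k, cabs (a k) <= M) -> (forall k, a k = z * a k.+1) -> forall k, a k = 0.
Proof.
move=> z1 aM az k.
have hk l : a k = z ^+ l * a (k + l)%N.
  elim: l => [|l ih]; first by rewrite addn0 mul1r.
  by rewrite ih az exprSr addnS mulrA.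
apply/eqP; rewrite -cabs_eq0; apply/eqP/le_anti; rewrite cabs_ge0 andbT.
have cv : (fun l => cabs z ^+ l * M) @ \oo --> (0 : R).
  rewrite -[X in _ --> X](mul0r M); apply: cvgM; last exact: cvg_cst.
  by apply: cvg_expr; rewrite ger0_norm ?cabs_ge0.
rewrite -(cvg_lim _ cv) //; apply: limr_ge; first by apply/cvg_ex; exists 0.
apply: nearW => l; rewrite (hk l) cabsM cabsX.
by apply: ler_wpM2l => //; rewrite exprn_ge0 ?cabs_ge0.
Qed.

End Geometric.

(* [I f] is a mean value of [f] on the torus, possibly twisted by a character of the other
   variable, and [em m] plays the role of e^{imx}; the three instances are the circle and
   the torus with either variable frozen on the Fourier side. *)
Record hardy_functional (T : Type) (R : realType) (cls : (T -> R[i]) -> Prop)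
    (I : (T -> R[i]) -> R[i]) (em : int -> T -> R[i]) : Prop := HardyFunctional {
  hf_emD : forall m n t, em (m + n) t = em m t * em n t;
  hf_emJ : forall m t, em (- m) t = (em m t)^*%C;
  hf_em1 : forall m t, cabs (em m t) = 1;
  hf_clsD : forall f g, cls f -> cls g -> cls (fun t => f t + g t);
  hf_clsZ : forall c f, cls f -> cls (fun t => c * f t);
  hf_clsE : forall m f, cls f -> cls (fun t => f t * em m t);
  hf_clsV : forall z m f, cabs z < 1 -> cls f -> cls (fun t => f t / (1 - z * em m t));
  hf_ID : forall f g, cls f -> cls g -> I (fun t => f t + g t) = I f + I g;
  hf_IZ : forall c f, cls f -> I (fun t => c * f t) = c * I f;
  hf_bnd : forall f, cls f ->
    exists M : R, forall m, cabs (I (fun t => f t * em m t)) <= M }.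

Section HardyFunctional.
Variables (T : Type) (R : realType).
Local Notation C := R[i].
Variables (cls : (T -> C) -> Prop) (I : (T -> C) -> C) (em : int -> T -> C).
Hypothesis HI : hardy_functional cls I em.
Let emD := hf_emD HI.
Let emJ := hf_emJ HI.
Let em1 := hf_em1 HI.
Let clsD := hf_clsD HI.
Let clsZ := hf_clsZ HI.
Let clsE := hf_clsE HI.
Let clsV := hf_clsV HI.
Let ID := hf_ID HI.
Let IZ := hf_IZ HI.
Let Ibnd := hf_bnd HI.
Implicit Types (f g : T -> C) (z a : C).

Definition hatG f m := I (fun t => f t * em (- m) t).
Definition lower f m0 := forall m : int, m < m0 -> hatG f m = 0.
Definition upper f m0 := forall m : int, m0 <= m -> hatG f m = 0.
(** The Cauchy integral: for [lower f 0] it is the value at [z] of the analytic extension of [f]. *)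
Definition extG z f := I (fun t => f t / (1 - z * em (-1) t)).
Definition bfac a t : C := (em 1 t - a) / (1 - a^*%C * em 1 t).

Lemma em0 t : em 0 t = 1.
Proof.
have e0 : em 0 t != 0 by rewrite -cabs_eq0 em1 oner_eq0.
by apply: (mulfI e0); rewrite mulr1 -emD addr0.
Qed.

Lemma emN m t : em m t * em (- m) t = 1.
Proof. by rewrite -emD subrr em0. Qed.

Lemma extGE z f : extG z f = hatG (fun t => f t / (1 - z * em (-1) t)) 0.
Proof.
by rewrite /extG /hatG; congr I; apply/funext => t; rewrite oppr0 em0 mulr1.
Qed.

Lemma den_neq0 z m t : cabs z < 1 -> 1 - z * em m t != 0.
Proof. by move=> z1; apply: one_sub_neq0 => //; rewrite em1. Qed.

Lemma hatG_shift f k m : hatG (fun t => f t * em k t) m = hatG f (m - k).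
Proof.
rewrite /hatG; congr I; apply/funext => t.
by rewrite -mulrA -emD opprB addrC.
Qed.

Lemma hatGD f g m : cls f -> cls g -> hatG (fun t => f t + g t) m = hatG f m + hatG g m.
Proof.
move=> hf hg; rewrite /hatG -ID; try exact: clsE.
by congr I; apply/funext => t; rewrite mulrDl.
Qed.

Lemma hatGZ c f m : cls f -> hatG (fun t => c * f t) m = c * hatG f m.
Proof.
move=> hf; rewrite /hatG -IZ; last exact: clsE.
by congr I; apply/funext => t; rewrite mulrA.
Qed.

Lemma clsN f : cls f -> cls (fun t => - f t).
Proof. by move=> /(clsZ (-1)); congr cls; apply/funext => t; rewrite mulN1r. Qed.

Lemma hatGN f m : cls f -> hatG (fun t => - f t) m = - hatG f m.
Proof.
move=> hf; rewrite -mulN1r -hatGZ //.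
by congr hatG; apply/funext => t; rewrite mulN1r.
Qed.

Lemma hatGB f g m : cls f -> cls g -> hatG (fun t => f t - g t) m = hatG f m - hatG g m.
Proof. by move=> hf hg; rewrite hatGD ?hatGN //; exact: clsN. Qed.

Lemma hatG_div z k f m : cabs z < 1 -> cls f ->
  hatG (fun t => f t / (1 - z * em k t)) m
   - z * hatG (fun t => f t / (1 - z * em k t)) (m - k) = hatG f m.
Proof.
move=> z1 hf; have hw := clsV k z1 hf.
rewrite -hatG_shift -hatGZ; last exact: clsE.
rewrite -hatGB //; last by apply: clsZ; exact: clsE.
congr hatG; apply/funext => t.
by have := den_neq0 k t z1 => h; field.
Qed.

Lemma hatG_bnd f : cls f -> exists M : R, forall m, cabs (hatG f m) <= M.
Proof. by move=> /Ibnd[M hM]; exists M => m; exact: hM. Qed.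

(** From [m0] on the recursion for the coefficients of the quotient is homogeneous, and its bounded
    solutions vanish by [geometric_zero]. *)
Lemma upper_div z f m0 : cabs z < 1 -> cls f -> upper f m0 ->
  upper (fun t => f t / (1 - z * em (-1) t)) m0.
Proof.
move=> z1 hf fu m m0m; have [M hM] := hatG_bnd (clsV (-1) z1 hf).
have := @geometric_zero R (fun k => hatG (fun t => f t / (1 - z * em (-1) t)) (m + k%:Z)) z M z1.
move=> /(_ _ _ 0%N); rewrite addr0; apply => k; first exact: hM.
have := hatG_div (-1) (m + k%:Z) z1 hf; rewrite fu; last by rewrite ler_wpDr.
by move=> /eqP; rewrite subr_eq0 => /eqP ->; rewrite opprK -addrA -PoszD addn1.
Qed.

Lemma lower_div z f m0 : cabs z < 1 -> cls f -> lower f m0 ->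
  lower (fun t => f t / (1 - z * em 1 t)) m0.
Proof.
move=> z1 hf fu m m0m; have [M hM] := hatG_bnd (clsV 1 z1 hf).
have := @geometric_zero R (fun k => hatG (fun t => f t / (1 - z * em 1 t)) (m - k%:Z)) z M z1.
move=> /(_ _ _ 0%N); rewrite subr0; apply => k; first exact: hM.
have := hatG_div 1 (m - k%:Z) z1 hf; rewrite fu; last first.
  by apply: le_lt_trans m0m; rewrite gerBl.
by move=> /eqP; rewrite subr_eq0 => /eqP ->; rewrite -addrA -opprD -PoszD addn1.
Qed.

Lemma lower_shift f k m0 : lower f m0 -> lower (fun t => f t * em k t) (m0 + k).
Proof. by move=> h m mk; rewrite hatG_shift h // ltrBlDr. Qed.

Lemma upper_shift f k m0 : upper f m0 -> upper (fun t => f t * em k t) (m0 + k).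
Proof. by move=> h m mk; rewrite hatG_shift h // lerBrDr. Qed.

Lemma lower_le f m0 m1 : m1 <= m0 -> lower f m0 -> lower f m1.
Proof. by move=> h hf m m1m; apply: hf; exact: lt_le_trans h. Qed.

Lemma upper_le f m0 m1 : m0 <= m1 -> upper f m0 -> upper f m1.
Proof. by move=> h hf m m1m; apply: hf; exact: le_trans m1m. Qed.

Lemma lowerD f g m0 : cls f -> cls g -> lower f m0 -> lower g m0 ->
  lower (fun t => f t + g t) m0.
Proof. by move=> cf cg hf hg m h; rewrite hatGD // hf // hg // addr0. Qed.

Lemma upperD f g m0 : cls f -> cls g -> upper f m0 -> upper g m0 ->
  upper (fun t => f t + g t) m0.
Proof. by move=> cf cg hf hg m h; rewrite hatGD // hf // hg // addr0. Qed.

Lemma lowerZ c f m0 : cls f -> lower f m0 -> lower (fun t => c * f t) m0.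
Proof. by move=> cf hf m h; rewrite hatGZ // hf // mulr0. Qed.

Lemma upperZ c f m0 : cls f -> upper f m0 -> upper (fun t => c * f t) m0.
Proof. by move=> cf hf m h; rewrite hatGZ // hf // mulr0. Qed.

Lemma bfacE a f : (fun t => f t * bfac a t) =
  (fun t => ((f t * em 1 t) + (- a) * f t) / (1 - a^*%C * em 1 t)).
Proof. by apply/funext => t; rewrite /bfac; ring. Qed.

Lemma bfacJ a t : (bfac a t)^*%C = (em (-1) t - a^*%C) / (1 - a * em (-1) t).
Proof.
by rewrite /bfac rmorphM rmorphB fmorphV rmorphB rmorph1 rmorphM /= conjcK !emJ.
Qed.

Lemma bfacJE a f : (fun t => f t * (bfac a t)^*%C) =
  (fun t => ((f t * em (-1) t) + (- a^*%C) * f t) / (1 - a * em (-1) t)).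
Proof. by apply/funext => t; rewrite bfacJ; ring. Qed.

Lemma cls_bfac a f : cabs a < 1 -> cls f -> cls (fun t => f t * bfac a t).
Proof.
move=> a1 hf; rewrite bfacE; apply: clsV; first by rewrite cabsJ.
by apply: clsD; [exact: clsE|exact: clsZ].
Qed.

Lemma cls_bfacJ a f : cabs a < 1 -> cls f -> cls (fun t => f t * (bfac a t)^*%C).
Proof.
move=> a1 hf; rewrite bfacJE; apply: clsV => //.
by apply: clsD; [exact: clsE|exact: clsZ].
Qed.

Lemma lower_bfac a f m0 : cabs a < 1 -> cls f -> lower f m0 ->
  lower (fun t => f t * bfac a t) m0.
Proof.
move=> a1 hf fl; rewrite bfacE; apply: lower_div; first by rewrite cabsJ.
  by apply: clsD; [exact: clsE|exact: clsZ].
apply: lowerD; [exact: clsE|exact: clsZ| |exact: lowerZ].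
by apply: (lower_le _ (@lower_shift _ 1 _ fl)); rewrite lerDl.
Qed.

Lemma upper_bfacJ a f m0 : cabs a < 1 -> cls f -> upper f m0 ->
  upper (fun t => f t * (bfac a t)^*%C) m0.
Proof.
move=> a1 hf fl; rewrite bfacJE; apply: upper_div => //.
  by apply: clsD; [exact: clsE|exact: clsZ].
apply: upperD; [exact: clsE|exact: clsZ| |exact: upperZ].
by apply: (upper_le _ (@upper_shift _ (-1) _ fl)); rewrite gerDl.
Qed.

Lemma bfacK a t : cabs a < 1 -> bfac a t * (bfac a t)^*%C = 1.
Proof.
move=> a1; rewrite bfacJ /bfac.
have a1' : cabs a^*%C < 1 by rewrite cabsJ.
have h1 := den_neq0 1 t a1'; have h2 := den_neq0 (-1) t a1.
have e0 : em 1 t != 0 by rewrite -cabs_eq0 em1 oner_eq0.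
have eN : em (-1) t = (em 1 t)^-1 by apply: (mulfI e0); rewrite emN divff.
rewrite eN in h2 *.
have h3 : em 1 t - a != 0.
  apply: contra h2 => /eqP h; rewrite subr_eq0; apply/eqP; apply: (mulIf e0).
  by rewrite mul1r divfK //; apply/eqP; rewrite -subr_eq0 h.
by field; rewrite h3 e0 h1.
Qed.

(* ext z f = 0 says that the coefficient of index 0 of f/(1 - z/e) vanishes; going down
   the recursion c_m = z c_{m+1} kills all negative coefficients of f/(e - z). *)
Lemma lower_root_div z f : cabs z < 1 -> cls f -> lower f 0 -> extG z f = 0 ->
  lower (fun t => f t / (1 - z * em (-1) t)) 1.
Proof.
move=> z1 hf fl fz m; rewrite -[1]add0r ltzD1 => m0.
have -> : m = - `|m|%N%:Z by rewrite abszE ler0_norm // opprK.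
elim: `|m|%N => [|k ih]; first by rewrite -extGE.
have := hatG_div (-1) (- k.+1%:Z) z1 hf; rewrite fl // opprK.
have -> : - k.+1%:Z + 1 = - k%:Z by rewrite -addn1 PoszD opprD addrK.
by rewrite ih mulr0 subr0.
Qed.

(** The quotient in [lower_root_div] has its spectrum in m >= 1, one better than needed; the
    remaining factor e^{-ix} - conj z of [bfacJ] costs exactly one frequency. *)
Lemma lower_bfacJ z f : cabs z < 1 -> cls f -> lower f 0 -> extG z f = 0 ->
  lower (fun t => f t * (bfac z t)^*%C) 0.
Proof.
move=> z1 hf fl fz; have hl := lower_root_div z1 hf fl fz.
have -> : (fun t => f t * (bfac z t)^*%C) = (fun t =>
  (f t / (1 - z * em (-1) t)) * em (-1) t + (- z^*%C) * (f t / (1 - z * em (-1) t))).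
  by apply/funext => t; rewrite bfacJ; ring.
have hw := clsV (-1) z1 hf.
apply: lowerD; [exact: clsE|exact: clsZ| |].
- by have := @lower_shift _ (-1) _ hl; rewrite subrr.
- by apply: lowerZ => //; exact: (lower_le _ hl).
Qed.

Lemma extGD z f g : cabs z < 1 -> cls f -> cls g ->
  extG z (fun t => f t + g t) = extG z f + extG z g.
Proof.
move=> z1 hf hg; rewrite !extGE -hatGD; try exact: clsV.
by congr hatG; apply/funext => t; rewrite mulrDl.
Qed.

Lemma extGZ z c f : cabs z < 1 -> cls f -> extG z (fun t => c * f t) = c * extG z f.
Proof.
move=> z1 hf; rewrite !extGE -hatGZ; last exact: clsV.
by congr hatG; apply/funext => t; rewrite mulrA.
Qed.

Lemma extGN z f : cabs z < 1 -> cls f -> extG z (fun t => - f t) = - extG z f.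
Proof.
move=> z1 hf; rewrite -mulN1r -extGZ //.
by congr extG; apply/funext => t; rewrite mulN1r.
Qed.

Lemma extGB z f g : cabs z < 1 -> cls f -> cls g ->
  extG z (fun t => f t - g t) = extG z f - extG z g.
Proof. by move=> z1 hf hg; rewrite extGD ?extGN //; exact: clsN. Qed.

(** The recursion at index -1, where the coefficient of [f] is 0, compares the coefficients -1 and 0
    of the quotient. *)
Lemma extG_em z f : cabs z < 1 -> cls f -> lower f 0 ->
  extG z (fun t => f t * em 1 t) = z * extG z f.
Proof.
move=> z1 hf fl; rewrite !extGE.
have -> : (fun t => f t * em 1 t / (1 - z * em (-1) t)) =
  (fun t => f t / (1 - z * em (-1) t) * em 1 t) by apply/funext => t; ring.
have := hatG_div (-1) (-1) z1 hf; rewrite fl //.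
by rewrite hatG_shift sub0r subrr => /eqP; rewrite subr_eq0 => /eqP.
Qed.

(** Multiplying the quotient back by 1 - a e^{ix} multiplies its value at [z] by 1 - a z, by
    [extG_em]. *)
Lemma extG_div z a f : cabs z < 1 -> cabs a < 1 -> cls f -> lower f 0 ->
  extG z (fun t => f t / (1 - a * em 1 t)) = extG z f / (1 - a * z).
Proof.
move=> z1 a1 hf fl; have hw := clsV 1 a1 hf.
have hl := lower_div a1 hf fl.
have az : 1 - a * z != 0 by apply: one_sub_neq0 => //; exact: ltW.
apply: (mulIf az); rewrite divfK //.
set w := (fun t => f t / _) in hw hl *.
have -> : extG z w * (1 - a * z) = extG z w - a * (z * extG z w) by ring.
rewrite -extG_em // -extGZ //; last exact: clsE.
rewrite -extGB //; last by apply: clsZ; exact: clsE.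
congr extG; apply/funext => t; rewrite /w.
by have h := den_neq0 1 t a1; field.
Qed.

Lemma extG_bfac z a f : cabs z < 1 -> cabs a < 1 -> cls f -> lower f 0 ->
  extG z (fun t => f t * bfac a t) = extG z f * ((z - a) / (1 - a^*%C * z)).
Proof.
move=> z1 a1 hf fl; rewrite bfacE extG_div ?cabsJ //; last 2 first.
- by apply: clsD; [exact: clsE|exact: clsZ].
- apply: lowerD; [exact: clsE|exact: clsZ| |exact: lowerZ].
  by apply: (lower_le _ (@lower_shift _ 1 _ fl)); rewrite lerDl.
rewrite extGD //; [|exact: clsE|exact: clsZ].
by rewrite extG_em // extGZ //; ring.
Qed.

(** The quotient times b_z is [f] again, and b_z(z') is nonzero since the nodes differ: dividing out
    one zero leaves the others in place. *)
Lemma extG_bfacJ z z' f : cabs z < 1 -> cabs z' < 1 -> z != z' -> cls f -> lower f 0 ->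
  extG z f = 0 -> extG z' f = 0 -> extG z' (fun t => f t * (bfac z t)^*%C) = 0.
Proof.
move=> z1 z1' zz hf fl fz fz'.
have hl := lower_bfacJ z1 hf fl fz; have hc := cls_bfacJ z1 hf.
have := extG_bfac z1' z1 hc hl.
have -> : (fun t => f t * (bfac z t)^*%C * bfac z t) = f.
  by apply/funext => t; rewrite -mulrA [_^*%C * _]mulrC bfacK // mulr1.
rewrite fz' => /esym/eqP; rewrite mulf_eq0 => /orP[/eqP //|].
rewrite mulf_eq0 invr_eq0 subr_eq0 eq_sym (negbTE zz) /=.
have -> // : (1 - z^*%C * z' == 0) = false.
by apply/negbTE; apply: one_sub_neq0; [rewrite cabsJ|exact: ltW].
Qed.

Section Products.
Variables (J : eqType) (a : J -> C).
Hypothesis a1 : forall j, cabs (a j) < 1.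

Lemma prod_lower_bfac (s : seq J) f m0 : cls f -> lower f m0 ->
  cls (fun t => f t * \prod_(j <- s) bfac (a j) t) /\
  lower (fun t => f t * \prod_(j <- s) bfac (a j) t) m0.
Proof.
elim: s f => [|j s ih] f hf fl.
  have -> // : (fun t => f t * \prod_(j <- [::]) bfac (a j) t) = f.
  by apply/funext => t; rewrite big_nil mulr1.
have -> : (fun t => f t * \prod_(j <- j :: s) bfac (a j) t) =
   (fun t => (f t * bfac (a j) t) * \prod_(j <- s) bfac (a j) t).
  by apply/funext => t; rewrite big_cons mulrA.
by apply: ih; [exact: cls_bfac|exact: lower_bfac].
Qed.

Lemma prod_upper_bfacJ (s : seq J) f m0 : cls f -> upper f m0 ->
  cls (fun t => f t * \prod_(j <- s) (bfac (a j) t)^*%C) /\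
  upper (fun t => f t * \prod_(j <- s) (bfac (a j) t)^*%C) m0.
Proof.
elim: s f => [|j s ih] f hf fl.
  have -> // : (fun t => f t * \prod_(j <- [::]) (bfac (a j) t)^*%C) = f.
  by apply/funext => t; rewrite big_nil mulr1.
have -> : (fun t => f t * \prod_(j <- j :: s) (bfac (a j) t)^*%C) =
   (fun t => (f t * (bfac (a j) t)^*%C) * \prod_(j <- s) (bfac (a j) t)^*%C).
  by apply/funext => t; rewrite big_cons mulrA.
by apply: ih; [exact: cls_bfacJ|exact: upper_bfacJ].
Qed.

Lemma prod_lower_bfacJ (s : seq J) f : injective a -> uniq s -> cls f -> lower f 0 ->
  (forall j, j \in s -> extG (a j) f = 0) ->
  lower (fun t => f t * \prod_(j <- s) (bfac (a j) t)^*%C) 0.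
Proof.
move=> ainj; elim: s f => [|j s ih] f us hf fl fz.
  have -> // : (fun t => f t * \prod_(j <- [::]) (bfac (a j) t)^*%C) = f.
  by apply/funext => t; rewrite big_nil mulr1.
have -> : (fun t => f t * \prod_(j <- j :: s) (bfac (a j) t)^*%C) =
   (fun t => (f t * (bfac (a j) t)^*%C) * \prod_(j <- s) (bfac (a j) t)^*%C).
  by apply/funext => t; rewrite big_cons mulrA.
move: us => /= /andP[js us].
have fj : extG (a j) f = 0 by apply: fz; rewrite mem_head.
apply: ih => //; [exact: cls_bfacJ|exact: lower_bfacJ|].
move=> k ks; apply: extG_bfacJ => //.
- by apply: contraNneq js => /ainj ->.
- by apply: fz; rewrite in_cons ks orbT.
Qed.

End Products.

End HardyFunctional.

(** * The circle and the torus as instances *)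

Section Torus.
Variable R : realType.
Local Notation C := R[i].
Local Notation T1 := (measurableTypeR R).
Local Notation T2 := (T2 R).
Local Notation mu := (@mu2 R).
Local Notation D := (@sqT2 R).
Local Notation S := (@sqT R).
Local Notation mD := (@measurable_sqT2 R).
Local Notation mS := (@measurable_sqT R).
Local Notation fD := (@mu2_sqT2_fin R).
Local Notation fS := (@leb_sqT_fin R).

Local Notation Linf_le := (@Linf_le R).
Local Notation L2 := (@L2 R).
Local Notation cmeas := (@cmeas R).
Local Notation fhat := (@fhat R).
Local Notation cint2 := (@cint2 R).
Local Notation cint1 := (@cint1 R).
Local Notation ext1 := (@ext1 R).
Local Notation chr2 := (@chr2 R).

Definition I1 (f : T1 -> C) := integrableC (leb R) S f.
Definition I2 (f : T2 -> C) := integrableC mu D f.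

Definition c1 : C := ((2 * pi)^-1 : R)%:C%C.
Definition c2 : C := (((2 * pi) ^+ 2)^-1 : R)%:C%C.

Lemma twopi_neq0 : (2 * pi : R) != 0.
Proof. by rewrite mulf_neq0 // gt_eqF // pi_gt0. Qed.

Lemma c2E : c2 = c1 * c1.
Proof. by rewrite /c2 /c1 -rmorphM /= expr2 invfM. Qed.

Lemma cint1E (f : R -> C) : cint1 f = c1 * Cint (leb R) S f.
Proof. by rewrite /cint1 /c1 /Cint; simpc. Qed.

Lemma cint2E (f : T2 -> C) : cint2 f = c2 * Cint mu D f.
Proof. by rewrite /cint2 /c2 /Cint; simpc. Qed.

Lemma cint2D f g : I2 f -> I2 g -> cint2 (fun p => f p + g p) = cint2 f + cint2 g.
Proof. by move=> hf hg; rewrite !cint2E CintD // ?mulrDr //; exact: mD. Qed.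

Lemma cint2Z c f : I2 f -> cint2 (fun p => c * f p) = c * cint2 f.
Proof. by move=> hf; rewrite !cint2E CintZ //; [rewrite mulrCA|exact: mD]. Qed.

Lemma cint1D f g : I1 f -> I1 g -> cint1 (fun p => f p + g p) = cint1 f + cint1 g.
Proof. by move=> hf hg; rewrite !cint1E CintD // ?mulrDr //; exact: mS. Qed.

Lemma cint1Z c f : I1 f -> cint1 (fun p => c * f p) = c * cint1 f.
Proof. by move=> hf; rewrite !cint1E CintZ //; [rewrite mulrCA|exact: mS]. Qed.

Lemma cint2N f : I2 f -> cint2 (fun p => - f p) = - cint2 f.
Proof.
by move=> hf; rewrite -mulN1r -cint2Z //; congr cint2; apply/funext => p; rewrite mulN1r.
Qed.

Lemma I2D f g : I2 f -> I2 g -> I2 (fun p => f p + g p).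
Proof. by apply: integrableCD; exact: mD. Qed.
Lemma I2Z c f : I2 f -> I2 (fun p => c * f p).
Proof. by apply: integrableCZ; exact: mD. Qed.
Lemma I2N f : I2 f -> I2 (fun p => - f p).
Proof. by apply: integrableCN; exact: mD. Qed.
Lemma I2B f g : I2 f -> I2 g -> I2 (fun p => f p - g p).
Proof. by move=> hf hg; apply: I2D => //; exact: I2N. Qed.
Lemma I2_Linf f g c : I2 f -> Linf_le g c -> I2 (fun p => f p * g p).
Proof. by move=> hf hg; exact: (integrableC_mulb mD hf hg). Qed.
Lemma Linf_I2 f c : Linf_le f c -> I2 f.
Proof. exact: (integrableC_bounded mD fD). Qed.
Lemma L2_I2 f : L2 f -> I2 f.
Proof. exact: (L2C_integrable mD fD). Qed.
Lemma L2M_I2 f g : L2 f -> L2 g -> I2 (fun p => f p * g p).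
Proof. exact: (integrableC_L2 mD). Qed.
Lemma L2J (f : T2 -> C) : L2 f -> L2 (fun p => (f p)^*%C).
Proof. exact: L2CJ. Qed.
Lemma L2_Linf f g c : L2 f -> Linf_le g c -> L2 (fun p => f p * g p).
Proof. exact: (L2C_mulb mD). Qed.
Lemma Linf_L2 f c : Linf_le f c -> L2 f.
Proof. exact: (L2C_bounded mD fD). Qed.
Lemma L2D f g : L2 f -> L2 g -> L2 (fun p => f p + g p).
Proof. exact: (L2CD mD). Qed.
Lemma L2Z c f : L2 f -> L2 (fun p => c * f p).
Proof. exact: (L2CZ mD). Qed.
Lemma L2B f g : L2 f -> L2 g -> L2 (fun p => f p - g p).
Proof. exact: (L2CB mD). Qed.

Lemma Linf_bnd f (c : R) : cmeas f -> (forall p, cabs (f p) <= c) -> Linf_le f c.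
Proof. by move=> mf fc; split => //; exact: aeW. Qed.

Lemma LinfM f g c e : Linf_le f c -> Linf_le g e -> 0 <= c ->
  Linf_le (fun p => f p * g p) (c * e).
Proof.
move=> [mf hf] [mg hg] c0; split; first exact: mfunCM.
near=> p => Dp; rewrite cabsM ler_pM ?cabs_ge0 //.
- by move: Dp; near: p.
- by move: Dp; near: p.
Unshelve. all: by end_near. Qed.

Lemma LinfD f g c e : Linf_le f c -> Linf_le g e ->
  Linf_le (fun p => f p + g p) (c + e).
Proof.
move=> [mf hf] [mg hg]; split; first exact: mfunCD.
near=> p => Dp; apply: le_trans (cabsD _ _) _; apply: lerD.
- by move: Dp; near: p.
- by move: Dp; near: p.
Unshelve. all: by end_near. Qed.

Lemma LinfJ f c : Linf_le f c -> Linf_le (fun p => (f p)^*%C) c.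
Proof.
move=> [mf hf]; split; first exact: mfunCJ.
by apply: filterS hf => p h /h; rewrite cabsJ.
Qed.

Lemma Linf_chr2 m n : Linf_le (chr2 m n) 1.
Proof. by apply: Linf_bnd; [exact: mfunC_chr2|move=> p; rewrite cabs_chr2]. Qed.

Lemma Linf_cauchy z m n : cabs z < 1 ->
  Linf_le (fun p => (1 - z * chr2 m n p)^-1) (1 - cabs z)^-1.
Proof.
move=> z1; apply: Linf_bnd => [|p]; last by apply: one_sub_inv_bnd; rewrite ?cabs_chr2.
apply: mfunCV; apply: mfunCB; first exact: mfunC_cst.
by apply: mfunCM; [exact: mfunC_cst|exact: mfunC_chr2].
Qed.

Lemma fhatE f m n : fhat f m n = cint2 (fun p => f p * chr2 (- m) (- n) p).
Proof.
rewrite /fhat; congr cint2; apply/funext => p; congr (_ * expi _).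
by rewrite !mulrNz; ring.
Qed.

(** The mean twisted by e^{-iny}: with [ex] it sees one row of the double Fourier series as a series
    in x, see [hat_x]. [Iy] does the same for columns. *)
Definition Ix (n : int) (f : T2 -> C) := cint2 (fun p => f p * chr2 0 (- n) p).
Definition Iy (m : int) (f : T2 -> C) := cint2 (fun p => f p * chr2 (- m) 0 p).
Definition ex (m : int) : T2 -> C := chr2 m 0.
Definition ey (n : int) : T2 -> C := chr2 0 n.
Definition e1 (m : int) (x : T1) : C := expi (m%:~R * x).

Lemma chr2J m n p : chr2 (- m) (- n) p = (chr2 m n p)^*%C.
Proof. by rewrite /chr2 -expiN; congr expi; rewrite !mulrNz; ring. Qed.

(** Freezing a frequency means multiplying by one more character, so [hardy_x] and [hardy_y] are the
    same case. *)
Lemma I2_hardy I em : (forall m, exists k l, em m = chr2 k l) ->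
  (forall m n t, em (m + n) t = em m t * em n t) ->
  (forall m t, em (- m) t = (em m t)^*%C) ->
  (exists k l, I = fun f => cint2 (fun p => f p * chr2 k l p)) ->
  hardy_functional I2 I em.
Proof.
move=> hem emD emJ [k [l ->]].
have em1 m t : cabs (em m t) = 1 by have [a [b ->]] := hem m; exact: cabs_chr2.
have clsE m f : I2 f -> I2 (fun t => f t * em m t).
  by move=> hf; have [a [b ->]] := hem m; apply: (I2_Linf hf); exact: Linf_chr2.
split => //.
- exact: I2D.
- exact: I2Z.
- move=> z m f z1 hf; have [a [b ->]] := hem m.
  by apply: (I2_Linf hf); exact: Linf_cauchy.
- move=> f g hf hg; rewrite -cint2D.
  + by congr cint2; apply/funext => p; rewrite mulrDl.
  + by apply: (I2_Linf hf); exact: Linf_chr2.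
  + by apply: (I2_Linf hg); exact: Linf_chr2.
- move=> c f hf; rewrite -cint2Z.
  + by congr cint2; apply/funext => p; rewrite mulrA.
  + by apply: (I2_Linf hf); exact: Linf_chr2.
- move=> f hf; have [M hM] := Cint_bound mD hf.
  exists (cabs c2 * M) => m; have [a [b ->]] := hem m.
  rewrite cint2E cabsM ler_wpM2l ?cabs_ge0 //.
  have := hM (fun p => chr2 a b p * chr2 k l p).
  have -> : (fun p => f p * (chr2 a b p * chr2 k l p)) =
     (fun p => f p * chr2 a b p * chr2 k l p) by apply/funext => p; rewrite mulrA.
  apply; first by apply: mfunCM; exact: mfunC_chr2.
  by move=> p; rewrite cabsM !cabs_chr2 mulr1.
Qed.

Lemma hardy_x n : hardy_functional I2 (Ix n) ex.
Proof.
apply: I2_hardy.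
- by move=> m; exists m, 0.
- by move=> m k t; rewrite /ex chr2D addr0.
- by move=> m t; rewrite /ex -chr2J oppr0.
- by exists 0, (- n).
Qed.

Lemma hardy_y m : hardy_functional I2 (Iy m) ey.
Proof.
apply: I2_hardy.
- by move=> k; exists 0, k.
- by move=> n k t; rewrite /ey chr2D addr0.
- by move=> n t; rewrite /ey -chr2J oppr0.
- by exists (- m), 0.
Qed.

Lemma cabs_e1 m x : cabs (e1 m x) = 1.
Proof. exact: cabs_expi. Qed.

Lemma mfunC_e1 m : mfunC (e1 m).
Proof. by apply: mfunC_expi; exact: measurable_funM. Qed.

Lemma e1D m n t : e1 (m + n) t = e1 m t * e1 n t.
Proof. by rewrite /e1 -expiD intrD mulrDl. Qed.

Lemma e1J m t : e1 (- m) t = (e1 m t)^*%C.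
Proof. by rewrite /e1 -expiN mulrNz mulNr. Qed.

Definition Linf1 (f : T1 -> C) c := ess_boundedC (leb R) S f c.

Lemma I1_Linf f g c : I1 f -> Linf1 g c -> I1 (fun p => f p * g p).
Proof. by move=> hf hg; exact: (integrableC_mulb mS hf hg). Qed.

Lemma Linf1_I1 f c : Linf1 f c -> I1 f.
Proof. exact: (integrableC_bounded mS fS). Qed.

Lemma Linf1_bnd f (c : R) : mfunC f -> (forall p, cabs (f p) <= c) -> Linf1 f c.
Proof. by move=> mf fc; split => //; exact: aeW. Qed.

Lemma Linf1_e1 m : Linf1 (e1 m) 1.
Proof. by apply: Linf1_bnd; [exact: mfunC_e1|move=> p; rewrite cabs_e1]. Qed.

Lemma Linf1_cauchy z m : cabs z < 1 ->
  Linf1 (fun p => (1 - z * e1 m p)^-1) (1 - cabs z)^-1.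
Proof.
move=> z1; apply: Linf1_bnd => [|p]; last by apply: one_sub_inv_bnd; rewrite ?cabs_e1.
apply: mfunCV; apply: mfunCB; first exact: mfunC_cst.
by apply: mfunCM; [exact: mfunC_cst|exact: mfunC_e1].
Qed.

Lemma hardy_1 : hardy_functional I1 cint1 e1.
Proof.
split.
- exact: e1D.
- exact: e1J.
- exact: cabs_e1.
- by apply: integrableCD; exact: mS.
- by apply: integrableCZ; exact: mS.
- by move=> m f hf; exact: (I1_Linf hf (Linf1_e1 m)).
- by move=> z m f z1 hf; exact: (I1_Linf hf (Linf1_cauchy m z1)).
- exact: cint1D.
- exact: cint1Z.
- move=> f hf; have [M hM] := Cint_bound mS hf.
  exists (cabs c1 * M) => m; rewrite cint1E cabsM ler_wpM2l ?cabs_ge0 //.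
  by apply: hM; [exact: mfunC_e1|move=> p; rewrite cabs_e1].
Qed.

Lemma hat_x f m n : hatG (Ix n) ex f m = fhat f m n.
Proof.
rewrite fhatE /hatG /Ix /ex; congr cint2; apply/funext => p.
by rewrite -mulrA chr2D addr0 add0r.
Qed.

Lemma hat_y f m n : hatG (Iy m) ey f n = fhat f m n.
Proof.
rewrite fhatE /hatG /Iy /ey; congr cint2; apply/funext => p.
by rewrite -mulrA chr2D addr0 add0r.
Qed.

Lemma e1_expi (t : R) : expi t = e1 1 t. Proof. by rewrite /e1 mul1r. Qed.
Lemma e1N_expi (t : R) : expi (- t) = e1 (-1) t. Proof. by rewrite /e1 mulN1r. Qed.
Lemma ex_expi p : expi p.1 = ex 1 p. Proof. by rewrite /ex /chr2 mul1r mul0r addr0. Qed.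
Lemma exN_expi p : expi (- p.1) = ex (-1) p.
Proof. by rewrite /ex /chr2 mulN1r mul0r addr0. Qed.
Lemma ey_expi p : expi p.2 = ey 1 p. Proof. by rewrite /ey /chr2 mul1r mul0r add0r. Qed.
Lemma eyN_expi p : expi (- p.2) = ey (-1) p.
Proof. by rewrite /ey /chr2 mulN1r mul0r add0r. Qed.

Lemma ext1E f z y : ext1 f z y = extG cint1 e1 z (fun x => f (x, y)).
Proof. by rewrite /ext1 /extG; congr cint1; apply/funext => x; rewrite e1N_expi. Qed.

Lemma blaschke_x n (a : 'I_n -> C) p : blaschke a p.1 = \prod_(j < n) bfac ex (a j) p.
Proof. by rewrite /blaschke; apply: eq_bigr => j _; rewrite /bfac ex_expi. Qed.

Lemma blaschke_y n (a : 'I_n -> C) p : blaschke a p.2 = \prod_(j < n) bfac ey (a j) p.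
Proof. by rewrite /blaschke; apply: eq_bigr => j _; rewrite /bfac ey_expi. Qed.

Lemma mfunC_section (f : T2 -> C) y : mfunC f -> mfunC (fun x : T1 => f (x, y)).
Proof.
move=> [f1 f2]; split.
- by apply: (measurableT_comp f1); exact: pair2_measurable.
- by apply: (measurableT_comp f2); exact: pair2_measurable.
Qed.

Lemma mfunC_cint1 (f : T2 -> C) : mfunC f ->
  mfunC (fun y : T1 => cint1 (fun x => f (x, y))).
Proof.
move=> [f1 f2]; under [X in mfunC X]eq_fun do rewrite cint1E.
apply: mfunCM; first exact: mfunC_cst.
split.
- exact: (measurable_Rintegral_section (@lebesgue_measure R) mS f1).
- exact: (measurable_Rintegral_section (@lebesgue_measure R) mS f2).
Qed.

Lemma cint2_Fubini f : I2 f -> I1 (fun y => cint1 (fun x => f (x, y))) /\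
  cint2 f = cint1 (fun y => cint1 (fun x => f (x, y))).
Proof.
move=> [mf [i1 i2]].
have [r1 r2] := Fubini_rect (m1 := @lebesgue_measure R) (m2 := @lebesgue_measure R) mS mS mf.1 i1.
have [s1 s2] := Fubini_rect (m1 := @lebesgue_measure R) (m2 := @lebesgue_measure R) mS mS mf.2 i2.
have iC : I1 (fun y => Cint (leb R) S (fun x => f (x, y))).
  split; last by split.
  split.
  - exact: (measurable_Rintegral_section (@lebesgue_measure R) mS mf.1).
  - exact: (measurable_Rintegral_section (@lebesgue_measure R) mS mf.2).
split.
  under [X in I1 X]eq_fun do rewrite cint1E.
  by apply: integrableCZ => //; exact: mS.
rewrite cint2E c2E -mulrA; under eq_fun do rewrite cint1E.
rewrite cint1Z // cint1E mulrCA; congr (_ * (_ * _)).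
by rewrite /Cint; congr (_ +i* _)%C; [exact: r2|exact: s2].
Qed.

Lemma ae_slices (Q : T2 -> Prop) : {ae mu, forall p, D p -> Q p} ->
  {ae leb R, forall y, S y -> {ae leb R, forall x, S x -> Q (x, y)}}.
Proof.
move=> h.
have := @ae_section _ _ T1 T1 R (@lebesgue_measure R) (@lebesgue_measure R) _ h.
by apply: filterS => y hy Sy; apply: filterS hy => x hx Sx; exact: hx.
Qed.

End Torus.

(** * Fourier coefficients on the torus *)

Section Inner.
Variable R : realType.
Local Notation C := R[i].
Local Notation Re := (@complex.Re R).
Local Notation Im := (@complex.Im R).
Local Notation T2 := (T2 R).
Local Notation mu := (@mu2 R).
Local Notation D := (@sqT2 R).
Local Notation S := (@sqT R).
Local Notation mD := (@measurable_sqT2 R).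
Local Notation mS := (@measurable_sqT R).
Local Notation Linf_le := (@Linf_le R).
Local Notation L2 := (@L2 R).
Local Notation fhat := (@fhat R).
Local Notation cint2 := (@cint2 R).
Local Notation cint1 := (@cint1 R).
Local Notation chr2 := (@chr2 R).
Local Notation inner := (@inner R).
Local Notation tpoly := (@tpoly R).
Local Notation e1 := (@e1 R).
Local Notation I2 := (@I2 R).

Lemma expi_2pi : expi (2 * pi) = 1 :> C.
Proof. by rewrite /expi mulr_natl cos2pi sin2pi. Qed.

Lemma e1_2pi m : e1 m (2 * pi) = 1.
Proof.
have hn (n : nat) : e1 n (2 * pi) = 1.
  elim: n => [|n ih]; first by rewrite /e1 mul0r expi0.
  by rewrite -addn1 PoszD e1D ih mul1r -e1_expi expi_2pi.
have [|n|n] := intP m; first exact: (hn 0%N).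
- by rewrite hn.
- by rewrite e1J hn conjc1.
Qed.

Lemma Rintegral_FTC (f F : R -> R) : continuous f -> (forall x : R, is_derive x (1 : R) F (f x)) ->
  F (2 * pi) = F 0 -> Rintegral (leb R) S f = 0.
Proof.
move=> cf dF FE.
have ab : (0 : R) < 2 * pi by rewrite mulr_gt0 // pi_gt0.
have cF : continuous F.
  by move=> x; apply/differentiable_continuous/derivable1_diffP; case: (dF x).
have := @continuous_FTC2 R f F 0 (2 * pi) ab.
move=> h; rewrite /Rintegral.
have h2 : (\int[@lebesgue_measure R]_(x in `[0%R, (2 * pi)%R]) (f x)%:E = (F (2 * pi)%R)%:E - (F 0%R)%:E)%E.
  apply: h.
  - exact: continuous_subspaceT.
  - split.
    + by move=> x _; case: (dF x).
    + by apply: cvg_at_right_filter; exact: cF.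
    + by apply: cvg_at_left_filter; exact: cF.
  - by move=> x _; rewrite derive1E; case: (dF x).
by rewrite [X in fine X]h2 FE -EFinB subrr.
Qed.

Lemma cint1_e1 m : m != 0 -> cint1 (e1 m) = 0.
Proof.
move=> m0; have mR0 : (m%:~R : R) != 0 by rewrite intr_eq0.
have := e1_2pi m; rewrite /e1 /expi => -[hc hs].
rewrite /cint1 /e1 /expi /=.
have d x : is_derive (x : R) (1 : R) (fun x : R => m%:~R * x) m%:~R.
  have := @is_deriveZ R R^o R^o id m%:~R x 1 1 (is_derive_id _ _).
  by rewrite [_ *: _]mulr1.
have ds x : is_derive (x : R) (1 : R) (fun x : R => (m%:~R)^-1 * sin (m%:~R * x)) (cos (m%:~R * x)).
  have h1 := is_derive1_comp (is_derive_sin (m%:~R * x)) (d x).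
  have := @is_deriveZ R R^o R^o _ (m%:~R)^-1 x 1 _ h1.
  by rewrite [_ *: _](_ : _ = cos (m%:~R * x)) // /GRing.scale /= mulrC mulfK.
have dc x : is_derive (x : R) (1 : R) (fun x : R => - (m%:~R)^-1 * cos (m%:~R * x)) (sin (m%:~R * x)).
  have h1 := is_derive1_comp (is_derive_cos (m%:~R * x)) (d x).
  have := @is_deriveZ R R^o R^o _ (- (m%:~R)^-1) x 1 _ h1.
  by rewrite [_ *: _](_ : _ = sin (m%:~R * x)) // /GRing.scale /= mulNr mulNr mulrN opprK mulrC mulfK.
rewrite (Rintegral_FTC _ ds); first rewrite (Rintegral_FTC _ dc).
- by rewrite mulr0.
- by move=> x; apply: continuous_comp; [exact: mulrl_continuous|exact: continuous_sin].
- by rewrite hc mulr0 cos0.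
- by move=> x; apply: continuous_comp; [exact: mulrl_continuous|exact: continuous_cos].
- by rewrite hs !mulr0 sin0 mulr0.
Qed.

Lemma cint1_cst (c : C) : cint1 (fun=> c) = c.
Proof.
rewrite /cint1 !Rintegral_cst; try exact: mS.
rewrite leb_sqT /= ![_ * (2 * pi)]mulrC !mulKf ?twopi_neq0 //.
by case: c.
Qed.

Lemma chr2_sect m n x y : chr2 m n (x, y) = e1 n y * e1 m x.
Proof. by rewrite /chr2 /e1 -expiD addrC. Qed.

Lemma I2_chr2 m n : I2 (chr2 m n).
Proof. exact: (Linf_I2 (Linf_chr2 R m n)). Qed.

Lemma cint2_chr2 m n : cint2 (chr2 m n) = ((m == 0) && (n == 0))%:R.
Proof.
rewrite (cint2_Fubini (I2_chr2 m n)).2.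
have -> : (fun y => cint1 (fun x => chr2 m n (x, y))) =
    (fun y => cint1 (e1 m) * e1 n y).
  apply/funext => y; under eq_fun do rewrite chr2_sect.
  by rewrite cint1Z 1?mulrC //; exact: (Linf1_I1 (Linf1_e1 R _)).
rewrite cint1Z; last exact: (Linf1_I1 (Linf1_e1 R _)).
have e10 : e1 0 = fun=> 1 by apply/funext => x; rewrite /e1 mul0r expi0.
have [->|m0] := eqVneq m 0; last by rewrite cint1_e1 // mul0r.
have [->|n0] := eqVneq n 0; last by rewrite [cint1 (e1 n)]cint1_e1 // mulr0.
by rewrite e10 cint1_cst mulr1.
Qed.

Definition nsq (f : T2 -> C) : R := Re (inner f f).

Lemma nsqE f : nsq f = ((2 * pi) ^+ 2)^-1 * Rintegral mu D (fun p => cabs (f p) ^+ 2).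
Proof.
by rewrite /nsq /inner /cint2 /=; congr (_ * _); apply: eq_Rintegral => p _; rewrite Re_mulJ.
Qed.

Lemma norm2E f : norm2 f = Num.sqrt (nsq f).
Proof. by rewrite nsqE. Qed.

Lemma nsq_ge0 f : 0 <= nsq f.
Proof.
by rewrite nsqE mulr_ge0 // ?invr_ge0 ?sqr_ge0 //; apply: Rintegral_ge0 => p _; exact: sqr_ge0.
Qed.

Lemma nsq_inner f : L2 f -> inner f f = (nsq f)%:C%C.
Proof.
move=> hf; rewrite /nsq /inner cint2E /Cint.
have -> : Rintegral mu D (fun p => Im (f p * (f p)^*%C)) = 0.
  rewrite (@eq_Rintegral _ _ _ mu D (fun=> 0)); last by move=> p _; rewrite -cabs_sqrJ.
  by rewrite Rintegral_cst ?mul0r //; exact: mD.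
by rewrite /c2; simpc.
Qed.

Lemma innerDl f g h : L2 f -> L2 g -> L2 h ->
  inner (fun p => f p + g p) h = inner f h + inner g h.
Proof.
move=> hf hg hh; rewrite /inner -cint2D; try by apply: L2M_I2 => //; exact: L2J.
by congr cint2; apply/funext => p; rewrite mulrDl.
Qed.

Lemma innerZl c f h : L2 f -> L2 h -> inner (fun p => c * f p) h = c * inner f h.
Proof.
move=> hf hh; rewrite /inner -cint2Z; last by apply: L2M_I2 => //; exact: L2J.
by congr cint2; apply/funext => p; rewrite mulrA.
Qed.

Lemma innerC f g : L2 f -> L2 g -> inner g f = (inner f g)^*%C.
Proof.
move=> hf hg.
rewrite /inner !cint2E cconjM -CintJ; last 2 first.
- exact: mD.
- by apply: (@L2M_I2 R) => //; exact: L2J.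
congr (_ * _); first by rewrite /c2 conjc_real.
by congr Cint; apply/funext => p; rewrite cconjM conjcK mulrC.
Qed.

Lemma innerDr f g h : L2 f -> L2 g -> L2 h ->
  inner h (fun p => f p + g p) = inner h f + inner h g.
Proof.
move=> hf hg hh; rewrite innerC //; last exact: L2D.
by rewrite innerDl // cconjD -!innerC.
Qed.

Lemma innerZr c f h : L2 f -> L2 h -> inner h (fun p => c * f p) = c^*%C * inner h f.
Proof.
move=> hf hh; rewrite innerC //; last exact: L2Z.
by rewrite innerZl // cconjM -!innerC.
Qed.

Lemma innerBl f g h : L2 f -> L2 g -> L2 h ->
  inner (fun p => f p - g p) h = inner f h - inner g h.
Proof.
move=> hf hg hh.
have -> : (fun p => f p - g p) = (fun p => f p + (-1) * g p).
  by apply/funext => p; rewrite mulN1r.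
by rewrite innerDl ?innerZl ?mulN1r //; exact: L2Z.
Qed.

Lemma innerBr f g h : L2 f -> L2 g -> L2 h ->
  inner h (fun p => f p - g p) = inner h f - inner h g.
Proof.
move=> hf hg hh; rewrite innerC //; last exact: L2B.
by rewrite innerBl // cconjB -!innerC.
Qed.

Lemma nsqB f g : L2 f -> L2 g ->
  nsq (fun p => f p - g p) = nsq f - 2 * Re (inner f g) + nsq g.
Proof.
move=> hf hg; have hB := L2B hf hg.
rewrite /nsq innerBl // !innerBr // (innerC hf hg).
by case: (inner f f) (inner f g) (inner g g) => [? ?] [? ?] [? ?] /=; ring.
Qed.

Lemma nsqD f g : L2 f -> L2 g ->
  nsq (fun p => f p + g p) = nsq f + 2 * Re (inner f g) + nsq g.
Proof.
move=> hf hg; have hB := L2D hf hg.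
rewrite /nsq innerDl // !innerDr // (innerC hf hg).
by case: (inner f f) (inner f g) (inner g g) => [? ?] [? ?] [? ?] /=; ring.
Qed.

Lemma nsqZ c f : L2 f -> nsq (fun p => c * f p) = cabs c ^+ 2 * nsq f.
Proof.
move=> hf; rewrite /nsq innerZl //; last exact: L2Z.
rewrite innerZr // mulrA -cabs_sqrJ nsq_inner //.
by rewrite -rmorphM.
Qed.

Lemma Re_inner_le f g : L2 f -> L2 g -> 2 * Re (inner f g) <= nsq f + nsq g.
Proof.
by move=> hf hg; have := nsq_ge0 (fun p => f p - g p); rewrite nsqB //; lra.
Qed.

Lemma nsq_mul_le a f c : L2 f -> Linf_le a c -> 0 <= c ->
  nsq (fun p => a p * f p) <= c ^+ 2 * nsq f.
Proof.
move=> hf ha c0; rewrite !nsqE mulrCA ler_wpM2l ?invr_ge0 ?sqr_ge0 //.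
have haf : L2 (fun p => a p * f p).
  have := L2_Linf hf ha; congr (L2 _); apply/funext => p; exact: mulrC.
rewrite -RintegralZl //; [|exact: mD|exact: hf.2].
have ik : mu.-integrable D (fun p => (c ^+ 2 * cabs (f p) ^+ 2)%:E).
  exact: (integrableZl mD (c ^+ 2) hf.2).
rewrite /Rintegral; apply: fine_le.
- exact: (integrable_fin_num mD haf.2).
- exact: (integrable_fin_num mD ik).
apply: ae_ge0_le_integral => //; try by move=> p _; rewrite lee_fin sqr_ge0.
all: try by move=> p _; rewrite lee_fin mulr_ge0 ?sqr_ge0.
- exact: mD.
- exact: (measurable_int mu haf.2).
- exact: (measurable_int mu ik).
- apply: filterS ha.2 => p h /h hp; rewrite lee_fin cabsM exprMn.
  by rewrite ler_wpM2r ?sqr_ge0 // ler_sqr ?nnegrE ?cabs_ge0.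
Qed.

Lemma L2_chr2 m n : L2 (chr2 m n).
Proof. exact: (Linf_L2 (Linf_chr2 R m n)). Qed.

Lemma L2_tpoly s : L2 (tpoly s).
Proof.
apply: (@L2C_sum _ _ _ _ _ mD (@mu2_sqT2_fin R) _ s (fun t p => t.1 * chr2 t.2.1 t.2.2 p)).
by move=> t; apply: L2Z; exact: L2_chr2.
Qed.

Lemma inner_chr2 f m n : inner f (chr2 m n) = fhat f m n.
Proof.
by rewrite fhatE /inner; congr cint2; apply/funext => p; rewrite chr2J.
Qed.

Lemma tpoly_cons t s p : tpoly (t :: s) p = t.1 * chr2 t.2.1 t.2.2 p + tpoly s p.
Proof. by rewrite /tpoly big_cons. Qed.

Lemma inner_tpoly f s : L2 f ->
  inner f (tpoly s) = \sum_(t <- s) t.1^*%C * fhat f t.2.1 t.2.2.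
Proof.
move=> hf; elim: s => [|t s ih].
  rewrite big_nil (_ : tpoly [::] = fun p => 0 * chr2 0 0 p); last first.
    by apply/funext => p; rewrite /tpoly big_nil mul0r.
  by rewrite innerZr ?conjc0 ?mul0r //; exact: L2_chr2.
rewrite big_cons -ih -inner_chr2.
rewrite (_ : tpoly (t :: s) = fun p => t.1 * chr2 t.2.1 t.2.2 p + tpoly s p); last first.
  by apply/funext => p; exact: tpoly_cons.
rewrite innerDr ?innerZr //; try exact: L2_tpoly; try exact: L2_chr2.
by apply: L2Z; exact: L2_chr2.
Qed.

Lemma fhat_chr2 m n k l : fhat (chr2 m n) k l = ((m == k) && (n == l))%:R.
Proof.
rewrite fhatE; under eq_fun do rewrite chr2D.
by rewrite cint2_chr2 !subr_eq0.
Qed.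

Lemma fhat_tpoly s k l :
  fhat (tpoly s) k l = \sum_(t <- s) t.1 * ((t.2.1 == k) && (t.2.2 == l))%:R.
Proof.
rewrite -inner_chr2 innerC; [|exact: L2_chr2|exact: L2_tpoly].
rewrite inner_tpoly; last exact: L2_chr2.
rewrite cconj_sum; apply: eq_bigr => t _; rewrite cconjM conjcK fhat_chr2.
by rewrite conjc_nat eq_sym [l == _]eq_sym.
Qed.

Lemma fhatD f g m n : L2 f -> L2 g -> fhat (fun p => f p + g p) m n = fhat f m n + fhat g m n.
Proof. by move=> hf hg; rewrite -!inner_chr2 innerDl //; exact: L2_chr2. Qed.
Lemma fhatB f g m n : L2 f -> L2 g -> fhat (fun p => f p - g p) m n = fhat f m n - fhat g m n.
Proof. by move=> hf hg; rewrite -!inner_chr2 innerBl //; exact: L2_chr2. Qed.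
Lemma fhatZ c f m n : L2 f -> fhat (fun p => c * f p) m n = c * fhat f m n.
Proof. by move=> hf; rewrite -!inner_chr2 innerZl //; exact: L2_chr2. Qed.

Lemma bessel1 f m n : L2 f -> cabs (fhat f m n) ^+ 2 <= nsq f.
Proof.
move=> hf; set X := fhat f m n.
have := nsq_ge0 (fun p => f p - X * chr2 m n p).
rewrite nsqB //; last by apply: L2Z; exact: L2_chr2.
rewrite nsqZ; last exact: L2_chr2.
rewrite innerZr //; last exact: L2_chr2.
rewrite inner_chr2 -/X [X^*%C * X]mulrC Re_mulJ /nsq inner_chr2 fhat_chr2 !eqxx /=.
by lra.
Qed.

Lemma nsq_dense f (eps : R) : L2 f -> 0 < eps -> exists s, nsq (fun p => f p - tpoly s p) <= eps.
Proof.
move=> hf e0.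
have h0 : (0 : R) < (2 * pi) ^+ 2 by rewrite exprn_gt0 // mulr_gt0 // pi_gt0.
have [s hs] := tpoly_dense hf (mulr_gt0 h0 e0).
exists s; rewrite nsqE mulrC ler_pdivrMr // mulrC.
have hB : L2 (fun p => f p - tpoly s p) by apply: L2B => //; exact: L2_tpoly.
rewrite -lee_fin /Rintegral fineK //.
by apply: (integrable_fin_num mD); exact: hB.2.
Qed.

Lemma tpoly_filter (P : pred (C * (int * int))) s p :
  tpoly s p = tpoly (seq.filter P s) p + tpoly (seq.filter (predC P) s) p.
Proof. by rewrite /tpoly !big_filter [LHS](bigID P). Qed.

(* Dropping from a trigonometric polynomial the frequencies that [f] does not have only
   improves the approximation of [f]. *)
Lemma nsq_dense_spectrum f (eps : R) (L : pred (int * int)) : L2 f -> 0 < eps ->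
  (forall m n, ~~ L (m, n) -> fhat f m n = 0) ->
  exists2 s, all (fun t => L t.2) s & nsq (fun p => f p - tpoly s p) <= eps.
Proof.
move=> hf e0 fL; have [s hs] := nsq_dense hf e0.
pose P := fun t : C * (int * int) => L t.2.
exists (seq.filter P s); first exact: filter_all.
apply: le_trans hs.
have h1 : L2 (fun p => f p - tpoly (seq.filter P s) p) by apply: L2B => //; exact: L2_tpoly.
rewrite [in leRHS](_ : (fun p => _) =
  (fun p => (f p - tpoly (seq.filter P s) p) - tpoly (seq.filter (predC P) s) p)); last first.
  by apply/funext => p; rewrite (tpoly_filter P s) opprD addrA.
rewrite (nsqB h1); last exact: L2_tpoly.
rewrite inner_tpoly // big1_seq ?mulr0 ?subr0 ?lerDl ?nsq_ge0 //.
move=> t /=; rewrite mem_filter => /andP[/= tL _].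
rewrite fhatB //; last exact: L2_tpoly.
rewrite fL; last by case: t tL => c [].
rewrite fhat_tpoly big1_seq ?subr0 ?mulr0 //.
move=> u; rewrite mem_filter /= => /andP[uP _].
rewrite -[_ && _]/(u.2 == t.2) ; case: eqP => h; last by rewrite mulr0.
by move: tL uP; rewrite /P -h => /negbTE ->.
Qed.

(** Approximate [f] by a trigonometric polynomial t with frequencies in [M]. The product a t has no
    coefficient in [N], because differences of [N] and [M] stay in [N]; by [bessel1] the coefficient
    of a(f - t) is small. *)
Lemma fhat_mulM (N M : pred (int * int)) a f c :
  (forall m n k l, N (m, n) -> M (k, l) -> N (m - k, n - l)) ->
  Linf_le a c -> L2 f ->
  (forall m n, N (m, n) -> fhat a m n = 0) ->
  (forall m n, ~~ M (m, n) -> fhat f m n = 0) ->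
  forall m n, N (m, n) -> fhat (fun p => a p * f p) m n = 0.
Proof.
move=> NM ha' hf aN fM m n Nmn.
have ha : Linf_le a `|c|.
  by split; [exact: ha'.1|apply: filterS ha'.2 => p h /h /le_trans; apply; exact: ler_norm].
have La (g : T2 -> C) : L2 g -> L2 (fun p => a p * g p).
  move=> hg; have := L2_Linf hg ha; congr (L2 _); apply/funext => p; exact: mulrC.
apply/eqP; rewrite -cabs_eq0 -sqrf_eq0; apply/eqP/le_anti; rewrite sqr_ge0 andbT.
apply/ler_addgt0Pl => e e0; rewrite addr0.
pose K := `|c| ^+ 2 + 1; have K0 : 0 < K by rewrite ltr_wpDl // sqr_ge0.
have [s sM hs] := nsq_dense_spectrum hf (divr_gt0 e0 K0) fM.
have hw : L2 (fun p => f p - tpoly s p) by apply: L2B => //; exact: L2_tpoly.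
have -> : fhat (fun p => a p * f p) m n = fhat (fun p => a p * (f p - tpoly s p)) m n.
  have -> : (fun p => a p * (f p - tpoly s p)) = (fun p => a p * f p - a p * tpoly s p).
    by apply/funext => p; rewrite mulrBr.
  rewrite fhatB; [|exact: La|by apply: La; exact: L2_tpoly].
  suff -> : fhat (fun p => a p * tpoly s p) m n = 0 by rewrite subr0.
  elim: s sM {hs hw} => [_|t s ih /= /andP[tM sM]].
    rewrite (_ : (fun p => _) = (fun p => 0 * chr2 0 0 p)); last first.
      by apply/funext => p; rewrite /tpoly big_nil mulr0 mul0r.
    by rewrite fhatZ ?mul0r //; exact: L2_chr2.
  rewrite (_ : (fun p => _) = (fun p => t.1 * (a p * chr2 t.2.1 t.2.2 p) + a p * tpoly s p)); last first.
    by apply/funext => p; rewrite tpoly_cons mulrDr mulrCA.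
  rewrite fhatD; [|by apply: L2Z; apply: La; exact: L2_chr2|by apply: La; exact: L2_tpoly].
  rewrite ih // fhatZ ?addr0; last by apply: La; exact: L2_chr2.
  have -> : fhat (fun p => a p * chr2 t.2.1 t.2.2 p) m n = fhat a (m - t.2.1) (n - t.2.2).
    rewrite !fhatE; congr cint2; apply/funext => p.
    by rewrite -mulrA chr2D !opprB.
  rewrite aN ?mulr0 //; apply: NM => //; case: t tM => ? [] //.
apply: le_trans (bessel1 m n (La _ hw)) _.
apply: le_trans (nsq_mul_le hw ha (normr_ge0 _)) _.
apply: (@le_trans _ _ (`|c| ^+ 2 * (e / K))); first by rewrite ler_wpM2l ?sqr_ge0.
rewrite mulrCA ger_pMr // ler_pdivrMr // mul1r /K.
by rewrite lerDl.
Qed.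

End Inner.

(** * Exchange of the two variables *)

Section Swap.
Variable R : realType.
Local Notation C := R[i].
Local Notation T1 := (measurableTypeR R).
Local Notation T2 := (T2 R).
Local Notation mu := (@mu2 R).
Local Notation D := (@sqT2 R).
Local Notation mD := (@measurable_sqT2 R).

Definition sw (p : T2) : T2 := (p.2, p.1).

Lemma measurable_sw : measurable_fun setT sw.
Proof. exact: (measurable_fun_pair measurable_snd measurable_fst). Qed.

(** The image measure has the right values on rectangles, and a product measure is determined by
    these. *)
Lemma mu2_sw (A : set T2) : measurable A -> mu A = mu (sw @^-1` A).
Proof.
move=> mA.
have h := @product_measure_unique _ _ T1 T1 R (@lebesgue_measure R) (@lebesgue_measure R)
   (pushforward mu sw).
apply: (h measurable_sw) mA => B B' mB mB' {h}.
have hs : sw @^-1` (B `*` B') = B' `*` B.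
  by apply/seteqP; split => p /= [? ?]; split.
have h := @product_measure1E _ _ T1 T1 R (@lebesgue_measure R) (@lebesgue_measure R) _ _ mB' mB.
transitivity (mu (sw @^-1` (B `*` B'))) => //.
by rewrite hs; apply: etrans h _; rewrite muleC.
Qed.

Lemma D_sw : sw @^-1` D = D.
Proof. by apply/seteqP; split => p /= [? ?]; split. Qed.

Lemma integral_sw (h : T2 -> \bar R) : measurable_fun setT h ->
  mu.-integrable D h -> mu.-integrable D (h \o sw) /\
  (\int[mu]_(p in D) h (sw p) = \int[mu]_(p in D) h p)%E.
Proof.
move=> mh ih.
have swK : (h \o sw) \o sw = h by apply/funext => -[].
have mhs : measurable_fun setT (h \o sw) by exact: (measurableT_comp mh measurable_sw).
have ih2 : (pushforward mu sw).-integrable D (h \o sw).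
  by apply: (integrable_pushforward measurable_sw mhs) mD; rewrite swK D_sw.
have e : (\int[pushforward mu sw]_(p in D) (h \o sw) p = \int[mu]_(p in D) h p)%E.
  by rewrite (integral_pushforward measurable_sw mhs) ?swK ?D_sw //; exact: mD.
have em A : measurable A -> A `<=` D -> mu A = pushforward mu sw A.
  by move=> mA _; exact: mu2_sw.
split.
  have [mi fi] := elimT (integrableP _ _ _) ih2.
  apply/integrableP; split; first exact: mi.
  have E := @eq_measure_integral _ _ R D (pushforward mu sw) mu (fun p => `|(h \o sw) p|%E) em.
  by rewrite (E measurable_sw); exact: fi.
have E := @eq_measure_integral _ _ R D (pushforward mu sw) mu (h \o sw) em.
exact: (etrans (E measurable_sw) e).
Qed.

Lemma mfunC_sw (f : T2 -> C) : mfunC f -> mfunC (f \o sw).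
Proof.
move=> [f1 f2]; split.
- exact: (measurableT_comp f1 measurable_sw).
- exact: (measurableT_comp f2 measurable_sw).
Qed.

Lemma cint2_sw (f : T2 -> C) : I2 f -> I2 (f \o sw) /\ cint2 (f \o sw) = cint2 f.
Proof.
move=> [mf [i1 i2]].
have [j1 e1] := integral_sw (iffRL (measurable_EFinP _ _) mf.1) i1.
have [j2 e2] := integral_sw (iffRL (measurable_EFinP _ _) mf.2) i2.
split; first by split; [exact: mfunC_sw|split].
by rewrite /cint2; congr (_ * _ +i* (_ * _))%C; congr fine.
Qed.

Lemma L2_sw (f : T2 -> C) : L2 f -> L2 (f \o sw).
Proof.
move=> [mf hf]; split; first exact: mfunC_sw.
have mh := iffRL (measurable_EFinP _ _) (measurable_cabs_sqr mf).
by have [j _] := integral_sw mh hf.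
Qed.

Lemma ae_sw (Q : T2 -> Prop) : {ae mu, forall p, Q p} -> {ae mu, forall p, Q (sw p)}.
Proof.
move=> [N [mN N0 hN]]; exists (sw @^-1` N); split.
- by rewrite -[X in measurable X]setTI; exact: (measurable_sw measurableT mN).
- by rewrite -mu2_sw.
- by move=> p /= nQ; exact: hN.
Qed.

Lemma Linf_sw (f : T2 -> C) c : Linf_le f c -> Linf_le (f \o sw) c.
Proof.
move=> [mf hf]; split; first exact: mfunC_sw.
by apply: filterS (ae_sw hf) => p h [? ?]; apply: h; split.
Qed.

Lemma fhat_sw (f : T2 -> C) m n : I2 f -> fhat (f \o sw) m n = fhat f n m.
Proof.
move=> hf; rewrite !fhatE.
have hg : I2 (fun p => f p * chr2 (- n) (- m) p) := I2_Linf hf (Linf_chr2 R _ _).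
rewrite -(cint2_sw hg).2; congr cint2; apply/funext => p /=; congr (_ * _).
by rewrite /chr2 addrC.
Qed.

Lemma H2_sw f : H2 f -> H2 (f \o sw) :> Prop.
Proof.
move=> [hf h]; split; first exact: L2_sw.
move=> m n mn; rewrite fhat_sw; last exact: L2_I2.
by apply: h; case: mn; [right|left].
Qed.

Lemma Hinf_sw f : Hinf f -> Hinf (f \o sw) :> Prop.
Proof.
move=> [[c hf] h]; split; first by exists c; exact: Linf_sw.
move=> m n mn; rewrite fhat_sw; last exact: (Linf_I2 hf).
by apply: h; case: mn; [right|left].
Qed.

Lemma inner_sw f g : L2 f -> L2 g -> inner (f \o sw) (g \o sw) = inner f g :> C.
Proof. by move=> hf hg; exact: (cint2_sw (L2M_I2 hf (L2J hg))).2. Qed.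

Lemma nsq_sw f : L2 f -> nsq (f \o sw) = nsq f.
Proof. by move=> hf; rewrite /nsq inner_sw. Qed.

Lemma sw_comp (f : T2 -> C) : (f \o sw) \o sw = f.
Proof. by apply/funext => -[]. Qed.

Lemma ae_snd (Q : T1 -> Prop) : {ae leb R, forall y, Q y} -> {ae mu, forall p, Q p.2}.
Proof.
move=> [N [mN N0 hN]]; exists (setT `*` N); split.
- exact: measurableX.
- have h := @product_measure1E _ _ T1 T1 R (leb R) (@lebesgue_measure R) _ _ measurableT mN.
  by apply: etrans h _; rewrite -[X in (_ * X)%E]/(leb R N) N0 mule0.
- by move=> p /= nQ; split => //; exact: hN.
Qed.

End Swap.

(** * The bound for symbols with two bounded representatives *)

Section HankelBound.
Variable R : realType.
Local Notation C := R[i].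
Local Notation T2 := (T2 R).
Local Notation Linf_le := (@Linf_le R).
Local Notation L2 := (@L2 R).
Local Notation fhat := (@fhat R).
Local Notation chr2 := (@chr2 R).
Local Notation inner := (@inner R).
Local Notation tpoly := (@tpoly R).

Lemma tpoly_orth (P : pred (int * int)) s :
  nsq (tpoly s) = nsq (tpoly (seq.filter (fun t => P t.2) s)) +
                  nsq (tpoly (seq.filter (predC (fun t => P t.2)) s)).
Proof.
pose Q := fun t : C * (int * int) => P t.2; rewrite -/Q.
have -> : tpoly s = fun p => tpoly (seq.filter Q s) p + tpoly (seq.filter (predC Q) s) p.
  by apply/funext => p; exact: tpoly_filter.
rewrite nsqD; try exact: L2_tpoly.
rewrite inner_tpoly; last exact: L2_tpoly.
rewrite big1_seq ?mulr0 ?addr0 //.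
move=> t /=; rewrite mem_filter => /andP[/= tL _].
rewrite fhat_tpoly big1_seq ?mulr0 //.
move=> u; rewrite mem_filter /= => /andP[uP _].
rewrite -[_ && _]/(u.2 == t.2); case: eqP => h; last by rewrite mulr0.
by move: tL uP; rewrite /Q -h => /negbTE ->.
Qed.

Lemma nsq_tpoly_filter (P : pred (int * int)) s :
  nsq (tpoly (seq.filter (fun t => P t.2) s)) <= nsq (tpoly s).
Proof. by rewrite (tpoly_orth P s) lerDl nsq_ge0. Qed.

Lemma H2_chr2 m n : 0 <= m -> 0 <= n -> H2 (chr2 m n).
Proof.
move=> m0 n0; split; first exact: L2_chr2.
move=> k l kl; rewrite fhat_chr2; case: eqP => [mk|//]; case: eqP => [nl|//].
by move: kl; rewrite -mk -nl => -[]; rewrite ltNge ?m0 ?n0.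
Qed.

Lemma hankel_norm_le_sqrt2 (phi phi1 phi2 : T2 -> C) (c0 c : R) : 0 <= c ->
  Linf_le phi c0 -> Linf_le phi1 c -> Linf_le phi2 c ->
  (forall m n, m < 0 -> fhat (fun p => phi p - phi1 p) m n = 0) ->
  (forall m n, n < 0 -> fhat (fun p => phi p - phi2 p) m n = 0) ->
  hankel_norm_le phi (Num.sqrt 2 * c).
Proof.
move=> c_ge0 hphi h1 h2 hx hy f Hf h [Hh hproj].
have Lf : L2 f by case: Hf.
have Lmul a e : Linf_le a e -> L2 (fun p => a p * f p).
  move=> ha; have := L2_Linf Lf ha; congr (L2 _); apply/funext => p; exact: mulrC.
have Lpf : L2 (fmul phi f) := Lmul _ _ hphi.
have Lh : L2 h by case: Hh.
set g := fsub (fmul phi f) h.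
have Lg : L2 g by exact: L2B.
have gplus m n : 0 <= m -> 0 <= n -> fhat g m n = 0.
  by move=> m0 n0; rewrite -inner_chr2; apply: hproj; exact: H2_chr2.
have gneg m n : (m < 0 \/ n < 0) -> fhat g m n = fhat (fmul phi f) m n.
  by move=> mn; rewrite fhatB // (Hh.2 _ _ mn) subr0.
have LinfB a e : Linf_le a e -> Linf_le (fun p => phi p - a p) (c0 + e).
  move=> ha; apply: (LinfD hphi); split; first by apply: mfunCN; exact: ha.1.
  by apply: filterS ha.2 => p hh /hh; rewrite cabsN.
have fh a e m n : Linf_le a e -> fhat (fun p => (phi p - a p) * f p) m n = 0 ->
    fhat (fmul phi f) m n = fhat (fun p => a p * f p) m n.
  move=> ha h0; apply/eqP; rewrite -subr_eq0 -fhatB //; last exact: Lmul ha.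
  rewrite -h0; apply/eqP; congr (fhat _ m n); apply/funext => p.
  by rewrite /fmul mulrBl.
have gx m n : m < 0 -> fhat g m n = fhat (fun p => phi1 p * f p) m n.
  move=> m0; rewrite gneg; last by left.
  apply: (fh _ _ _ _ h1).
  apply: (@fhat_mulM R (fun k => k.1 < 0) (fun k => 0 <= k.1) _ _ _ _ (LinfB _ _ h1) Lf) => //=.
  - by move=> *; lra.
  - by move=> k l; rewrite -ltNge => k0; apply: Hf.2; left.
have gy m n : n < 0 -> fhat g m n = fhat (fun p => phi2 p * f p) m n.
  move=> m0; rewrite gneg; last by right.
  apply: (fh _ _ _ _ h2).
  apply: (@fhat_mulM R (fun k => k.2 < 0) (fun k => 0 <= k.2) _ _ _ _ (LinfB _ _ h2) Lf) => //=.
  - by move=> *; lra.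
  - by move=> k l; rewrite -ltNge => k0; apply: Hf.2; right.
suff main : nsq g <= 2 * c ^+ 2 * nsq f.
  rewrite !norm2E; apply: (@le_trans _ _ (Num.sqrt (2 * c ^+ 2 * nsq f))).
    by rewrite ler_wsqrtr.
  rewrite sqrtrM; last by rewrite mulr_ge0 // sqr_ge0.
  by rewrite sqrtrM // sqrtr_sqr ger0_norm.
apply/ler_addgt0Pl => e e0.
have [s hs] := nsq_dense Lg e0.
pose P := fun k : int * int => k.1 < 0.
pose Q := fun k : int * int => k.2 < 0.
(* All frequencies with m < 0 go to [phi1], those with m >= 0 > n to [phi2]; on the rest [g] has no
   coefficients. The parts are disjoint, so the squared norms of the first two add up to at most
   that of [tpoly s]. *)
pose s1 := seq.filter (fun t : C * _ => P t.2) s.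
pose s' := seq.filter (predC (fun t : C * _ => P t.2)) s.
pose s2 := seq.filter (fun t : C * _ => Q t.2) s'.
pose s3 := seq.filter (predC (fun t : C * _ => Q t.2)) s'.
have e1 : inner g (tpoly s1) = inner (fun p => phi1 p * f p) (tpoly s1).
  rewrite !inner_tpoly //; last exact: Lmul h1.
  rewrite !big_seq; apply: eq_bigr => t; rewrite mem_filter => /andP[tP _].
  by rewrite gx.
have e2 : inner g (tpoly s2) = inner (fun p => phi2 p * f p) (tpoly s2).
  rewrite !inner_tpoly //; last exact: Lmul h2.
  rewrite !big_seq; apply: eq_bigr => t; rewrite mem_filter => /andP[tP _].
  by rewrite gy.
have e3 : inner g (tpoly s3) = 0.
  rewrite inner_tpoly // big1_seq // => t /=.
  rewrite !mem_filter /= /P /Q -!leNgt => /andP[t2 /andP[t1 _]].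
  by rewrite gplus // mulr0.
have ip : inner g (tpoly s) = inner g (tpoly s1) + inner g (tpoly s2).
  have -> : tpoly s = fun p => tpoly s1 p + (tpoly s2 p + tpoly s3 p).
    by apply/funext => p; rewrite -tpoly_filter -tpoly_filter.
  rewrite (innerDr (L2_tpoly s1) (L2D (L2_tpoly s2) (L2_tpoly s3)) Lg).
  by rewrite (innerDr (L2_tpoly s2) (L2_tpoly s3) Lg) e3 addr0.
have np : nsq (tpoly s1) + nsq (tpoly s2) <= nsq (tpoly s).
  by rewrite (tpoly_orth P s) lerD2l; exact: nsq_tpoly_filter.
have b1 := Re_inner_le (Lmul _ _ h1) (L2_tpoly s1).
have b2 := Re_inner_le (Lmul _ _ h2) (L2_tpoly s2).
have n1 := nsq_mul_le Lf h1 c_ge0; have n2 := nsq_mul_le Lf h2 c_ge0.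
move: hs; rewrite (nsqB Lg (L2_tpoly s)) ip cReD e1 e2 -mulrA => hs.
(* With t = [tpoly s]: |g|^2 <= e + 2 Re <g, t> - |t|^2, and the norms of the two parts of t cancel
   against |t|^2. What remains is |phi1 f|^2 + |phi2 f|^2, the origin of the factor 2. *)
have arith (x r1 r2 a1 a2 p1 p2 p N : R) : x - 2 * (r1 + r2) + p <= e ->
    2 * r1 <= a1 + p1 -> 2 * r2 <= a2 + p2 -> a1 <= N -> a2 <= N -> p1 + p2 <= p ->
    x <= e + 2 * N by clear; lra.
exact: (arith _ _ _ _ _ _ _ _ _ hs b1 b2 n1 n2 np).
Qed.

End HankelBound.

(** * Blaschke products and the two bounds *)

Section CintEssBound.
Context d (T : measurableType d) (R : realType).
Variables (mu : {measure set T -> \bar R}) (D : set T).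
Hypothesis mD : measurable D.
Hypothesis finD : (mu D < +oo)%E.

(** The real and imaginary parts are bounded separately, whence the factor 2; only the existence of
    a uniform bound matters in the applications. *)
Lemma cabs_Cint_le (f : T -> R[i]) (c : R) : ess_boundedC mu D f c ->
  cabs (Cint mu D f) <= 2 * (`|c| * fine (mu D)).
Proof.
move=> hf; have [mf [i1 i2]] := integrableC_bounded mD finD hf.
have aux (h : T -> R) : mu.-integrable D (EFin \o h) ->
    {ae mu, forall p, D p -> `|h p| <= `|c|} -> `|Rintegral mu D h| <= `|c| * fine (mu D).
  move=> ih hc; apply: le_trans (le_normr_Rintegral mD ih) _.
  rewrite -Rintegral_cst // /Rintegral; have ic := integrable_cstD mD finD `|c|.
  have ia := integrable_norm ih.
  apply: fine_le; [exact: (integrable_fin_num mD ia)|exact: (integrable_fin_num mD ic)|].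
  apply: ae_ge0_le_integral => //.
  exact: (measurable_int mu ia).
have fc : {ae mu, forall p, D p -> cabs (f p) <= `|c|}.
  by apply: filterS hf.2 => p h /h /le_trans; apply; exact: ler_norm.
apply: le_trans (cabs_le_ReIm _) _; rewrite mulr_natl mulr2n; apply: lerD.
- apply: aux => //; apply: filterS fc => p h /h; apply: le_trans; exact: normr_Re_le.
- apply: aux => //; apply: filterS fc => p h /h; apply: le_trans; exact: normr_Im_le.
Qed.

End CintEssBound.

#[global] Instance ae_leb_filter (R : realType) : Filter (almost_everywhere (leb R)).
Proof. exact: (ae_filter_ringOfSetsType (@lebesgue_measure R)). Qed.

Section Blaschke.
Variable R : realType.
Local Notation C := R[i].
Local Notation T1 := (measurableTypeR R).
Local Notation T2 := (T2 R).
Local Notation S := (@sqT R).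
Local Notation mS := (@measurable_sqT R).
Local Notation Linf_le := (@Linf_le R).
Local Notation I2 := (@I2 R).
Local Notation I1 := (@I1 R).
Local Notation fhat := (@fhat R).
Local Notation chr2 := (@chr2 R).
Local Notation ex := (@ex R).
Local Notation ey := (@ey R).
Local Notation e1 := (@e1 R).
Local Notation Ix := (@Ix R).
Local Notation Iy := (@Iy R).
Local Notation cint1 := (@cint1 R).
Local Notation ext1 := (@ext1 R).

Lemma cabs_bfac a p : cabs a < 1 -> cabs (bfac e1 a p) = 1.
Proof.
move=> a1; apply/eqP; rewrite -(@pexpr_eq1 _ _ 2) ?cabs_ge0 //; apply/eqP.
by apply: complexI; rewrite cabs_sqrJ (bfacK (hardy_1 R)).
Qed.

Section Family.
Variables (n : nat) (a : 'I_n -> C).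
Hypothesis a1 : forall j, cabs (a j) < 1.

Lemma blaschke_1 t : blaschke a t = \prod_(j < n) bfac e1 (a j) t.
Proof. by rewrite /blaschke; apply: eq_bigr => j _; rewrite /bfac e1_expi. Qed.

Lemma cabs_blaschke t : cabs (blaschke a t) = 1.
Proof.
rewrite blaschke_1; elim/big_rec: _ => [|j x _ h]; first exact: cabs1.
by rewrite cabsM h cabs_bfac ?mulr1.
Qed.

Lemma blaschkeK t : blaschke a t * (blaschke a t)^*%C = 1.
Proof. by rewrite -cabs_sqrJ cabs_blaschke expr1n. Qed.

Lemma mfunC_blaschke : mfunC (blaschke a : T1 -> C).
Proof.
apply: (@mfunC_prod _ _ R _ _ (fun j t => (expi t - a j) / (1 - (a j)^*%C * expi t))) => j.
have me : mfunC (fun t : T1 => expi t) by apply: mfunC_expi; exact: measurable_id.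
apply: mfunCM; first by apply: mfunCB => //; exact: mfunC_cst.
apply: mfunCV; apply: mfunCB; first exact: mfunC_cst.
by apply: mfunCM => //; exact: mfunC_cst.
Qed.

Lemma mfunC_fst (g : T1 -> C) : mfunC g -> mfunC (fun p : T2 => g p.1).
Proof.
move=> [g1 g2]; split.
- exact: (measurableT_comp g1 measurable_fst).
- exact: (measurableT_comp g2 measurable_fst).
Qed.

Lemma mfunC_snd (g : T1 -> C) : mfunC g -> mfunC (fun p : T2 => g p.2).
Proof.
move=> [g1 g2]; split.
- exact: (measurableT_comp g1 measurable_snd).
- exact: (measurableT_comp g2 measurable_snd).
Qed.

Lemma Linf_blaschke_x : Linf_le (fun p => blaschke a p.1) 1.
Proof.
by apply: Linf_bnd => [|p]; [exact: mfunC_fst mfunC_blaschke|rewrite cabs_blaschke].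
Qed.

Lemma Linf_blaschke_y : Linf_le (fun p => blaschke a p.2) 1.
Proof.
by apply: Linf_bnd => [|p]; [exact: mfunC_snd mfunC_blaschke|rewrite cabs_blaschke].
Qed.

Lemma blaschke_lower_x f k m0 : I2 f -> (forall m, m < m0 -> fhat f m k = 0) ->
  forall m, m < m0 -> fhat (fun p => f p * blaschke a p.1) m k = 0.
Proof.
move=> hf h m mm.
have hl : lower (Ix k) ex f m0 by move=> l lm; rewrite hat_x h.
have -> : (fun p => f p * blaschke a p.1) =
    (fun p => f p * \prod_(j <- index_enum 'I_n) bfac ex (a j) p).
  by apply/funext => p; rewrite blaschke_x.
have [_ H] := prod_lower_bfac (hardy_x R k) a1 (index_enum 'I_n) hf hl.
by rewrite -hat_x; exact: H.
Qed.

Lemma blaschke_lower_y f k m0 : I2 f -> (forall m, m < m0 -> fhat f k m = 0) ->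
  forall m, m < m0 -> fhat (fun p => f p * blaschke a p.2) k m = 0.
Proof.
move=> hf h m mm.
have hl : lower (Iy k) ey f m0 by move=> l lm; rewrite hat_y h.
have -> : (fun p => f p * blaschke a p.2) =
    (fun p => f p * \prod_(j <- index_enum 'I_n) bfac ey (a j) p).
  by apply/funext => p; rewrite blaschke_y.
have [_ H] := prod_lower_bfac (hardy_y R k) a1 (index_enum 'I_n) hf hl.
by rewrite -hat_y; exact: H.
Qed.

Lemma blaschkeJ_upper_y f k m0 : I2 f -> (forall m, m0 <= m -> fhat f k m = 0) ->
  forall m, m0 <= m -> fhat (fun p => f p * (blaschke a p.2)^*%C) k m = 0.
Proof.
move=> hf h m mm.
have hl : upper (Iy k) ey f m0 by move=> l lm; rewrite hat_y h.
have -> : (fun p => f p * (blaschke a p.2)^*%C) =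
    (fun p => f p * \prod_(j <- index_enum 'I_n) (bfac ey (a j) p)^*%C).
  by apply/funext => p; rewrite blaschke_y cconj_prod.
have [_ H] := prod_upper_bfacJ (hardy_y R k) a1 (index_enum 'I_n) hf hl.
by rewrite -hat_y; exact: H.
Qed.

(** A function of y alone mixes only coefficients of the same x-frequency; a vanishing row is the
    case where every index may serve as [m0]. *)
Lemma blaschkeJ_zero_y f k : I2 f -> (forall m, fhat f k m = 0) ->
  forall m, fhat (fun p => f p * (blaschke a p.2)^*%C) k m = 0.
Proof. by move=> hf h m; apply: (blaschkeJ_upper_y hf (m0 := m)). Qed.

Lemma blaschke_zero_y f k : I2 f -> (forall m, fhat f k m = 0) ->
  forall m, fhat (fun p => f p * blaschke a p.2) k m = 0.
Proof. by move=> hf h m; apply: (blaschke_lower_y hf (m0 := m + 1)) => //; rewrite ltrDl. Qed.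

Lemma blaschke_zero_x f k : I2 f -> (forall m, fhat f m k = 0) ->
  forall m, fhat (fun p => f p * blaschke a p.1) m k = 0.
Proof. by move=> hf h m; apply: (blaschke_lower_x hf (m0 := m + 1)) => //; rewrite ltrDl. Qed.

Lemma blaschkeJ_lower_x f k : injective a -> I2 f -> (forall m, m < 0 -> fhat f m k = 0) ->
  (forall j, extG (Ix k) ex (a j) f = 0) ->
  forall m, m < 0 -> fhat (fun p => f p * (blaschke a p.1)^*%C) m k = 0.
Proof.
move=> ainj hf h hz m mm.
have hl : lower (Ix k) ex f 0 by move=> l lm; rewrite hat_x h.
have -> : (fun p => f p * (blaschke a p.1)^*%C) =
    (fun p => f p * \prod_(j <- index_enum 'I_n) (bfac ex (a j) p)^*%C).
  by apply/funext => p; rewrite blaschke_x cconj_prod.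
have H := prod_lower_bfacJ (hardy_x R k) a1 ainj (index_enum_uniq _) hf hl (fun j _ => hz j).
by rewrite -hat_x; exact: H.
Qed.

(* One factor of the Blaschke product cancels the pole of the Cauchy kernel. *)
Lemma extG_blaschke_x f k j : I2 f -> (forall m, m < 0 -> fhat f m k = 0) ->
  extG (Ix k) ex (a j) (fun p => f p * blaschke a p.1) = 0.
Proof.
move=> hf h.
have hl : lower (Ix k) ex f 0 by move=> l lm; rewrite hat_x h.
pose s := [seq i <- index_enum 'I_n | i != j].
have [hc hlw] := prod_lower_bfac (hardy_x R k) a1 s hf hl.
have := extG_bfac (hardy_x R k) (a1 j) (a1 j) hc hlw.
rewrite subrr mul0r mulr0; congr (extG _ _ _ _ = _); apply/funext => p.
by rewrite blaschke_x (bigD1 j) //= big_filter -mulrA; congr (_ * _); rewrite mulrC.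
Qed.

End Family.

Lemma section_Linf1 f c : Linf_le f c ->
  {ae leb R, forall y, S y -> Linf1 (fun x => f (x, y)) c}.
Proof.
move=> [mf hf]; apply: filterS (ae_slices hf) => y h Sy; split.
- exact: mfunC_section.
- exact: h.
Qed.

Lemma mfunC_ext1 f z : cabs z < 1 -> mfunC f -> mfunC (fun y : T1 => ext1 f z y).
Proof.
move=> z1 mf.
have := @mfunC_cint1 R (fun p => f p / (1 - z * ex (-1) p)).
have -> : (fun y : T1 => ext1 f z y) =
   (fun y => cint1 (fun x => f (x, y) / (1 - z * ex (-1) (x, y)))).
  by apply/funext => y; congr cint1; apply/funext => x; rewrite -exN_expi.
apply; apply: mfunCM => //.
exact: (Linf_cauchy (-1) 0 z1).1.
Qed.

Lemma ext1_bnd f z c : cabs z < 1 -> Linf_le f c ->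
  exists K : R, {ae leb R, forall y, S y -> cabs (ext1 f z y) <= K}.
Proof.
move=> z1 hf.
pose c' := c * (1 - cabs z)^-1.
exists (cabs (c1 R) * (2 * (`|c'| * fine (leb R S)))).
apply: filterS (section_Linf1 hf) => y h Sy; have [mh bh] := h Sy.
rewrite ext1E /extG cint1E cabsM ler_wpM2l ?cabs_ge0 //.
apply: (cabs_Cint_le mS (@leb_sqT_fin R)); split.
  apply: mfunCM => //; exact: (Linf1_cauchy (-1) z1).1.
apply: filterS bh => x hx Sx; rewrite cabsM /c'.
apply: ler_pM; rewrite ?cabs_ge0 //; first exact: hx.
by apply: one_sub_inv_bnd => //; rewrite cabs_e1.
Qed.

Lemma Linf_ext1 f z c : cabs z < 1 -> Linf_le f c ->
  exists K, Linf_le (fun p => ext1 f z p.2) K.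
Proof.
move=> z1 hf; have [K hK] := ext1_bnd z1 hf; exists K; split.
  by apply: mfunC_snd; apply: mfunC_ext1 => //; exact: hf.1.
by apply: filterS (ae_snd hK) => p h [_ Sp]; exact: h.
Qed.

Lemma ae_eq_cint1 (f g : T1 -> C) : mfunC f -> mfunC g ->
  {ae leb R, forall y, S y -> f y = g y} -> cint1 f = cint1 g.
Proof. by move=> mf mg h; rewrite !cint1E (ae_eq_Cint mS mf mg h). Qed.

Lemma extG_x_Fubini f z c k : cabs z < 1 -> Linf_le f c ->
  extG (Ix k) ex z f = cint1 (fun y => ext1 f z y * e1 (- k) y).
Proof.
move=> z1 hf; have If := Linf_I2 hf.
have Iq : I2 (fun p => f p / (1 - z * ex (-1) p) * chr2 0 (- k) p).
  by apply: (@I2_Linf R _ _ 1); [exact: (I2_Linf If (Linf_cauchy (-1) 0 z1))|exact: Linf_chr2].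
rewrite /extG /Ix (cint2_Fubini Iq).2.
apply: ae_eq_cint1.
- exact: (mfunC_cint1 Iq.1).
- by apply: mfunCM; [apply: mfunC_ext1 => //; exact: hf.1|exact: mfunC_e1].
apply: filterS (section_Linf1 hf) => y h Sy.
have h1 : I1 (fun x => f (x, y) / (1 - z * e1 (-1) x)).
  by apply: (I1_Linf (Linf1_I1 (h Sy))); exact: Linf1_cauchy.
rewrite ext1E /extG mulrC -cint1Z //; congr cint1; apply/funext => x.
rewrite chr2_sect mulrC; congr (_ * (_ / (1 - z * _))).
- by rewrite /e1 mul0r expi0 mulr1.
- by rewrite /ex chr2_sect /e1 mul0r expi0 mul1r.
Qed.

Lemma fhat_snd (g : T1 -> C) m k : I2 (fun p => g p.2) ->
  fhat (fun p => g p.2) m k = (m == 0)%:R * cint1 (fun y => g y * e1 (- k) y).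
Proof.
move=> Ig; rewrite fhatE.
have Iq : I2 (fun p => g p.2 * chr2 (- m) (- k) p).
  by apply: (I2_Linf Ig); exact: Linf_chr2.
have Ie := Linf1_I1 (Linf1_e1 R (- m)).
rewrite (cint2_Fubini Iq).2.
have -> : (fun y => cint1 (fun x => g (x, y).2 * chr2 (- m) (- k) (x, y))) =
   (fun y => (g y * e1 (- k) y) * cint1 (e1 (- m))).
  apply/funext => y; rewrite -cint1Z //; congr cint1; apply/funext => x.
  by rewrite chr2_sect mulrA.
have [->|m0] := eqVneq m 0; last first.
  rewrite (@cint1_e1 R (- m)) ?oppr_eq0 // mul0r.
  under eq_fun do rewrite mulr0.
  exact: cint1_cst.
have -> : e1 (- 0) = (fun=> 1 : C) by apply/funext => x; rewrite oppr0 /e1 mul0r expi0.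
rewrite cint1_cst mul1r; congr cint1; apply/funext => y; exact: mulr1.
Qed.

Lemma fhat_neg_y_ext f z k : cabs z < 1 -> I2 f -> (forall m, fhat f m k = 0) ->
  extG (Ix k) ex z f = 0.
Proof.
move=> z1 hf h; rewrite (extGE (hardy_x R k)).
by apply: (upper_div (hardy_x R k) z1 hf (m0 := 0)) => // m _; rewrite hat_x h.
Qed.

(* The projection of u conj(b_z) onto functions analytic in x:
   conj(b_z)(u - u(z,.)) is analytic, conj(b_z) + conj(z) is anti-analytic. *)
Lemma proj_step z u : cabs z < 1 -> Hinf u ->
  exists h, Hinf h /\ forall m k, 0 <= m ->
    fhat (fun p => u p * (bfac ex z p)^*%C - h p) m k = 0.
Proof.
move=> z1 [[c hu] hz].
have [K hv] := Linf_ext1 z1 hu.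
set v := (fun p : T2 => ext1 u z p.2) in hv.
have Iu := Linf_I2 hu; have Iv := Linf_I2 hv.
have vE m k : fhat v m k = (m == 0)%:R * extG (Ix k) ex z u.
  by rewrite (@fhat_snd (fun y => ext1 u z y)) // (extG_x_Fubini k z1 hu).
have Hx k := hardy_x R k.
have bE p : bfac ex z p = blaschke (fun _ : 'I_1 => z) p.1.
  by rewrite blaschke_x big_ord1.
have Lb : Linf_le (fun p => (bfac ex z p)^*%C) 1.
  under [X in Defs.Linf_le X]eq_fun do rewrite bE.
  exact: (LinfJ (@Linf_blaschke_x 1 (fun=> z) (fun=> z1))).
have cl f : I2 f -> I2 (fun p => f p * (bfac ex z p)^*%C).
  by move=> hf; exact: (I2_Linf hf Lb).
have Luv : Linf_le (fun p => u p - v p) (c + K).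
  apply: (LinfD hu); split; first by apply: mfunCN; exact: hv.1.
  by apply: filterS hv.2 => p h /h; rewrite cabsN.
have Iuv := Linf_I2 Luv.
pose h p := (u p - v p) * (bfac ex z p)^*%C - z^*%C * v p.
have Lz : Linf_le (fun p => - (z^*%C * v p)) (cabs z * K).
  have [mv bv] := hv; split; first by apply: mfunCN; apply: mfunCM => //; exact: mfunC_cst.
  apply: filterS bv => p hp /hp hp'; rewrite cabsN cabsM cabsJ.
  by rewrite ler_wpM2l ?cabs_ge0.
have Lbuv : Linf_le (fun p => (u p - v p) * (bfac ex z p)^*%C) (1 * (c + K)).
  by have := LinfM Lb Luv ler01; congr Defs.Linf_le; apply/funext => p; rewrite mulrC.
have Lh := LinfD Lbuv Lz.
have hE m k : fhat h m k = fhat (fun p => (u p - v p) * (bfac ex z p)^*%C) m k - z^*%C * fhat v m k.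
  by rewrite fhatB ?fhatZ //; try exact: (Linf_L2 hv); try exact: (Linf_L2 Lbuv);
     apply: L2Z; exact: (Linf_L2 hv).
exists h; split.
  split; first by eexists; exact: Lh.
  move=> m k mk; rewrite hE.
  have extv : extG (Ix k) ex z v = extG (Ix k) ex z u.
    rewrite [LHS](extGE (Hx k)).
    have v1 : upper (Ix k) ex v 1.
      by move=> l l1; rewrite hat_x vE gt_eqF ?mul0r // (lt_le_trans _ l1).
    have := hatG_div (Hx k) (-1) 0 z1 Iv.
    have -> := upper_div (Hx k) z1 Iv v1 (m := 0 - -1); last by rewrite opprK add0r.
    rewrite mulr0 subr0.
    by move=> ->; rewrite hat_x vE eqxx mul1r.
  (* For k < 0 the whole row of [u], and with it that of [v], is zero. For k >= 0 the condition is m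
     < 0 and the root of u - v at [z] is used. *)
  have [k0|k0] := ltP k 0.
    have z0 : extG (Ix k) ex z u = 0.
      by apply: fhat_neg_y_ext => // l; apply: hz; right.
    rewrite vE z0 !mulr0 subr0.
    have := upper_bfacJ (Hx k) z1 Iuv (m0 := m); rewrite /upper.
    move=> /(_ _ m (lexx m)); rewrite hat_x; apply => l _.
    rewrite hat_x fhatB; [|exact: (Linf_L2 hu)|exact: (Linf_L2 hv)].
    by rewrite vE z0 mulr0 subr0 hz //; right.
  have m0 : m < 0 by case: mk => //; rewrite ltNge k0.
  rewrite vE lt_eqF // mul0r mulr0 subr0 -hat_x.
  apply: (lower_bfacJ (Hx k) z1 Iuv) => //.
    move=> l l0; rewrite hat_x fhatB; [|exact: (Linf_L2 hu)|exact: (Linf_L2 hv)].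
    by rewrite vE lt_eqF // mul0r subr0 hz //; left.
  by rewrite (extGB (Hx k)) // extv subrr.
move=> m k m0.
(* The remainder is v (conj b_z + conj z). As [v] does not depend on x, the factor e^{-ix} / (1 - z
   e^{-ix}) leaves only negative x-frequencies. *)
have -> : (fun p => u p * (bfac ex z p)^*%C - h p) =
    (fun p => (1 - z * z^*%C) * ((v p * ex (-1) p) / (1 - z * ex (-1) p))).
  apply/funext => p; rewrite /h (bfacJ (Hx k)).
  by have d0 := den_neq0 (Hx k) (-1) p z1; field.
have cw := hf_clsE (Hx k) (-1) Iv.
rewrite -hat_x (hatGZ (Hx k)); last exact: (hf_clsV (Hx k) (-1) z1 cw).
rewrite (upper_div (Hx k) z1 cw (m0 := 0)) ?mulr0 // => l l0.
rewrite (hatG_shift (Hx k)) hat_x vE opprK gt_eqF ?mul0r //.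
by rewrite ltr_wpDl.
Qed.

End Blaschke.

(** * The projection of conj b u onto H^2 *)

Section Projection.
Variable R : realType.
Local Notation C := R[i].
Local Notation Linf_le := (@Linf_le R).
Local Notation L2 := (@L2 R).
Local Notation I2 := (@I2 R).
Local Notation I1 := (@I1 R).
Local Notation fhat := (@fhat R).
Local Notation inner := (@inner R).
Local Notation ex := (@ex R).
Local Notation cint2 := (@cint2 R).
Local Notation sw := (@sw R).

(** One factor at a time: the error made so far has only negative x-frequencies and keeps them under
    a further conjugate factor, while [proj_step] replaces the analytic part. *)
Lemma proj_blaschke_x n (a : 'I_n -> C) u : (forall j, cabs (a j) < 1) -> Hinf u ->
  exists h, Hinf h /\ forall m k, 0 <= m ->
    fhat (fun p => u p * (blaschke a p.1)^*%C - h p) m k = 0.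
Proof.
move=> a1 hu.
suff: forall s : seq 'I_n, exists h, Hinf h /\ forall m k, 0 <= m ->
    fhat (fun p => u p * \prod_(j <- s) (bfac ex (a j) p)^*%C - h p) m k = 0.
  move=> /(_ (index_enum 'I_n)) [h [hh H]]; exists h; split=> // m k m0.
  rewrite -[RHS](H m k m0).
  have -> // : (fun p => u p * (blaschke a p.1)^*%C - h p) =
     (fun p => u p * \prod_(j <- index_enum 'I_n) (bfac ex (a j) p)^*%C - h p).
  by apply/funext => p; rewrite blaschke_x cconj_prod.
elim=> [|j s [h1 [hh1 H1]]].
  exists u; split=> // m k m0.
  have -> : (fun p => u p * \prod_(j <- [::]) (bfac ex (a j) p)^*%C - u p) = (fun=> 0 * (1 : C)).
    by apply/funext => p; rewrite big_nil mulr1 subrr mul0r.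
  have I1 : I2 (fun=> 1) by apply: (@Linf_I2 R _ 1); apply: Linf_bnd => [|p]; [exact: mfunC_cst|rewrite cabs1].
  by rewrite -hat_x (hatGZ (hardy_x R k)) // mul0r.
have [h [hh H]] := proj_step (a1 j) hh1.
exists h; split=> // m k m0.
have [[c cu] _] := hu; have [[c1 ch1] _] := hh1; have [[c2 ch] _] := hh.
have Hx := hardy_x R k.
have Iu := (prod_upper_bfacJ Hx a1 s (Linf_I2 cu) (m0 := m)).
set f1 := (fun p => u p * \prod_(j <- s) (bfac ex (a j) p)^*%C - h1 p) in H1.
have If1 : I2 f1.
  apply: I2B; last exact: Linf_I2 ch1.
  elim: (s) => [|i l ih]; last first.
    have := cls_bfacJ Hx (a1 i) ih; congr I2; apply/funext => p.
    by rewrite big_cons; ring.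
  have -> : (fun p => u p * \prod_(j <- [::]) (bfac ex (a j) p)^*%C) = u; last exact: Linf_I2 cu.
  by apply/funext => p; rewrite big_nil mulr1.
have -> : (fun p => u p * \prod_(i <- j :: s) (bfac ex (a i) p)^*%C - h p) =
  (fun p => f1 p * (bfac ex (a j) p)^*%C + (h1 p * (bfac ex (a j) p)^*%C - h p)).
  by apply/funext => p; rewrite big_cons /f1; ring.
rewrite -hat_x (hatGD Hx).
- rewrite [X in _ + X]hat_x H // addr0.
  by apply: (upper_bfacJ Hx (a1 j) If1 (m0 := 0)) => // l l0; rewrite hat_x H1.
- exact: (cls_bfacJ Hx (a1 j) If1).
- by apply: I2B; [apply: (cls_bfacJ Hx) => //; exact: Linf_I2 ch1|exact: Linf_I2 ch].
Qed.

Lemma proj_blaschke_y n (a : 'I_n -> C) u : (forall j, cabs (a j) < 1) -> Hinf u ->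
  exists h, Hinf h /\ forall m k, 0 <= k ->
    fhat (fun p => u p * (blaschke a p.2)^*%C - h p) m k = 0.
Proof.
move=> a1 hu; have [h [hh H]] := proj_blaschke_x a1 (Hinf_sw hu).
have [[c cu] _] := hu; have [[c2 ch] _] := hh.
exists (h \o sw); split; first exact: Hinf_sw.
move=> m k k0.
have IF : I2 (fun p => (u \o sw) p * (blaschke a p.1)^*%C - h p).
  apply: I2B; last exact: (Linf_I2 ch).
  exact: (I2_Linf (Linf_I2 (Linf_sw cu)) (LinfJ (Linf_blaschke_x a1))).
have := etrans (fhat_sw m k IF) (H k m k0); congr (_ = _).
by have -> : (fun p => u p * (blaschke a p.2)^*%C - (h \o sw) p) =
   (fun p => (u \o sw) p * (blaschke a p.1)^*%C - h p) \o sw by apply/funext => -[].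
Qed.

Lemma fhatJ g m n : L2 g -> fhat (fun p => (g p)^*%C) m n = (fhat g (- m) (- n))^*%C.
Proof.
move=> hg; have := innerC hg (L2_chr2 R (- m) (- n)); rewrite inner_chr2 => <-.
rewrite fhatE; congr cint2; apply/funext => p; exact: mulrC.
Qed.

(** Projections are tested against all of H^2, so vanishing coefficients must be turned into
    orthogonality. The conjugate of the inner product is the coefficient at (0, 0) of [conj g v],
    where [conj g] has no coefficient with both indices <= 0. *)
Lemma inner_H2_zero g v c : Linf_le g c -> H2 v ->
  (forall m n, 0 <= m -> 0 <= n -> fhat g m n = 0) -> inner g v = 0.
Proof.
move=> hg [hv vz] gz.
have Lg := Linf_L2 hg.
rewrite innerC //.
suff -> : inner v g = 0 by rewrite raddf0.
pose N := [pred x : int * int | (x.1 <= 0) && (x.2 <= 0)].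
pose M := [pred x : int * int | (0 <= x.1) && (0 <= x.2)].
have h := @fhat_mulM R N M (fun p => (g p)^*%C) v c.
have -> : inner v g = fhat (fun p => (g p)^*%C * v p) 0 0.
  rewrite fhatE; congr cint2; apply/funext => p.
  by rewrite oppr0 chr2_0 mulr1 mulrC.
apply: h => //.
- by move=> m n k l /= /andP[? ?] /andP[? ?]; apply/andP; split; lra.
- exact: LinfJ.
- move=> m n /andP[/= m0 n0].
  by rewrite fhatJ // gz ?oppr_ge0 // raddf0.
- by move=> m n /=; rewrite negb_and -!ltNge => /orP[] h'; apply: vz; [left|right].
Qed.

(** Projecting in x and then in y suffices: the error of the x-step has no coefficient with m >= 0,
    and multiplication by the conjugate Blaschke product in y preserves this. *)
Lemma proj_exists n (z w : 'I_n -> C) u :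
  (forall j, cabs (z j) < 1) -> (forall j, cabs (w j) < 1) -> Hinf u ->
  exists2 h, Hinf h & is_projH2 (fun p => (blaschke z p.1 * blaschke w p.2)^*%C * u p) h.
Proof.
move=> z1 w1 hu.
have [h1 [hh1 H1]] := proj_blaschke_x z1 hu.
have [h [hh H]] := proj_blaschke_y w1 hh1.
have [[c cu] _] := hu; have [[c1 ch1] _] := hh1; have [[c2 ch] hz] := hh.
exists h => //; split; first by split => //; exact: (Linf_L2 ch).
move=> v hv.
have Lz := LinfJ (Linf_blaschke_x z1); have Lw := LinfJ (Linf_blaschke_y w1).
have L1 : Linf_le (fun p => u p * (blaschke z p.1)^*%C - h1 p) (1 * c + c1).
  apply: LinfD; last by split; [apply: mfunCN; exact: ch1.1|apply: filterS ch1.2 => p h' /h'; rewrite cabsN].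
  by have := LinfM Lz cu ler01; congr Defs.Linf_le; apply/funext => p; rewrite mulrC.
have L2 : Linf_le (fun p => h1 p * (blaschke w p.2)^*%C - h p) (1 * c1 + c2).
  apply: LinfD; last by split; [apply: mfunCN; exact: ch.1|apply: filterS ch.2 => p h' /h'; rewrite cabsN].
  by have := LinfM Lw ch1 ler01; congr Defs.Linf_le; apply/funext => p; rewrite mulrC.
have L1w : Linf_le (fun p => (u p * (blaschke z p.1)^*%C - h1 p) * (blaschke w p.2)^*%C) (1 * (1 * c + c1)).
  by have := LinfM Lw L1 ler01; congr Defs.Linf_le; apply/funext => p; rewrite mulrC.
have E : fsub (fun p => (blaschke z p.1 * blaschke w p.2)^*%C * u p) h =
  (fun p => (u p * (blaschke z p.1)^*%C - h1 p) * (blaschke w p.2)^*%C +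
            (h1 p * (blaschke w p.2)^*%C - h p)).
  by apply/funext => p; rewrite /fsub cconjM; ring.
rewrite E; apply: (inner_H2_zero (LinfD L1w L2)) => // m n' m0 n0.
rewrite fhatD; [|exact: (Linf_L2 L1w)|exact: (Linf_L2 L2)].
rewrite H // addr0.
by apply: (blaschkeJ_zero_y w1 (Linf_I2 L1)) => k; exact: H1.
Qed.

End Projection.

(** * From interpolation to the Hankel bound *)

Section Sufficiency.
Variable R : realType.
Local Notation C := R[i].
Local Notation T2 := (T2 R).
Local Notation S := (@sqT R).
Local Notation mD := (@measurable_sqT2 R).
Local Notation Linf_le := (@Linf_le R).
Local Notation L2 := (@L2 R).
Local Notation I2 := (@I2 R).
Local Notation fhat := (@fhat R).
Local Notation chr2 := (@chr2 R).
Local Notation ex := (@ex R).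
Local Notation ey := (@ey R).
Local Notation e1 := (@e1 R).
Local Notation Ix := (@Ix R).
Local Notation Iy := (@Iy R).
Local Notation cint2 := (@cint2 R).
Local Notation ext1 := (@ext1 R).
Local Notation sw := (@sw R).

Local Notation ext12 := (@ext12 R).
Local Notation ext2 := (@ext2 R).

Lemma cint2_bound f : I2 f -> exists M : R, forall (u : T2 -> C) (c : R), 0 <= c -> mfunC u ->
  (forall p, cabs (u p) <= c) -> cabs (cint2 (fun p => f p * u p)) <= c * M.
Proof.
move=> If; have [M hM] := Cint_bound mD If.
exists (cabs (c2 R) * M) => u c c0 mu' uc; rewrite cint2E cabsM mulrCA ler_wpM2l ?cabs_ge0 //.
have [c0'|cn] := eqVneq c 0.
  have -> : (fun p => f p * u p) = (fun p => 0 * f p).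
    apply/funext => p; have /eqP : cabs (u p) = 0 by apply/le_anti; rewrite cabs_ge0 -[X in _ <= X]c0' uc.
    by rewrite cabs_eq0 => /eqP ->; rewrite mulr0 mul0r.
  by rewrite (CintZ mD) // mul0r cabs0 c0' mul0r.
have cp : 0 < c by rewrite lt_neqAle eq_sym cn.
have -> : (fun p => f p * u p) = (fun p => c%:C%C * (f p * (c^-1%:C%C * u p))).
  apply/funext => p; rewrite mulrCA; congr (_ * _).
  by rewrite mulrA -rmorphM /= divff // mul1r.
have mv : mfunC (fun p => c^-1%:C%C * u p) by apply: mfunCM => //; exact: mfunC_cst.
have vb p : cabs (c^-1%:C%C * u p) <= 1.
  by rewrite cabsM cabs_real ger0_norm ?invr_ge0 // ler_pdivrMl // mulr1.
rewrite (CintZ mD); last by apply: (integrableC_mulb mD If); split; [exact: mv|exact: aeW].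
by rewrite cabsM cabs_real ger0_norm // ler_wpM2l // hM.
Qed.

(* With [A n v = \hat{(W / (1 - v e^{-iy}))}(n)], where [W] carries the Cauchy kernel at [z],
   [A n v - v * A n.+1 v = \hat W(n)]; so [A 0 = 0] on the disc forces [A n = 0] for all n. *)
Lemma ext12_zero U z : cabs z < 1 -> I2 U ->
  (forall v, cabs v < 1 -> ext12 U z v = 0) ->
  (forall m n, n < 0 -> fhat U m n = 0) -> forall n, extG (Ix n) ex z U = 0.
Proof.
move=> z1 IU Uz Un n.
have [n0|n0] := ltP n 0; first by apply: fhat_neg_y_ext => // m; exact: Un.
pose W p := U p / (1 - z * ex (-1) p).
have IW : I2 W by exact: (hf_clsV (hardy_x R 0) (-1) z1 IU).
pose A (k : int) v := hatG (Iy 0) ey (fun p => W p / (1 - v * ey (-1) p)) k.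
have AE k v : cabs v < 1 -> A k v - v * A (k + 1) v = hatG (Iy 0) ey W k.
  by move=> v1; have := hatG_div (hardy_y R 0) (-1) k v1 IW; rewrite opprK.
have -> : extG (Ix n) ex z U = hatG (Iy 0) ey W n.
  rewrite hat_y fhatE /extG /Ix; congr cint2.
have A0 k : A k 0 = hatG (Iy 0) ey W k.
  by rewrite -(AE k 0) ?cabs0 // mul0r subr0.
suff: forall k : nat, forall v, cabs v < 1 -> A k v = 0.
  by move=> H; rewrite -A0; case: n n0 => // n _; rewrite H ?cabs0.
elim=> [|k ih] v v1.
  rewrite -(Uz v v1) /A -(extGE (hardy_y R 0)) /extG /Iy /Defs.ext12; congr cint2.
  apply/funext => p; rewrite oppr0 chr2_0 mulr1 /W -exN_expi -eyN_expi.
  by rewrite -mulrA -invfM mulrC.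
have hk u : cabs u < 1 -> u * A k.+1 u = 0.
  move=> u1; apply/eqP; rewrite -oppr_eq0; apply/eqP.
  by have := AE k u u1; rewrite ih // -A0 ih ?cabs0 // sub0r -addn1 PoszD.
have [v0|v0] := eqVneq v 0; last by move/eqP: (hk v v1); rewrite mulf_eq0 (negbTE v0) => /eqP.
(* At v = 0 the relation [hk] is empty. Instead A_(k+1)(0) = A_(k+1)(d) - d A_(k+2)(d) for small d >
   0: the first term is 0 and the second at most 2 M d, since the kernel is at most 2 for d <=
   1/2. *)
rewrite v0; have [M hM] := cint2_bound IW.
have bnd u : cabs u <= 2^-1 -> cabs (A (k.+1%:Z + 1) u) <= 2 * M.
  clearbody W; move=> u2; rewrite /A /hatG /Iy.
  have u1 : cabs u < 1 by apply: le_lt_trans u2 _; rewrite invf_lt1 // ltr1n.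
  under [X in cint2 X]eq_fun do rewrite -!mulrA.
  apply: (hM (fun t => (1 - u * ey (-1) t)^-1 * (ey (- (k.+1%:Z + 1)) t * chr2 (- 0) 0 t)) 2 (ler0n R 2)).
    apply: mfunCM; first exact: (Linf_cauchy 0 (-1) u1).1.
    by apply: mfunCM; exact: mfunC_chr2.
  move=> p; rewrite !cabsM !cabs_chr2 !mulr1.
  apply: le_trans (one_sub_inv_bnd u1 _) _; first by rewrite cabs_chr2.
  by rewrite -[leRHS]invrK lef_pV2 ?posrE ?invr_gt0 ?subr_gt0 //; lra.
apply/eqP; rewrite -cabs_eq0; apply/eqP/le_anti; rewrite cabs_ge0 andbT.
apply/ler_addgt0Pl => e e0; rewrite addr0.
have M0 : 0 <= 2 * M by apply: le_trans (cabs_ge0 _) (bnd 0 _); rewrite cabs0 invr_ge0.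
pose d := Num.min 2^-1 (e / (2 * M + 1)).
have d0 : 0 < d by rewrite lt_min invr_gt0 ltr0n divr_gt0 // ltr_wpDl.
have du : cabs d%:C%C = d by rewrite cabs_real gtr0_norm.
have d2 : cabs d%:C%C <= 2^-1 by rewrite du ge_min lexx.
have d1 : cabs d%:C%C < 1 by apply: le_lt_trans d2 _; rewrite invf_lt1 // ltr1n.
have dn : d%:C%C != 0 :> C by rewrite -cabs_eq0 du gt_eqF.
rewrite A0 -(AE _ _ d1).
have -> : A k.+1 d%:C%C = 0.
  by move/eqP: (hk _ d1); rewrite mulf_eq0 (negbTE dn) => /eqP.
rewrite sub0r cabsN cabsM du.
apply: (@le_trans _ _ (e / (2 * M + 1) * (2 * M))).
  by apply: ler_pM; rewrite ?cabs_ge0 ?(ltW d0) ?bnd // ge_min lexx orbT.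
by rewrite mulrAC ler_pdivrMr ?ltr_wpDl // ler_wpM2l ?(ltW e0) // lerDl.
Qed.

Section Nodes.
Variables (n : nat) (z w : 'I_n -> C).
Hypothesis z1 : forall j, cabs (z j) < 1.
Hypothesis w1 : forall j, cabs (w j) < 1.

(** The product in x divides out the zeros of [U]; the one in y acts inside each row of fixed
    x-frequency. *)
Lemma blaschkeJ2_analytic_x U : injective z -> I2 U ->
  (forall m k, m < 0 -> fhat U m k = 0) ->
  (forall j k, extG (Ix k) ex (z j) U = 0) ->
  forall m k, m < 0 -> fhat (fun p => (blaschke z p.1 * blaschke w p.2)^*%C * U p) m k = 0.
Proof.
move=> zinj IU Um Uz m k m0.
have -> : (fun p => (blaschke z p.1 * blaschke w p.2)^*%C * U p) =
   (fun p => (U p * (blaschke z p.1)^*%C) * (blaschke w p.2)^*%C).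
  by apply/funext => p; rewrite cconjM; ring.
apply: (blaschkeJ_zero_y w1); first exact: (I2_Linf IU (LinfJ (Linf_blaschke_x z1))).
by move=> l; apply: (blaschkeJ_lower_x z1 zinj IU) => // i; exact: Um.
Qed.

Lemma Linf_blaschkeJ2 : Linf_le (fun p => (blaschke z p.1 * blaschke w p.2)^*%C) 1.
Proof.
apply: LinfJ; have := LinfM (Linf_blaschke_x z1) (Linf_blaschke_y w1) ler01.
by rewrite mulr1.
Qed.

End Nodes.

Lemma blaschkeJ2_analytic_y n (z w : 'I_n -> C) U :
  (forall j, cabs (z j) < 1) -> (forall j, cabs (w j) < 1) -> injective w -> I2 U ->
  (forall m k, k < 0 -> fhat U m k = 0) ->
  (forall j k, extG (Ix k) ex (w j) (U \o sw) = 0) ->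
  forall m k, k < 0 -> fhat (fun p => (blaschke z p.1 * blaschke w p.2)^*%C * U p) m k = 0.
Proof.
move=> z1 w1 winj IU Um Uw m k k0.
have IUs := (cint2_sw IU).1.
have IF : I2 (fun p => (blaschke w p.1 * blaschke z p.2)^*%C * (U \o sw) p).
  have := I2_Linf IUs (Linf_blaschkeJ2 w1 z1); congr I2; apply/funext => p; exact: mulrC.
have h : fhat (fun p => (blaschke w p.1 * blaschke z p.2)^*%C * (U \o sw) p) k m = 0.
  apply: (blaschkeJ2_analytic_x w1 z1 winj IUs) => // i l i0.
  by rewrite fhat_sw // Um.
set F := (fun p => _) in IF h.
have -> : (fun p => (blaschke z p.1 * blaschke w p.2)^*%C * U p) = F \o sw.
  by apply/funext => -[x y]; rewrite /F /= [blaschke w _ * _]mulrC.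
exact: etrans (fhat_sw m k IF) h.
Qed.

(** Equal slice values have equal Fourier coefficients in y; this turns the almost everywhere
    conditions of (iv) into zeros at every frozen frequency. *)
Lemma extG_x_eq F H a c e : cabs a < 1 -> Linf_le F c -> Linf_le H e ->
  {ae leb R, forall y : R, S y -> ext1 F a y = ext1 H a y} ->
  forall k, extG (Ix k) ex a (fun p => F p - H p) = 0.
Proof.
move=> a1 LF LH E k; rewrite (extGB (hardy_x R k)) //; [|exact: Linf_I2 LF|exact: Linf_I2 LH].
rewrite (extG_x_Fubini k a1 LF) (extG_x_Fubini k a1 LH); apply/eqP; rewrite subr_eq0; apply/eqP.
apply: ae_eq_cint1; [| |by apply: filterS E => y h Sy; rewrite h].
- by apply: mfunCM; [apply: mfunC_ext1 => //; exact: LF.1|exact: mfunC_e1].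
- by apply: mfunCM; [apply: mfunC_ext1 => //; exact: LH.1|exact: mfunC_e1].
Qed.

Lemma ext12_I2 f (u v : C) : cabs u < 1 -> cabs v < 1 -> I2 f ->
  I2 (fun p => f p / ((1 - u * expi (- p.1)) * (1 - v * expi (- p.2)))).
Proof.
move=> u1 v1 If; have := I2_Linf (I2_Linf If (Linf_cauchy (-1) 0 u1)) (Linf_cauchy 0 (-1) v1).
congr I2; apply/funext => p.
by rewrite -[chr2 (-1) 0 p]exN_expi -[chr2 0 (-1) p]eyN_expi -mulrA -invfM.
Qed.

Lemma ext12_sw U z v : I2 U -> cabs z < 1 -> cabs v < 1 -> ext12 (U \o sw) z v = ext12 U v z.
Proof.
move=> IU z1 v1.
have h := ext12_I2 v1 z1 IU.
rewrite /Defs.ext12 -(cint2_sw h).2; congr cint2; apply/funext => p /=.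
by rewrite mulrC [X in _ * X^-1]mulrC mulrC.
Qed.

Lemma ext12B f g (u v : C) : cabs u < 1 -> cabs v < 1 -> I2 f -> I2 g ->
  ext12 (fun p => f p - g p) u v = ext12 f u v - ext12 g u v.
Proof.
move=> u1 v1 If Ig.
rewrite /Defs.ext12 -[- cint2 _]cint2N; last exact: ext12_I2.
rewrite -cint2D; [|exact: ext12_I2|by apply: I2N; exact: ext12_I2].
by congr cint2; apply/funext => p; rewrite mulrBl.
Qed.

Section Conditions.
Variables (n : nat) (z w : 'I_n -> C) (G : T2 -> C).
Hypotheses (z1 : forall j, cabs (z j) < 1) (w1 : forall j, cabs (w j) < 1).
Hypotheses (zinj : injective z) (winj : injective w).
Hypothesis hG : Hinf G.
Let b (p : T2) := blaschke z p.1 * blaschke w p.2.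
Let phi p := (b p)^*%C * G p.

(** Write phi - phi_i = (conj b (G + U_i) - phi_i) - conj b U_i, both terms analytic in the i-th
    variable. For (iv) take U_i = F_i - G and phi_i = conj b F_i; for (iii) take U_1 = U_2 = F - G
    and the symbols of BMO_r. *)
Lemma hankel_interp_bound (phi1 phi2 U1 U2 : T2 -> C) (c : R) : 0 <= c ->
  Linf_le phi1 c -> Linf_le phi2 c -> L2 U1 -> L2 U2 ->
  (forall m k, m < 0 -> fhat U1 m k = 0) ->
  (forall m k, k < 0 -> fhat U2 m k = 0) ->
  (forall j k, extG (Ix k) ex (z j) U1 = 0) ->
  (forall j k, extG (Ix k) ex (w j) (U2 \o sw) = 0) ->
  (forall m k, m < 0 -> fhat (fun p => (b p)^*%C * (G p + U1 p) - phi1 p) m k = 0) ->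
  (forall m k, k < 0 -> fhat (fun p => (b p)^*%C * (G p + U2 p) - phi2 p) m k = 0) ->
  hankel_norm_le phi (Num.sqrt 2 * c).
Proof.
move=> c0 h1 h2 LU1 LU2 U1x U2y U1z U2w H1 H2.
have [[cG LG] _] := hG.
have Lb := Linf_blaschkeJ2 z1 w1.
have Lphi : Linf_le phi (1 * cG) := LinfM Lb LG ler01.
have Lb2 (f : T2 -> C) : L2 f -> L2 (fun p => (b p)^*%C * f p).
  by move=> hf; have := L2_Linf hf Lb; congr Defs.L2; apply/funext => p; exact: mulrC.
have key (U psi : T2 -> C) m k : L2 U -> Linf_le psi c ->
    fhat (fun p => (b p)^*%C * U p) m k = 0 ->
    fhat (fun p => (b p)^*%C * (G p + U p) - psi p) m k = 0 ->
    fhat (fun p => phi p - psi p) m k = 0.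
  move=> LU Lpsi e1 e2.
  have -> : (fun p => phi p - psi p) =
      (fun p => ((b p)^*%C * (G p + U p) - psi p) - (b p)^*%C * U p).
    by apply/funext => p; rewrite /phi; ring.
  rewrite fhatB; [by rewrite e1 e2 subrr| |exact: Lb2].
  apply: L2B; last exact: (Linf_L2 Lpsi).
  by apply: Lb2; apply: L2D => //; exact: (Linf_L2 LG).
apply: (hankel_norm_le_sqrt2 c0 Lphi h1 h2) => m k mk.
- by apply: (key U1) => //; [exact: (blaschkeJ2_analytic_x z1 w1 zinj (L2_I2 LU1))|exact: H1].
- by apply: (key U2) => //; [exact: (blaschkeJ2_analytic_y z1 w1 winj (L2_I2 LU2))|exact: H2].
Qed.

Lemma interp_bound_Linf F1 F2 : Linf_le F1 1 -> Linf_le F2 1 ->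
  (forall m k, m < 0 -> fhat F1 m k = 0) -> (forall m k, k < 0 -> fhat F2 m k = 0) ->
  (forall j, {ae leb R, forall y : R, S y -> ext1 F1 (z j) y = ext1 G (z j) y}
    /\ {ae leb R, forall x : R, S x -> ext2 F2 x (w j) = ext2 G x (w j)}) ->
  hankel_norm_le phi (Num.sqrt 2).
Proof.
move=> L1 L2' F1x F2y E; have [[cG LG] Gz] := hG.
have Lb := Linf_blaschkeJ2 z1 w1.
have bF (F : T2 -> C) : Linf_le F 1 -> Linf_le (fun p => (b p)^*%C * F p) 1.
  by move=> LF; have := LinfM Lb LF ler01; rewrite mulr1.
rewrite -[Num.sqrt 2]mulr1.
have LF1 := Linf_L2 L1; have LF2 := Linf_L2 L2'; have LG2 := Linf_L2 LG.
have Z (F : T2 -> C) m k : Linf_le F 1 -> fhat (fun p => (b p)^*%C * (G p + (F p - G p)) - (b p)^*%C * F p) m k = 0.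
  move=> LF; have -> : (fun p => (b p)^*%C * (G p + (F p - G p)) - (b p)^*%C * F p) =
     (fun p => 0 * chr2 0 0 p) by apply/funext => p; ring.
  by rewrite fhatZ ?mul0r //; exact: L2_chr2.
apply: (@hankel_interp_bound _ _ (fun p => F1 p - G p) (fun p => F2 p - G p) 1 ler01 (bF _ L1) (bF _ L2')).
- exact: L2B.
- exact: L2B.
- by move=> m k m0; rewrite fhatB // F1x // Gz ?subrr //; left.
- by move=> m k m0; rewrite fhatB // F2y // Gz ?subrr //; right.
- by move=> j k; apply: (extG_x_eq (z1 j) L1 LG); exact: (E j).1.
- by move=> j k; apply: (extG_x_eq (w1 j) (Linf_sw L2') (Linf_sw LG)); exact: (E j).2.
- by move=> m k _; exact: Z.
- by move=> m k _; exact: Z.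
Qed.

Lemma interp_bound_bmo F : H2 F ->
  (forall k (v : C), cabs v < 1 -> ext12 F (z k) v = ext12 G (z k) v) ->
  (forall k (u : C), cabs u < 1 -> ext12 F u (w k) = ext12 G u (w k)) ->
  bmo_r_le (fun p => (b p)^*%C * F p) 1 -> hankel_norm_le phi (Num.sqrt 2).
Proof.
move=> [LF Fz] Ez Ew bmo; have [[cG LG] Gz] := hG.
have LG2 := Linf_L2 LG.
pose U p := F p - G p.
have LU : L2 U by exact: L2B.
have Uz m k : m < 0 \/ k < 0 -> fhat U m k = 0.
  by move=> h; rewrite fhatB // Fz // Gz // subrr.
move=> f hf h hh.
apply/ler_addgt0Pl => e e0.
pose N := norm2 f.
have N0 : 0 <= Num.sqrt 2 * N by rewrite mulr_ge0 ?sqrtr_ge0.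
(* The BMO_r norm is an infimum, so the symbols are only bounded by 1 + d; this [d] makes sqrt 2 d
   |f| at most [e]. *)
pose d := e / (Num.sqrt 2 * N + 1).
have d0 : 0 < d by rewrite divr_gt0 // ltr_wpDl.
have [phi0 [phi1 [phi2 [_ L1 L2' [[_ P1] [_ P2] _]]]]] := bmo d d0.
have b0 : 0 <= 1 + d by rewrite addr_ge0 ?ler01 ?(ltW d0).
have GU p : G p + U p = F p by rewrite /U addrC subrK.
have HB : hankel_norm_le phi (Num.sqrt 2 * (1 + d)).
  apply: (@hankel_interp_bound _ _ U U (1 + d) b0 L1 L2' LU LU).
  - by move=> m k m0; apply: Uz; left.
  - by move=> m k m0; apply: Uz; right.
  - move=> j k; apply: (ext12_zero (z1 j) (L2_I2 LU)).
      by move=> v v1; rewrite ext12B ?Ez ?subrr //; exact: L2_I2.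
    by move=> m l l0; apply: Uz; right.
  - move=> j k; apply: (ext12_zero (w1 j) (cint2_sw (L2_I2 LU)).1).
      by move=> v v1; rewrite (ext12_sw (L2_I2 LU)) // ext12B ?Ew ?subrr //; exact: L2_I2.
    by move=> m l l0; rewrite fhat_sw; [apply: Uz; left|exact: L2_I2].
  - by move=> m k m0; under eq_fun do rewrite GU; exact: P1.
  - by move=> m k m0; under eq_fun do rewrite GU; exact: P2.
apply: le_trans (HB f hf h hh) _.
rewrite -/N mulrDr mulr1 mulrDl [leRHS]addrC lerD2l mulrAC.
rewrite /d mulrCA ger_pMr // ler_pdivrMr ?ltr_wpDl // mul1r.
by rewrite lerDl.
Qed.

End Conditions.
End Sufficiency.

(** * The Pick condition *)

Section Pick.
Variable R : realType.
Local Notation C := R[i].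

Definition pick_form n (z g : 'I_n -> C) (v : 'I_n -> C) : C :=
  \sum_(j < n) \sum_(k < n)
    (v j)^*%C * ((1 - g j * (g k)^*%C) / (1 - z j * (z k)^*%C)) * v k.

Definition pick_pos n (z g : 'I_n -> C) := forall v, 0 <= pick_form z g v.

Lemma cconjK (x : C) : (x^*%C)^*%C = x.
Proof. by case: x => a b /=; rewrite opprK. Qed.

Lemma cabs_sqrJB (x y : C) : (cabs x ^+ 2 - cabs y ^+ 2)%:C%C = x * x^*%C - y * y^*%C.
Proof. by rewrite -!cabs_sqrJ; exact: rmorphB. Qed.

Lemma sub_sqrJ_gt0 (x : C) : cabs x < 1 -> 0 < 1 - x * x^*%C.
Proof.
move=> x1; rewrite -cabs_sqrJ -[1]/(1%:C%C) -rmorphB ltcR subr_gt0.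
by rewrite expr_lt1 // cabs_ge0.
Qed.

Lemma one_subJ_neq0 (x y : C) : cabs x < 1 -> cabs y <= 1 -> 1 - x^*%C * y != 0.
Proof. by move=> x1 y1; apply: one_sub_neq0; rewrite ?cabsJ. Qed.

Lemma one_subJr_neq0 (x y : C) : cabs x < 1 -> cabs y <= 1 -> 1 - y * x^*%C != 0.
Proof. by move=> x1 y1; rewrite mulrC one_subJ_neq0. Qed.

Lemma ge0_Re (x : C) : 0 <= x -> x = (complex.Re x)%:C%C.
Proof. by case: x => a b; rewrite lecE /= => /andP[/eqP -> _]. Qed.

Section Consequences.
Variables (n : nat) (z g : 'I_n.+1 -> C).
Hypothesis z1 : forall j, cabs (z j) < 1.
Hypothesis pos : pick_pos z g.
Local Notation M j k := ((1 - g j * (g k)^*%C) / (1 - z j * (z k)^*%C)).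

Lemma sum_support2 (F : 'I_n.+1 -> C) a b : a != b ->
  (forall j, j != a -> j != b -> F j = 0) -> \sum_j F j = F a + F b.
Proof.
move=> ab F0; rewrite (bigD1 a) //= (bigD1 b) 1?eq_sym //= big1 ?addr0 //.
by move=> j /andP[]; exact: F0.
Qed.

Lemma pick_form_support2 (a b : 'I_n.+1) (x y : C) : a != b ->
  0 <= (x^*%C * M a a * x + x^*%C * M a b * y) + (y^*%C * M b a * x + y^*%C * M b b * y).
Proof.
move=> ab; have ba : b == a = false by rewrite eq_sym (negbTE ab).
pose v j := if j == a then x else if j == b then y else 0.
have vz j : j != a -> j != b -> v j = 0 by rewrite /v => /negbTE -> /negbTE ->.
have va : v a = x by rewrite /v eqxx.
have vb : v b = y by rewrite /v ba eqxx.
have row i : \sum_k (v i)^*%C * M i k * v k = (v i)^*%C * M i a * x + (v i)^*%C * M i b * y.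
  by rewrite (sum_support2 ab) ?va ?vb // => k ka kb; rewrite (vz k) // mulr0.
have := pos v; rewrite /pick_form (sum_support2 ab); last first.
  by move=> i ia ib; rewrite row (vz i) // raddf0 !mul0r addr0.
by rewrite !row va vb.
Qed.

Lemma pick_value_le1 j : cabs (g j) <= 1.
Proof.
have := pos (fun i => if i == j then 1 else 0).
rewrite /pick_form (bigD1 j) //= [X in _ + X]big1 ?addr0; last first.
  by move=> i /negbTE ij; rewrite big1 // => k _; rewrite ij raddf0 !mul0r.
rewrite (bigD1 j) //= [X in _ + X]big1 ?addr0; last by move=> i /negbTE ->; rewrite mulr0.
rewrite eqxx mulr1 rmorph1 mul1r ler_pdivlMr ?mul0r; last exact: sub_sqrJ_gt0.
rewrite -cabs_sqrJ -[1]/(1%:C%C) -rmorphB lecR subr_ge0.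
by rewrite expr_le1 // cabs_ge0.
Qed.

(* A vanishing diagonal entry of a positive matrix kills its row. *)
Lemma pick_unimodular a j : cabs (g a) = 1 -> g j = g a.
Proof.
move=> ga; have [->//|ja] := eqVneq j a.
have gaa : g a * (g a)^*%C = 1 by rewrite -cabs_sqrJ ga expr1n.
have Maa : M a a = 0 by rewrite gaa subrr mul0r.
have dz i l : 1 - z i * (z l)^*%C != 0 by rewrite one_subJr_neq0 // ltW.
have MJ i l : (M i l)^*%C = M l i.
  by rewrite cconjM cconjV !cconjB !cconjM !cconjK rmorph1 [g l * _]mulrC [z l * _]mulrC.
have aj : a != j by rewrite eq_sym.
have Mjj : M j j = (complex.Re (M j j))%:C%C.
  by apply: ge0_Re; have := pick_form_support2 0 1 aj; rewrite raddf0 rmorph1 !mul0r !mulr0 !mul1r !mulr1 !add0r.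
(* The form at the vector with entries - s M_aj at [a] and 1 at [j]; since M_aa = 0 it is affine in
   [s]. *)
have key (s : R) : (s + s) * cabs (M a j) ^+ 2 <= complex.Re (M j j).
  have := pick_form_support2 (- s%:C%C * M a j) 1 aj.
  rewrite Maa rmorph1 cconjM cconjN MJ conjc_real.
  set q := M j a; have qE : q = (M a j)^*%C by rewrite MJ.
  have -> : (- s%:C%C * q * 0 * (- s%:C%C * M a j) + - s%:C%C * q * M a j * 1) +
     (1 * q * (- s%:C%C * M a j) + 1 * M j j * 1) = M j j - (s%:C%C + s%:C%C) * (M a j * (M a j)^*%C).
    by rewrite qE; ring.
  have -> : M j j - (s%:C%C + s%:C%C) * (M a j * (M a j)^*%C) =
      (complex.Re (M j j) - (s + s) * cabs (M a j) ^+ 2)%:C%C.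
    rewrite {1}Mjj -(cabs_sqrJ (M a j)); move: (complex.Re _) (cabs (M a j) ^+ 2) => r P.
    by rewrite rmorphB rmorphM rmorphD.
  by rewrite lecR subr_ge0.
suff M0 : M a j = 0.
  have : 1 - g a * (g j)^*%C = 0.
    by move/eqP: M0; rewrite mulf_eq0 invr_eq0 (negbTE (dz _ _)) orbF => /eqP.
  move=> h; have : (1 - g a * (g j)^*%C)^*%C * g a = 0 by rewrite h raddf0 mul0r.
  rewrite cconjB cconjM cconjK rmorph1 mulrBl mul1r mulrAC [_^*%C * g a]mulrC gaa.
  by rewrite mul1r => /eqP; rewrite subr_eq0 => /eqP <-.
apply/eqP; rewrite -cabs_eq0 -sqrf_eq0; apply/eqP/le_anti; rewrite sqr_ge0 andbT leNgt.
apply/negP => p0; set P := _ ^+ 2 in p0 key.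
have := key ((complex.Re (M j j) + 1) / (2 * P)).
set s := _ / (2 * P); have -> : (s + s) * P = complex.Re (M j j) + 1.
  by rewrite /s; field; rewrite gt_eqF.
by rewrite gerDl leNgt ltr01.
Qed.

End Consequences.

(** One step of Schur's algorithm: for f(a) = g0 and f(b) = g, the value at b of the function
    obtained by moving g0 to 0 with a disc automorphism and dividing out the zero at a. *)
Definition schur_value (a g0 b g : C) : C :=
  ((g - g0) / (1 - g0^*%C * g)) / ((b - a) / (1 - a^*%C * b)).

(* The Schur complement of the first diagonal entry of the Pick matrix is, up to
   congruence by the diagonal matrix [al], the Pick matrix of the reduced data. *)
Lemma schur_complement_entry (a g0 b g c h : C) :
  cabs a < 1 -> cabs b < 1 -> cabs c < 1 -> cabs g0 < 1 -> cabs g <= 1 -> cabs h <= 1 ->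
  b != a -> c != a ->
  let al b g := (1 - g0^*%C * g) * ((b - a) / (1 - a^*%C * b)) in
  (1 - g * h^*%C) / (1 - b * c^*%C)
   - ((1 - g * g0^*%C) / (1 - b * a^*%C)) * ((1 - g0 * h^*%C) / (1 - a * c^*%C))
     / ((1 - g0 * g0^*%C) / (1 - a * a^*%C))
  = (1 - g0 * g0^*%C)^-1 * (al b g * ((1 - schur_value a g0 b g * (schur_value a g0 c h)^*%C)
      / (1 - b * c^*%C)) * (al c h)^*%C).
Proof.
move=> a1 b1 c1 g01 g1 h1 ba ca al; rewrite /al /schur_value.
have ca' : c^*%C - a^*%C != 0.
  by rewrite -cconjB -cabs_eq0 cabsJ cabs_eq0 subr_eq0.
rewrite !(cconjM, cconjV, cconjB, cconjK, rmorph1).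
have n1 := one_subJ_neq0 g01 g1.
have n2 := one_subJr_neq0 g01 h1.
have n2' : 1 - g0 * h^*%C != 0.
  by rewrite -cabs_eq0 -cabsJ cabs_eq0 cconjB cconjM cconjK rmorph1 one_subJ_neq0.
have n3 := one_subJ_neq0 a1 (ltW b1).
have n4 : 1 - a * c^*%C != 0 by rewrite one_subJr_neq0 // ltW.
have n5 : 1 - b * c^*%C != 0 by rewrite one_subJr_neq0 // ltW.
have n6 : 1 - a * a^*%C != 0 by rewrite one_subJr_neq0 // ltW.
have n7 : 1 - g0 * g0^*%C != 0 by rewrite one_subJr_neq0 // ltW.
have n8 : 1 - b * a^*%C != 0 by rewrite one_subJr_neq0 // ltW.
have n9 : b - a != 0 by rewrite subr_eq0.
move: ca' n1 n2 n2' n3 n4 n5 n6 n7 n8 n9.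
move: (a^*%C) (c^*%C) (g0^*%C) (h^*%C) => a' c' g0' h' *.
field.
by rewrite ?n1 ?n2 //; do ?[apply/andP; split]; rewrite // mulrC.
Qed.

Section Reduction.
Variables (n : nat) (z g : 'I_n.+1 -> C).
Hypotheses (z1 : forall j, cabs (z j) < 1) (zinj : injective z).
Hypothesis pos : pick_pos z g.
Let a := z ord0.
Let g0 := g ord0.
Hypothesis g01 : cabs g0 < 1.
Let z' j := z (lift ord0 j).
Let g' j := schur_value a g0 (z' j) (g (lift ord0 j)).

Lemma pick_pos_reduce : pick_pos z' g'.
Proof.
move=> u.
pose M j k := (1 - g j * (g k)^*%C) / (1 - z j * (z k)^*%C).
pose al j := (1 - g0^*%C * g (lift ord0 j)) * ((z' j - a) / (1 - a^*%C * z' j)).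
have g1 := pick_value_le1 z1 pos.
have za j : z' j != a by rewrite /z' /a (inj_eq zinj) eq_sym neq_lift.
have al0 j : al j != 0.
  apply: mulf_neq0; first exact: one_subJ_neq0.
  by apply: mulf_neq0; rewrite ?subr_eq0 ?invr_eq0 ?one_subJ_neq0 ?(ltW (z1 _)) ?z1.
have M00 : 0 < M ord0 ord0 by rewrite /M divr_gt0 // sub_sqrJ_gt0.
have M0 : M ord0 ord0 != 0 by rewrite gt_eqF.
(* This absorbs the diagonal congruence, so that the form of the Schur complement at [v] is a
   multiple of the reduced Pick form at [u]. *)
pose v j := u j / (al j)^*%C.
have vJ j : (v j)^*%C * al j = (u j)^*%C by rewrite /v cconjM cconjV cconjK divfK.
have vE j : (al j)^*%C * v j = u j.
  by rewrite /v mulrCA divff ?mulr1 // -cabs_eq0 cabsJ cabs_eq0.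
pose B := \sum_k M ord0 (lift ord0 k) * v k.
pose B' := \sum_k (v k)^*%C * M (lift ord0 k) ord0.
have MJ i l : (M i l)^*%C = M l i.
  by rewrite /M cconjM cconjV !cconjB !cconjM !cconjK rmorph1 [g l * _]mulrC [z l * _]mulrC.
have BJ : B^*%C = B'.
  by rewrite /B cconj_sum; apply: eq_bigr => k _; rewrite cconjM MJ mulrC.
(* The first entry completes the square: the form of the full matrix at [w] is that of the Schur
   complement at [v]. *)
pose w j := if unlift ord0 j is Some i then v i else - B / M ord0 ord0.
have w0 : w ord0 = - B / M ord0 ord0 by rewrite /w unlift_none.
have wl i : w (lift ord0 i) = v i by rewrite /w liftK.
have := pos w.
have -> : pick_form z g w = (1 - g0 * g0^*%C)^-1 * pick_form z' g' u.
  have -> : pick_form z g w =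
     \sum_j \sum_k (v j)^*%C * (M (lift ord0 j) (lift ord0 k)
        - M (lift ord0 j) ord0 * M ord0 (lift ord0 k) / M ord0 ord0) * v k.
    have E : \sum_j \sum_k (v j)^*%C * (M (lift ord0 j) (lift ord0 k)
        - M (lift ord0 j) ord0 * M ord0 (lift ord0 k) / M ord0 ord0) * v k =
       \sum_j \sum_k (v j)^*%C * M (lift ord0 j) (lift ord0 k) * v k - B' * B / M ord0 ord0.
      rewrite /B' mulr_suml mulr_suml -sumrB; apply: eq_bigr => j _.
      rewrite /B mulr_sumr mulr_suml -sumrB; apply: eq_bigr => k _.
      by field.
    rewrite E /pick_form big_ord_recl big_ord_recl w0.
    under eq_bigr do rewrite wl.
    under [X in _ + X]eq_bigr => j _.
      rewrite big_ord_recl wl w0; under eq_bigr do rewrite wl.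
      over.
    rewrite big_split /= -mulr_suml -/(M ord0 ord0).
    have -> : \sum_(i < n) (- B / M ord0 ord0)^*%C *
        ((1 - g ord0 * (g (lift ord0 i))^*%C) / (1 - z ord0 * (z (lift ord0 i))^*%C)) * v i
       = (- B / M ord0 ord0)^*%C * B.
      by rewrite /B mulr_sumr; apply: eq_bigr => k _; rewrite -mulrA.
    rewrite cconjM cconjV cconjN MJ BJ -/B'.
    by field.
  rewrite /pick_form mulr_sumr; apply: eq_bigr => j _; rewrite mulr_sumr; apply: eq_bigr => k _.
  rewrite (schur_complement_entry (z1 ord0) (z1 _) (z1 _) g01 (g1 _) (g1 _) (za j) (za k)).
  rewrite -/(al j) -/(al k) -[in RHS](vE k) -[in RHS](vJ j) -/a -/g0 -/(z' j) -/(z' k).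
  by rewrite -/(g' j) -/(g' k); ring.
by rewrite pmulr_rge0 // invr_gt0 sub_sqrJ_gt0.
Qed.

End Reduction.

(** Numerator and denominator of (b_a f' + g0) / (1 + conj g0 b_a f'), where f' interpolates the
    reduced data. When |g0| < 1 fails, which for Pick data means |g0| = 1, all values agree and the
    constant [g0] is returned. *)
Fixpoint schur n : ('I_n -> C) -> ('I_n -> C) -> {poly C} * {poly C} :=
  match n with
  | 0 => fun _ _ => (0, 1)
  | _.+1 => fun z g =>
    let a := z ord0 in let g0 := g ord0 in
    let pq := schur (fun j => z (lift ord0 j))
      (fun j => schur_value a g0 (z (lift ord0 j)) (g (lift ord0 j))) in
    let p := pq.1 * ('X - a%:P) in let q := pq.2 * (1 - a^*%C *: 'X) in
    if cabs g0 < 1 then (p + g0 *: q, q + g0^*%C *: p) else (g0%:P, 1)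
  end.

Lemma cabs_blaschke_disc (a t : C) : cabs a < 1 -> cabs t <= 1 ->
  cabs (t - a) <= cabs (1 - a^*%C * t).
Proof.
move=> a1 t1; rewrite -(@ler_pXn2r _ 2) ?nnegrE ?cabs_ge0 // -subr_ge0.
rewrite -lecR.
have -> : (cabs (1 - a^*%C * t) ^+ 2 - cabs (t - a) ^+ 2)%:C%C =
   (1 - a * a^*%C) * (1 - t * t^*%C).
  rewrite cabs_sqrJB !(cconjM, cconjB, cconjK, rmorph1); ring.
apply: mulr_ge0; first by rewrite ltW ?sub_sqrJ_gt0.
rewrite -cabs_sqrJ -[1]/(1%:C%C) -rmorphB lecR subr_ge0.
by rewrite expr_le1 // cabs_ge0.
Qed.

(** The induction carries |p| <= |q| and q nonzero on the closed disc. As |g0| < 1, the new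
    denominator q + conj g0 p cannot vanish, and |q + conj g0 p|^2 - |p + g0 q|^2 = (1 -
    |g0|^2)(|q|^2 - |p|^2). *)
Lemma schurP n (z g : 'I_n -> C) :
  (forall j, cabs (z j) < 1) -> injective z -> pick_pos z g ->
  (forall t, cabs t <= 1 -> (schur z g).2.[t] != 0 /\ cabs (schur z g).1.[t] <= cabs (schur z g).2.[t]) /\ forall j, (schur z g).1.[z j] = g j * (schur z g).2.[z j].
Proof.
elim: n z g => [|n ih] z g z1 zinj pos.
  split=> [t _|[]//]; rewrite /= hornerC horner0 cabs0 cabs1 oner_eq0; split => //.
have g1 := pick_value_le1 z1 pos.
rewrite /=; set a := z ord0; set g0 := g ord0; case: ifPn => [g01|]; last first.
  rewrite -leNgt => g01; have e : cabs g0 = 1 by apply/le_anti; rewrite g1.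
  split=> [t _|j] /=; rewrite !hornerC; first by rewrite e cabs1 oner_eq0; split.
  by rewrite mulr1 (pick_unimodular z1 pos j e).
have lift_inj : injective (fun j => z (lift ord0 j)) by move=> i j /zinj /lift_inj.
have [H1 H2] := ih _ _ (fun j => z1 (lift ord0 j)) lift_inj (pick_pos_reduce z1 zinj pos g01).
set P := (schur _ _).1 in H1 H2 *; set Q := (schur _ _).2 in H1 H2 *.
have hP t : (P * ('X - a%:P) + g0 *: (Q * (1 - a^*%C *: 'X))).[t] =
   P.[t] * (t - a) + g0 * (Q.[t] * (1 - a^*%C * t)).
  by rewrite !(hornerE, hornerZ).
have hQ t : (Q * (1 - a^*%C *: 'X) + g0^*%C *: (P * ('X - a%:P))).[t] =
   Q.[t] * (1 - a^*%C * t) + g0^*%C * (P.[t] * (t - a)).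
  by rewrite !(hornerE, hornerZ).
split=> [t t1|j]; rewrite /= hP hQ.
  have [Q0 PQ] := H1 t t1.
  set p := P.[t] * (t - a); set q := Q.[t] * (1 - a^*%C * t).
  have pq : cabs p <= cabs q.
    by rewrite !cabsM ler_pM ?cabs_ge0 // cabs_blaschke_disc // z1.
  have q0 : q != 0 by rewrite mulf_neq0 // one_subJ_neq0 // z1.
  have cq : 0 < cabs q by rewrite lt_neqAle cabs_ge0 eq_sym cabs_eq0 q0.
  split.
    apply/eqP => e; have : cabs q = cabs (g0^*%C * p).
      by rewrite -[q](addrK (g0^*%C * p)) e sub0r cabsN.
    rewrite cabsM cabsJ => e'; have : cabs q < cabs q; last by rewrite ltxx.
    rewrite {1}e'; apply: le_lt_trans (ler_wpM2l (cabs_ge0 _) pq) _.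
    by rewrite gtr_pMl.
  rewrite -(@ler_pXn2r _ 2) ?nnegrE ?cabs_ge0 // -subr_ge0 -lecR.
  have -> : (cabs (q + g0^*%C * p) ^+ 2 - cabs (p + g0 * q) ^+ 2)%:C%C =
     (1 - g0 * g0^*%C) * (q * q^*%C - p * p^*%C).
    rewrite cabs_sqrJB !(cconjM, cconjD, cconjK); ring.
  apply: mulr_ge0; first by rewrite ltW ?sub_sqrJ_gt0.
  rewrite -!cabs_sqrJ -rmorphB lecR subr_ge0.
  by rewrite ler_pXn2r ?nnegrE ?cabs_ge0.
have [->|[i ->]] : j = ord0 \/ exists i, j = lift ord0 i.
  by case: (unliftP ord0 j) => [i ->|->]; [right; exists i|left].
  by rewrite -/a -/g0 subrr !mulr0 add0r addr0.
rewrite H2 /schur_value -/a -/g0.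
have n1 : 1 - g0^*%C * g (lift ord0 i) != 0 by rewrite one_subJ_neq0.
have n2 : 1 - a^*%C * z (lift ord0 i) != 0 by rewrite one_subJ_neq0 ?z1 // ltW.
have n3 : z (lift ord0 i) - a != 0 by rewrite subr_eq0 (inj_eq zinj) eq_sym neq_lift.
by field; rewrite n1 n2 n3.
Qed.

End Pick.

(** * Rational functions without poles in the closed disc *)

Section RationalHardy.
Variables (T : Type) (R : realType).
Local Notation C := R[i].
Variables (cls : (T -> C) -> Prop) (I : (T -> C) -> C) (em : int -> T -> C).
Hypothesis HI : hardy_functional cls I em.

Lemma horner_analytic (p : {poly C}) f : cls f -> lower I em f 0 ->
  [/\ cls (fun t => f t * p.[em 1 t]), lower I em (fun t => f t * p.[em 1 t]) 0 &
   forall z, cabs z < 1 -> extG I em z (fun t => f t * p.[em 1 t]) = extG I em z f * p.[z]].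
Proof.
move=> hf fl; elim/poly_ind: p => [|p c [ih1 ih2 ih3]].
  have -> : (fun t => f t * (0 : {poly C}).[em 1 t]) = (fun t => 0 * f t).
    by apply/funext => t; rewrite horner0 mulr0 mul0r.
  split; [exact: (hf_clsZ HI)|exact: (lowerZ HI)|].
  by move=> z z1; rewrite (extGZ HI) // mul0r horner0 mulr0.
have -> : (fun t => f t * (p * 'X + c%:P).[em 1 t]) =
   (fun t => (f t * p.[em 1 t]) * em 1 t + c * f t).
  by apply/funext => t; rewrite hornerMXaddC; ring.
have h1 := hf_clsE HI 1 ih1; have h2 := hf_clsZ HI c hf.
split; first exact: (hf_clsD HI).
  apply: (lowerD HI) => //; last exact: (lowerZ HI).
  by move=> l l0; apply: (lower_shift HI (k := 1) ih2); rewrite add0r (lt_trans l0).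
move=> z z1; rewrite (extGD HI) // (extG_em HI) // ih3 // (extGZ HI) //.
by rewrite hornerMXaddC; ring.
Qed.

(** A root r outside the closed disc gives u - r = - r (1 - u / r), and dividing by the second
    factor preserves analyticity because |1 / r| < 1. *)
Lemma div_roots_analytic (s : seq C) f : cls f -> lower I em f 0 ->
  (forall r, r \in s -> 1 < cabs r) ->
  [/\ cls (fun t => f t / \prod_(r <- s) (em 1 t - r)),
      lower I em (fun t => f t / \prod_(r <- s) (em 1 t - r)) 0 &
   forall z, cabs z < 1 -> extG I em z (fun t => f t / \prod_(r <- s) (em 1 t - r))
     = extG I em z f / \prod_(r <- s) (z - r)].
Proof.
move=> hf fl; elim: s => [|r s ih] sr.
  have -> : (fun t => f t / \prod_(r <- [::]) (em 1 t - r)) = f.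
    by apply/funext => t; rewrite big_nil invr1 mulr1.
  by split => // z z1; rewrite big_nil invr1 mulr1.
have [ih1 ih2 ih3] : [/\ cls (fun t => f t / \prod_(r <- s) (em 1 t - r)),
      lower I em (fun t => f t / \prod_(r <- s) (em 1 t - r)) 0 &
   forall z, cabs z < 1 -> extG I em z (fun t => f t / \prod_(r <- s) (em 1 t - r))
     = extG I em z f / \prod_(r <- s) (z - r)].
  by apply: ih => q qs; apply: sr; rewrite inE qs orbT.
have r1 : 1 < cabs r by apply: sr; rewrite mem_head.
have r0 : r != 0 by rewrite -cabs_eq0 gt_eqF // (lt_trans ltr01).
have ri : cabs r^-1 < 1 by rewrite cabsV invf_lt1 // (lt_trans ltr01).
have E u : (u - r)^-1 = - r^-1 / (1 - r^-1 * u).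
  have -> : u - r = - r * (1 - r^-1 * u) by field.
  by rewrite invfM invrN.
have -> : (fun t => f t / \prod_(q <- r :: s) (em 1 t - q)) =
  (fun t => - r^-1 * (f t / \prod_(q <- s) (em 1 t - q) / (1 - r^-1 * em 1 t))).
  by apply/funext => t; rewrite big_cons invfM E; ring.
have h1 := hf_clsV HI 1 ri ih1.
split; first exact: (hf_clsZ HI).
  by apply: (lowerZ HI) => //; exact: (lower_div HI).
move=> z z1; rewrite (extGZ HI) // (extG_div HI) // ih3 // big_cons invfM E; ring.
Qed.

Lemma rational_analytic (P Q : {poly C}) : cls (fun=> 1) -> lower I em (fun=> 1) 0 ->
  (forall t, cabs t <= 1 -> Q.[t] != 0) ->
  [/\ cls (fun t => P.[em 1 t] / Q.[em 1 t]), lower I em (fun t => P.[em 1 t] / Q.[em 1 t]) 0 &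
   forall z, cabs z < 1 ->
     extG I em z (fun t => P.[em 1 t] / Q.[em 1 t]) = extG I em z (fun=> 1) * (P.[z] / Q.[z])].
Proof.
move=> c1 l1 Q0.
have [s Qs] := closed_field_poly_normal Q.
have Qn : Q != 0.
  by apply/eqP => q; have := Q0 0; rewrite q horner0 eqxx cabs0 => /(_ ler01).
have QE u : Q.[u] = lead_coef Q * \prod_(r <- s) (u - r).
  by rewrite {1}Qs hornerZ horner_prod; congr (_ * _); apply: eq_bigr => r _; rewrite !hornerE.
have sr r : r \in s -> 1 < cabs r.
  move=> rs; rewrite ltNge; apply/negP => /Q0; rewrite QE (big_rem r) //= subrr mul0r mulr0.
  by rewrite eqxx.
have [h1 h2 h3] := horner_analytic P c1 l1.
have [k1 k2 k3] := div_roots_analytic h1 h2 sr.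
have -> : (fun t => P.[em 1 t] / Q.[em 1 t]) = (fun t => (lead_coef Q)^-1 *
    (1 * P.[em 1 t] / \prod_(r <- s) (em 1 t - r))).
  by apply/funext => t; rewrite QE invfM mul1r; ring.
split; [exact: (hf_clsZ HI)|exact: (lowerZ HI)|].
by move=> z z1; rewrite (extGZ HI) // k3 // h3 // QE invfM; ring.
Qed.

End RationalHardy.

Section SchurMeasurable.
Context d (T : measurableType d) (R : realType).
Local Notation C := R[i].

Lemma measurable_cabs_lt1 (g : T -> C) : mfunC g -> measurable_fun setT (fun p => cabs (g p) < 1).
Proof.
move=> mg; have -> : (fun p => cabs (g p) < 1) = (fun p => cabs (g p) ^+ 2 < 1).
  by apply/funext => p; rewrite expr_lt1 // cabs_ge0.
apply: measurable_fun_ltr; first exact: measurable_cabs_sqr.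
exact: measurable_cst.
Qed.

(** The nodes are fixed and only the data vary, so the recursion unfolds into field operations and
    the measurable case distinction |g0| < 1. *)
Lemma mfunC_schur n (z : 'I_n -> C) (g : 'I_n -> T -> C) (t : T -> C) :
  (forall j, mfunC (g j)) -> mfunC t ->
  mfunC (fun p => (schur z (g^~ p)).1.[t p]) /\ mfunC (fun p => (schur z (g^~ p)).2.[t p]).
Proof.
move=> + mt; elim: n z g => [|n ih] z g mg.
  by split => /=; under eq_fun do rewrite ?hornerC ?horner0; exact: mfunC_cst.
pose g' j p := schur_value (z ord0) (g ord0 p) (z (lift ord0 j)) (g (lift ord0 j) p).
have mg' j : mfunC (g' j).
  apply: mfunCM; last exact: mfunC_cst.
  apply: mfunCM; first exact: mfunCB.
  apply: mfunCV; apply: mfunCB; first exact: mfunC_cst.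
  by apply: mfunCM => //; exact: mfunCJ.
have [hP hQ] := ih (fun j => z (lift ord0 j)) g' mg'.
have m1 : mfunC (fun p => t p - z ord0) by apply: mfunCB => //; exact: mfunC_cst.
have m2 : mfunC (fun p => 1 - (z ord0)^*%C * t p).
  by apply: mfunCB; [exact: mfunC_cst|apply: mfunCM => //; exact: mfunC_cst].
have mb := measurable_cabs_lt1 (mg ord0).
set P := (fun p => _) in hP; set Q := (fun p => _) in hQ.
split.
- have -> : (fun p => (schur z (g^~ p)).1.[t p]) = (fun p => if cabs (g ord0 p) < 1 then
      P p * (t p - z ord0) + g ord0 p * (Q p * (1 - (z ord0)^*%C * t p)) else g ord0 p).
    by apply/funext => p /=; case: ifP => _ /=; rewrite !(hornerE, hornerZ).
  apply: (mfunC_if mb); [|exact: mg]; apply: mfunCD; first exact: mfunCM.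
  by apply: mfunCM => //; exact: mfunCM.
- have -> : (fun p => (schur z (g^~ p)).2.[t p]) = (fun p => if cabs (g ord0 p) < 1 then
      Q p * (1 - (z ord0)^*%C * t p) + (g ord0 p)^*%C * (P p * (t p - z ord0)) else 1).
    by apply/funext => p /=; case: ifP => _ /=; rewrite !(hornerE, hornerZ).
  apply: (mfunC_if mb); [|exact: mfunC_cst].
  by apply: mfunCD; apply: mfunCM => //; [exact: mfunCJ|exact: mfunCM].
Qed.

End SchurMeasurable.

(** * Interpolation slice by slice *)

Section PickTorus.
Variable R : realType.
Local Notation C := R[i].
Local Notation T2 := (T2 R).
Local Notation S := (@sqT R).
Local Notation Linf_le := (@Linf_le R).
Local Notation I2 := (@I2 R).
Local Notation I1 := (@I1 R).
Local Notation fhat := (@fhat R).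
Local Notation chr2 := (@chr2 R).
Local Notation e1 := (@e1 R).
Local Notation cint1 := (@cint1 R).
Local Notation ext1 := (@ext1 R).

Lemma hat1_cst1 m : hatG cint1 e1 (fun=> 1) m = (m == 0)%:R.
Proof.
rewrite /hatG; under eq_fun do rewrite mul1r.
have [->|m0] := eqVneq m 0; last by rewrite (@cint1_e1 R (- m)) ?oppr_eq0.
have -> : e1 (- 0) = (fun=> 1 : C) by apply/funext => x; rewrite oppr0 /e1 mul0r expi0.
exact: cint1_cst.
Qed.

Lemma I1_cst1 : I1 (fun=> 1).
Proof. by apply: (@Linf1_I1 R _ 1); apply: Linf1_bnd => [|p]; [exact: mfunC_cst|rewrite cabs1]. Qed.

Lemma lower_cst1 : lower cint1 e1 (fun=> 1) 0.
Proof. by move=> m m0; rewrite hat1_cst1 lt_eqF. Qed.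

Lemma ext1_cst1 z : cabs z < 1 -> extG cint1 e1 z (fun=> 1) = 1.
Proof.
move=> z1; have H := hardy_1 R.
have v1 : upper cint1 e1 (fun=> 1) 1.
  by move=> m m0; rewrite hat1_cst1 gt_eqF // (lt_le_trans _ m0).
rewrite (extGE H); have := hatG_div H (-1) 0 z1 I1_cst1.
have -> := upper_div H z1 I1_cst1 v1 (m := 0 - -1); last by rewrite opprK add0r.
by rewrite mulr0 subr0 hat1_cst1 eqxx.
Qed.

Lemma analytic_of_slices F c : Linf_le F c ->
  {ae leb R, forall y, S y -> lower cint1 e1 (fun x => F (x, y)) 0} ->
  forall m k, m < 0 -> fhat F m k = 0.
Proof.
move=> LF H m k m0; rewrite fhatE.
have Iq : I2 (fun p => F p * chr2 (- m) (- k) p) by apply: (I2_Linf (Linf_I2 LF)); exact: Linf_chr2.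
rewrite (cint2_Fubini Iq).2 -[RHS]cint1_cst; apply: ae_eq_cint1.
- exact: (mfunC_cint1 Iq.1).
- exact: mfunC_cst.
apply: filterS2 H (section_Linf1 LF) => y h1 h2 Sy.
have -> : (fun x => F (x, y) * chr2 (- m) (- k) (x, y)) =
   (fun x => e1 (- k) y * (F (x, y) * e1 (- m) x)).
  by apply/funext => x; rewrite chr2_sect; ring.
rewrite cint1Z; last by apply: (hf_clsE (hardy_1 R)); exact: (Linf1_I1 (h2 Sy)).
have := h1 Sy m m0; rewrite /hatG => ->; exact: mulr0.
Qed.

Lemma pick_interpolation n (z : 'I_n -> C) G c : (forall j, cabs (z j) < 1) -> injective z ->
  Linf_le G c ->
  {ae leb R, forall y, S y -> pick_pos z (fun j => ext1 G (z j) y)} ->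
  exists F, [/\ Linf_le F 1, (forall m k, m < 0 -> fhat F m k = 0) &
    forall j, {ae leb R, forall y, S y -> ext1 F (z j) y = ext1 G (z j) y}].
Proof.
move=> z1 zinj LG pos.
pose g j (p : T2) := ext1 G (z j) p.2.
have mg j : mfunC (g j) by apply: mfunC_snd; apply: mfunC_ext1 => //; exact: LG.1.
have mt : mfunC (fun p : T2 => expi p.1) by apply: mfunC_expi; exact: measurable_fst.
have [mP mQ] := mfunC_schur z mg mt.
(* Division is total, so this is defined and measurable on the whole torus; bound, analyticity and
   interpolation are claimed on the slices where the Pick condition holds. *)
pose F p := (schur z (g^~ p)).1.[expi p.1] / (schur z (g^~ p)).2.[expi p.1].
have mF : mfunC F by apply: mfunCM => //; exact: mfunCV.
have H : {ae leb R, forall y, S y -> (forall x, cabs (F (x, y)) <= 1) /\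
    lower cint1 e1 (fun x => F (x, y)) 0 /\
    forall j, extG cint1 e1 (z j) (fun x => F (x, y)) = ext1 G (z j) y}.
  apply: filterS pos => y h /h {}h.
  have [s1 s2] := schurP z1 zinj h.
  set sc := schur z _ in s1 s2.
  have FE : (fun x => F (x, y)) = (fun x => sc.1.[e1 1 x] / sc.2.[e1 1 x]).
    by apply/funext => x; rewrite /F /= e1_expi.
  split; last first.
    have [_ r2 r3] := rational_analytic (hardy_1 R) sc.1 I1_cst1 lower_cst1 (fun t t1 => (s1 t t1).1).
    rewrite FE; split => // j; rewrite r3 // ext1_cst1 // mul1r s2 mulfK //.
    by have [] := s1 (z j) (ltW (z1 j)).
  move=> x; have := congr1 (fun f => f x) FE => /= ->.
  have c1 : cabs (e1 1 x) <= 1 by rewrite cabs_e1.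
  have [q0 pq] := s1 _ c1.
  by rewrite cabsM cabsV ler_pdivrMr ?mul1r // lt_neqAle eq_sym cabs_eq0 q0 cabs_ge0.
have LF : Linf_le F 1.
  split => //; apply: filterS (ae_snd H) => -[x y] h [_ Sy]; exact: (h Sy).1.
exists F; split => //.
- by apply: (analytic_of_slices LF); apply: filterS H => y h Sy; exact: (h Sy).2.1.
- move=> j; apply: filterS H => y h Sy; have [_ [_ hj]] := h Sy.
  by rewrite ext1E hj.
Qed.

End PickTorus.

(** * Positivity of the Pick form of a bounded analytic function *)

Section PickNecessary.
Variable R : realType.
Local Notation C := R[i].
Local Notation T1 := (measurableTypeR R).
Local Notation S := (@sqT R).
Local Notation mS := (@measurable_sqT R).
Local Notation I1 := (@I1 R).
Local Notation e1 := (@e1 R).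
Local Notation cint1 := (@cint1 R).

Lemma cint1_ge0 f : mfunC f -> {ae leb R, forall y, S y -> 0 <= f y} -> 0 <= cint1 f.
Proof.
(* A version of [f] that is real and nonnegative at every point, not only almost everywhere. *)
move=> mf f0; pose h y : R := `|complex.Re (f y)|.
have mh : measurable_fun setT h.
  by apply: measurableT_comp => //; exact: mf.1.
have mhC : mfunC (fun y : T1 => (h y)%:C%C) by split => //=; exact: measurable_cst.
have -> : cint1 f = cint1 (fun y => (h y)%:C%C).
  apply: ae_eq_cint1 => //; apply: filterS f0 => y h0 Sy.
  have := h0 Sy; rewrite /h; case: (f y) => a b; rewrite lecE /= => /andP[/eqP -> a0].
  by rewrite ger0_norm.
have E : cint1 (fun y => (h y)%:C%C) = ((2 * pi)^-1 * Rintegral (leb R) S h)%:C%C.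
  rewrite /Defs.cint1 /=.
  have -> : Rintegral (leb R) S (fun=> 0) = 0 by rewrite /Rintegral integral0_eq.
  by rewrite mulr0.
rewrite E lecR mulr_ge0 ?invr_ge0 ?mulr_ge0 ?pi_ge0 //.
by apply: Rintegral_ge0 => y _; exact: normr_ge0.
Qed.

Lemma cint1J f : I1 f -> cint1 (fun x => (f x)^*%C) = (cint1 f)^*%C.
Proof. by move=> hf; rewrite !cint1E cconjM conjc_real (CintJ mS hf). Qed.

Lemma cint1_sum J (s : seq J) (F : J -> T1 -> C) : (forall i, I1 (F i)) ->
  I1 (fun x => \sum_(i <- s) F i x) /\
  cint1 (fun x => \sum_(i <- s) F i x) = \sum_(i <- s) cint1 (F i).
Proof.
move=> hF; split; first exact: (@integrableC_sum _ _ _ _ _ mS (@leb_sqT_fin R) _ s F hF).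
rewrite cint1E (@Cint_sum _ _ _ _ _ mS (@leb_sqT_fin R) _ s F hF) mulr_sumr; apply: eq_bigr => i _; by rewrite cint1E.
Qed.

Section Kernels.
Variables (n : nat) (z : 'I_n -> C).
Hypothesis z1 : forall j, cabs (z j) < 1.

Definition szego (v : 'I_n -> C) (x : T1) : C := \sum_k v k / (1 - (z k)^*%C * e1 1 x).

Lemma szegoJ v x : (szego v x)^*%C = \sum_j (v j)^*%C / (1 - z j * e1 (-1) x).
Proof.
rewrite /szego cconj_sum; apply: eq_bigr => j _.
by rewrite cconjM cconjV cconjB rmorph1 cconjM cconjK -e1J.
Qed.

Lemma cabs_e1_le m x : cabs (e1 m x) <= 1.
Proof. by rewrite cabs_e1. Qed.

Lemma zJ1 j : cabs (z j)^*%C < 1.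
Proof. by rewrite cabsJ. Qed.

Lemma Linf1_szego v : exists c, Linf1 (szego v) c.
Proof.
exists (\sum_k cabs (v k) * (1 - cabs (z k))^-1); apply: Linf1_bnd.
  apply: (@mfunC_sum _ _ R) => k; apply: mfunCM; first exact: mfunC_cst.
  exact: (Linf1_cauchy 1 (zJ1 k)).1.
move=> x; apply: le_trans (cabs_sum _ _ _) _; apply: ler_sum => k _.
rewrite cabsM ler_wpM2l ?cabs_ge0 //.
by have := one_sub_inv_bnd (zJ1 k) (cabs_e1_le 1 x); rewrite cabsJ.
Qed.

(** The conjugate kernel at z_j evaluates at z_j the analytic function f / (1 - conj z_k e^{ix});
    its value is given by [extG_div]. *)
Lemma cint1_szego f u v : I1 f -> lower cint1 e1 f 0 ->
  cint1 (fun x => f x * ((szego u x)^*%C * szego v x)) =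
  \sum_j \sum_k (u j)^*%C * (extG cint1 e1 (z j) f / (1 - z j * (z k)^*%C)) * v k.
Proof.
move=> hf fl; have H := hardy_1 R.
have Ijk j k : I1 (fun x => f x / (1 - (z k)^*%C * e1 1 x) / (1 - z j * e1 (-1) x)).
  by apply: (hf_clsV H) => //; apply: (hf_clsV H) => //; exact: zJ1.
have -> : (fun x => f x * ((szego u x)^*%C * szego v x)) = (fun x => \sum_j \sum_k
   ((u j)^*%C * v k) * (f x / (1 - (z k)^*%C * e1 1 x) / (1 - z j * e1 (-1) x))).
  apply/funext => x; rewrite szegoJ /szego mulr_suml mulr_sumr; apply: eq_bigr => j _.
  by rewrite !mulr_sumr; apply: eq_bigr => k _; ring.
have Ij j k : I1 (fun x => ((u j)^*%C * v k) * (f x / (1 - (z k)^*%C * e1 1 x) / (1 - z j * e1 (-1) x))).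
  exact: (hf_clsZ H).
rewrite (cint1_sum _ (fun j => (cint1_sum _ (Ij j)).1)).2; apply: eq_bigr => j _.
rewrite (cint1_sum _ (Ij j)).2; apply: eq_bigr => k _.
rewrite cint1Z // -/(extG cint1 e1 (z j) (fun x => f x / (1 - (z k)^*%C * e1 1 x))).
by rewrite (extG_div H) ?zJ1 // [(z k)^*%C * _]mulrC; ring.
Qed.

Lemma pick_necessary f : Linf1 f 1 -> lower cint1 e1 f 0 ->
  pick_pos z (fun j => extG cint1 e1 (z j) f).
Proof.
move=> Lf fl v; have H := hardy_1 R; have If := Linf1_I1 Lf.
set gam := fun j => _.
(* [h] is the projection of [conj f g] onto H^2, since the adjoint of multiplication by [f]
   multiplies the kernel at z_k by the conjugate of f(z_k). So both cross terms integrate to the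
   integral of |h|^2. *)
pose g := szego v; pose h := szego (fun k => (gam k)^*%C * v k).
have [cg Lg] := Linf1_szego v; have [ch Lh] := Linf1_szego (fun k => (gam k)^*%C * v k).
have LJ (k : T1 -> C) c : Linf1 k c -> Linf1 (fun x => (k x)^*%C) c.
  by move=> [mk bk]; split; [exact: mfunCJ|apply: filterS bk => x hx /hx; rewrite cabsJ].
pose Hs := \sum_j \sum_k ((gam j)^*%C * v j)^*%C * (1 / (1 - z j * (z k)^*%C)) * ((gam k)^*%C * v k).
have I3 (f1 f2 f3 : T1 -> C) c2 c3 : I1 f1 -> Linf1 f2 c2 -> Linf1 f3 c3 ->
    I1 (fun x => f1 x * (f2 x * f3 x)).
  move=> h1 h2 h3; have := I1_Linf (I1_Linf h1 h2) h3.
  by congr I1; apply/funext => x; rewrite mulrA.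
have EA : cint1 (fun x => 1 * ((g x)^*%C * g x)) =
    \sum_j \sum_k (v j)^*%C * (1 / (1 - z j * (z k)^*%C)) * v k.
  rewrite (cint1_szego _ _ (I1_cst1 R) (lower_cst1 R)); apply: eq_bigr => j _; apply: eq_bigr => k _.
  by rewrite ext1_cst1.
have EH : cint1 (fun x => 1 * ((h x)^*%C * h x)) = Hs.
  rewrite (cint1_szego _ _ (I1_cst1 R) (lower_cst1 R)); apply: eq_bigr => j _; apply: eq_bigr => k _.
  by rewrite ext1_cst1.
have EB : cint1 (fun x => f x * ((g x)^*%C * h x)) = Hs.
  rewrite (cint1_szego _ _ If fl); apply: eq_bigr => j _; apply: eq_bigr => k _.
  by rewrite cconjM cconjK -/(gam j); ring.
have HJ : Hs^*%C = Hs.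
  rewrite -EH -cint1J; first by congr cint1; apply/funext => x; rewrite !cconjM cconjK rmorph1 [X in _ * X]mulrC.
  exact: (I3 _ _ _ _ _ (I1_cst1 R) (LJ _ _ Lh) Lh).
have IA := I3 _ _ _ _ _ (I1_cst1 R) (LJ _ _ Lg) Lg.
have IB := I3 _ _ _ _ _ If (LJ _ _ Lg) Lh.
have IH := I3 _ _ _ _ _ (I1_cst1 R) (LJ _ _ Lh) Lh.
have IBJ : I1 (fun x => (f x * ((g x)^*%C * h x))^*%C).
  have := I3 _ _ _ _ _ (Linf1_I1 (LJ _ _ Lf)) Lg (LJ _ _ Lh).
  by congr I1; apply/funext => x; rewrite !cconjM cconjK.
pose Phi x := 1 * ((g x)^*%C * g x) + -1 * (f x * ((g x)^*%C * h x))^*%C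
   + (-1 * (f x * ((g x)^*%C * h x)) + 1 * ((h x)^*%C * h x)).
have IZ c (k : T1 -> C) : I1 k -> I1 (fun x => c * k x) by exact: (hf_clsZ H).
have ID (k l : T1 -> C) : I1 k -> I1 l -> I1 (fun x => k x + l x) by exact: (hf_clsD H).
have EPhi : cint1 Phi = pick_form z gam v.
  rewrite cint1D; [|by apply: ID => //; exact: IZ|by apply: ID => //; exact: IZ].
  rewrite cint1D; [|exact: IA|exact: IZ].
  rewrite cint1D; [|exact: IZ|exact: IH].
  rewrite EA (cint1Z _ IBJ) (cint1J IB) (cint1Z _ IB) EB EH HJ.
  have -> (A B : C) : A + -1 * B + (-1 * B + B) = A - B by ring.
  rewrite /Hs /pick_form -sumrB; apply: eq_bigr => j _; rewrite -sumrB; apply: eq_bigr => k _.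
  by rewrite cconjM cconjK; ring.
have mPhi : mfunC Phi by exact: (ID _ _ (ID _ _ IA (IZ _ _ IBJ)) (ID _ _ (IZ _ _ IB) IH)).1.
rewrite -EPhi; apply: cint1_ge0 => //.
apply: filterS Lf.2 => x fx Sx; have := fx Sx => {}fx.
have -> : Phi x = (1 - f x * (f x)^*%C) * (g x * (g x)^*%C) +
   ((f x)^*%C * g x - h x) * ((f x)^*%C * g x - h x)^*%C.
  by rewrite /Phi !(cconjM, cconjB, cconjK); ring.
apply: addr_ge0; last by rewrite -cabs_sqrJ lecR sqr_ge0.
apply: mulr_ge0; rewrite -cabs_sqrJ ?lecR ?sqr_ge0 //.
by rewrite -[1]/(1%:C%C) -rmorphB lecR subr_ge0 expr_le1 // cabs_ge0.
Qed.

End Kernels.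
End PickNecessary.

(** * From Fourier coefficients to slices *)

Section Slices.
Variable R : realType.
Local Notation C := R[i].
Local Notation T1 := (measurableTypeR R).
Local Notation T2 := (T2 R).
Local Notation mu := (@mu2 R).
Local Notation D := (@sqT2 R).
Local Notation S := (@sqT R).
Local Notation mD := (@measurable_sqT2 R).
Local Notation mS := (@measurable_sqT R).
Local Notation Linf_le := (@Linf_le R).
Local Notation L2 := (@L2 R).
Local Notation I2 := (@I2 R).
Local Notation fhat := (@fhat R).
Local Notation chr2 := (@chr2 R).
Local Notation e1 := (@e1 R).
Local Notation cint1 := (@cint1 R).
Local Notation ext1 := (@ext1 R).

(** With the empty set as admissible spectrum the approximating polynomial is 0, so |f|^2 is below
    every positive bound. *)
Lemma ae_zero_fhat f : L2 f -> (forall m k, fhat f m k = 0) ->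
  {ae mu, forall p, D p -> f p = 0}.
Proof.
move=> hf fz.
have n0 : nsq f = 0.
  apply/le_anti; rewrite nsq_ge0 andbT; apply/ler_addgt0Pl => e e0; rewrite addr0.
  have [s sP hs] := nsq_dense_spectrum (L := pred0) hf e0 (fun m k _ => fz m k).
  case: s sP hs => [_|//]; congr (_ <= _); congr nsq; apply/funext => p.
  by rewrite /tpoly big_nil subr0.
have [mf hi] := hf.
have i0 : (\int[mu]_(p in D) `|(cabs (f p) ^+ 2)%:E|)%E = 0%E.
  have -> : (\int[mu]_(p in D) `|(cabs (f p) ^+ 2)%:E|)%E = (\int[mu]_(p in D) (cabs (f p) ^+ 2)%:E)%E.
    by apply: eq_integral => p _; rewrite abse_EFin ger0_norm // sqr_ge0.
  have := integrable_fin_num mD hi; move/fineK => <-; congr (_%:E).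
  move: n0; rewrite nsqE => /eqP; rewrite mulf_eq0 invr_eq0 sqrf_eq0.
  by rewrite (negbTE (twopi_neq0 R)) => /eqP.
have mh : measurable_fun D (fun p => (cabs (f p) ^+ 2)%:E).
  by apply: measurable_funTS; apply/measurable_EFinP; exact: measurable_cabs_sqr.
have := (ae_eq_integral_abs mu mD mh).1 i0.
apply: filterS => p h /h /= [] /eqP; rewrite sqrf_eq0 cabs_eq0 => /eqP //.
Qed.

(** If the property failed at a y whose slice is good, the whole interval, of length 2 pi, would be
    a null set. *)
Lemma ae_snd_const (P : T1 -> Prop) : {ae mu, forall p, D p -> P p.2} ->
  {ae leb R, forall y, S y -> P y}.
Proof.
move=> /(@ae_slices R (fun p => P p.2)); apply: filterS => y h Sy; apply: contrapT => nP.
have [N [mN N0 hN]] := h Sy.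
have SN : S `<=` N by move=> x Sx; apply: hN => /= /(_ Sx).
have : (leb R S <= leb R N)%E by apply: le_measure; rewrite ?inE //; exact: mS.
rewrite N0 leb_sqT lee_fin leNgt; apply/negP; rewrite negbK.
by rewrite mulr_gt0 // pi_gt0.
Qed.

(** The slice coefficient is a bounded function of y with vanishing Fourier coefficients; viewed on
    the torus as constant in x, it falls under [ae_zero_fhat]. *)
Lemma slice_coef_zero f c m : Linf_le f c -> (forall k, fhat f m k = 0) ->
  {ae leb R, forall y, S y -> hatG cint1 e1 (fun x => f (x, y)) m = 0}.
Proof.
move=> Lf fz; have If := Linf_I2 Lf.
pose a y := hatG cint1 e1 (fun x => f (x, y)) m.
have Iq k : I2 (fun p => f p * chr2 (- m) (- k) p) by apply: (I2_Linf If); exact: Linf_chr2.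
have ma : mfunC a.
  have := mfunC_cint1 (Iq 0).1; congr mfunC; apply/funext => y; congr cint1; apply/funext => x.
  by rewrite chr2_sect oppr0 /e1 mul0r expi0 mul1r.
have aE k : cint1 (fun y => a y * e1 (- k) y) = 0.
  rewrite -(fz k) fhatE (cint2_Fubini (Iq k)).2; apply: ae_eq_cint1.
  - by apply: mfunCM => //; exact: mfunC_e1.
  - exact: (mfunC_cint1 (Iq k).1).
  apply: filterS (section_Linf1 Lf) => y h Sy.
  rewrite /a /hatG mulrC -cint1Z; last by apply: (hf_clsE (hardy_1 R)); exact: (Linf1_I1 (h Sy)).
  by congr cint1; apply/funext => x; rewrite chr2_sect; ring.
have La : Linf_le (fun p => a p.2) (cabs (c1 R) * (2 * (`|c| * fine (leb R S)))).
  split; first exact: mfunC_snd.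
  apply: filterS (ae_snd (section_Linf1 Lf)) => p h [_ Sp].
  rewrite /a /hatG cint1E cabsM ler_wpM2l ?cabs_ge0 //.
  apply: (cabs_Cint_le mS (@leb_sqT_fin R)); have [mh bh] := h Sp; split.
    by apply: mfunCM => //; exact: mfunC_e1.
  by apply: filterS bh => x hx Sx; rewrite cabsM cabs_e1 mulr1; exact: hx.
apply: (@ae_snd_const (fun y => a y = 0)).
apply: ae_zero_fhat; first exact: (Linf_L2 La).
by move=> l k; rewrite (fhat_snd (g := a)) ?aE ?mulr0 //; exact: (Linf_I2 La).
Qed.

(** Each negative frequency has its own null set of slices, and there are countably many. *)
Lemma slices_analytic f c : Linf_le f c -> (forall m k, m < 0 -> fhat f m k = 0) ->
  {ae leb R, forall y, S y -> lower cint1 e1 (fun x => f (x, y)) 0}.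
Proof.
move=> Lf fz.
have := ae_foralln (mu := leb R) (fun n : nat => slice_coef_zero Lf (fun k => fz (Negz n) k isT)).
by apply: filterS => y h Sy [m|m] // _; exact: h.
Qed.

Section PickMatrix.
Variables (n : nat) (z g : 'I_n -> C).

Lemma psd_pick_form : psd (\matrix_(j < n, k < n)
    ((1 - g j * (g k)^*%C) / (1 - z j * (z k)^*%C))) <-> pick_pos z g.
Proof.
set M := \matrix_(j, k) _.
have E (v : 'cV[C]_n) : ((map_mx (fun x => x^*%C) v)^T *m M *m v) 0 0 = pick_form z g (fun j => v j 0).
  rewrite mxE /pick_form exchange_big /=; apply: eq_bigr => k _.
  by rewrite mxE mulr_suml; apply: eq_bigr => j _; rewrite !mxE.
split=> h v.
  have := h (\col_j v j); rewrite E; congr (0 <= _); apply: eq_bigr => j _; apply: eq_bigr => k _.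
  by rewrite !mxE.
by rewrite E; exact: h.
Qed.

End PickMatrix.

Section Torus.
Variables (n : nat) (z : 'I_n -> C) (G : T2 -> C) (c : R).
Hypotheses (z1 : forall j, cabs (z j) < 1) (zinj : injective z) (LG : Linf_le G c).

Lemma interpolation_pick F : Linf_le F 1 -> (forall m k, m < 0 -> fhat F m k = 0) ->
  (forall j, {ae leb R, forall y, S y -> ext1 F (z j) y = ext1 G (z j) y}) ->
  {ae leb R, forall y, S y -> pick_pos z (fun j => ext1 G (z j) y)}.
Proof.
move=> LF Fz E.
have hE : {ae leb R, forall y, S y -> forall j, ext1 F (z j) y = ext1 G (z j) y}.
  have : {ae leb R, forall y, forall i : nat, S y -> forall lt_i : (i < n)%N,
      ext1 F (z (Ordinal lt_i)) y = ext1 G (z (Ordinal lt_i)) y}.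
    apply: ae_foralln => i; have [lin|nli] := pselect (i < n)%N.
      by apply: filterS (E (Ordinal lin)) => y h Sy lt_i; rewrite (bool_irrelevance lt_i lin) h.
    by apply: aeW => y _ lt_i.
  by apply: filterS => y h Sy [i lt_i]; exact: h.
apply: filterS3 hE (section_Linf1 LF) (slices_analytic LF Fz) => y h1 h2 h3 Sy v.
have gE : (fun j => ext1 G (z j) y) = (fun j => extG cint1 e1 (z j) (fun x => F (x, y))).
  by apply/funext => j; rewrite -h1 // ext1E.
rewrite gE; exact: (pick_necessary z1 (h2 Sy) (h3 Sy) v).
Qed.

End Torus.
End Slices.

(** * Testing the Hankel operator *)

Section HankelTest.
Variable R : realType.
Local Notation C := R[i].
Local Notation T2 := (T2 R).
Local Notation Linf_le := (@Linf_le R).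
Local Notation L2 := (@L2 R).
Local Notation fhat := (@fhat R).
Local Notation chr2 := (@chr2 R).
Local Notation inner := (@inner R).
Local Notation ey := (@ey R).
Local Notation e1 := (@e1 R).
Local Notation cint2 := (@cint2 R).
Local Notation Re := (@complex.Re R).
Local Notation tpoly := (@tpoly R).

(** The weight makes small perturbations harmless: when |f| is of order d and |g| is bounded, both
    terms on the right are of order d. *)
Lemma Re_inner_le_scale f g (d : R) : L2 f -> L2 g -> 0 < d ->
  2 * Re (inner f g) <= d^-1 * nsq f + d * nsq g.
Proof.
move=> hf hg d0.
have := nsq_ge0 (fun p => f p - d%:C%C * g p).
rewrite nsqB //; last exact: L2Z.
rewrite innerZr // nsqZ // conjc_real cabs_real (gtr0_norm d0).
have -> : Re (d%:C%C * inner f g) = d * Re (inner f g) by rewrite cReM /= mul0r subr0.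
move=> h; rewrite -subr_ge0.
have -> : d^-1 * nsq f + d * nsq g - 2 * Re (inner f g) =
    d^-1 * (nsq f - 2 * (d * Re (inner f g)) + d ^+ 2 * nsq g) by field; rewrite gt_eqF.
by rewrite mulr_ge0 // invr_ge0 ltW.
Qed.

Lemma Linf_tpoly s : exists c, Linf_le (tpoly s) c.
Proof.
exists (\sum_(t <- s) cabs t.1); apply: Linf_bnd => [|p].
  exact: (L2_tpoly s).1.
apply: le_trans (cabs_sum _ _ _) _; apply: ler_sum => t _.
by rewrite cabsM cabs_chr2 mulr1.
Qed.

Lemma Linf_mul f g c e : Linf_le f c -> Linf_le g e -> Linf_le (fun p => f p * g p) (`|c| * e).
Proof.
move=> [mf hf] Lg; apply: (LinfM _ Lg); last exact: normr_ge0.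
by split => //; apply: filterS hf => p h /h /le_trans; apply; exact: ler_norm.
Qed.

Lemma analytic_mul_x a f c : Linf_le a c -> L2 f ->
  (forall m k, m < 0 -> fhat a m k = 0) -> (forall m k, m < 0 -> fhat f m k = 0) ->
  forall m k, m < 0 -> fhat (fun p => a p * f p) m k = 0.
Proof.
move=> ha hf az fz m k m0.
apply: (@fhat_mulM R (fun x => x.1 < 0) (fun x => 0 <= x.1) a f c) => //=.
- by move=> i j l r il0 l0; lra.
- by move=> i j; rewrite -ltNge; exact: fz.
Qed.

Lemma analytic_mul_y a f c : Linf_le a c -> L2 f ->
  (forall m k, k < 0 -> fhat a m k = 0) -> (forall m k, k < 0 -> fhat f m k = 0) ->
  forall m k, k < 0 -> fhat (fun p => a p * f p) m k = 0.
Proof.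
move=> ha hf az fz m k m0.
apply: (@fhat_mulM R (fun x => x.2 < 0) (fun x => 0 <= x.2) a f c) => //=.
- by move=> i j l r il0 l0; lra.
- by move=> i j; rewrite -ltNge; exact: fz.
Qed.

Section Test.
Variables (n : nat) (z w : 'I_n -> C) (G : T2 -> C).
Hypotheses (z1 : forall j, cabs (z j) < 1) (w1 : forall j, cabs (w j) < 1).
Hypothesis hG : Hinf G.
Let b (p : T2) := blaschke z p.1 * blaschke w p.2.
Let phi p := (b p)^*%C * G p.
Hypothesis hankel : hankel_norm_le phi 1.

Lemma bK p : b p * (b p)^*%C = 1.
Proof. by rewrite /b cconjM mulrACA !blaschkeK // mulr1. Qed.

(* The factor [ey N] moves [f] into H^2; it drops out of both sides. *)
Lemma hankel_test_shift f g (c : R) (N : int) : Linf_le f c ->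
  (forall m k, m < 0 \/ k < - N -> fhat f m k = 0) -> L2 g ->
  (forall u cu, Linf_le u cu -> (forall m k, m < 0 -> fhat u m k = 0) ->
     inner (fun p => u p * blaschke z p.1) g = 0) ->
  2 * Re (inner (fun p => G p * f p) g) <= nsq f + nsq g.
Proof.
move=> Lf fz Lg gz; have [[cG LG] Gz] := hG.
have eK p : ey N p * (ey N p)^*%C = 1 by rewrite -(hf_emJ (hardy_y R 0)) (emN (hardy_y R 0)).
have Le : Linf_le (ey N) 1 by exact: Linf_chr2.
have Lb := Linf_blaschkeJ2 z1 w1.
pose f' p := f p * ey N p.
have If := Linf_I2 Lf.
have Lf' : Linf_le f' (1 * c).
  by have := LinfM Le Lf ler01; congr Defs.Linf_le; apply/funext => p; rewrite mulrC.
have L2f' := Linf_L2 Lf'.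
have f'z m k : m < 0 \/ k < 0 -> fhat f' m k = 0.
  move=> mk; rewrite -hat_y (hatG_shift (hardy_y R m)) hat_y fz //.
  by case: mk => h; [left|right; rewrite ltrBlDr addrC subrr].
have hf' : H2 f' by split.
have hGf : Hinf (fun p => G p * f' p).
  split; first by eexists; exact: (Linf_mul LG Lf').
  move=> m k [m0|k0].
    by apply: (analytic_mul_x LG L2f') => // i j i0; [apply: Gz; left|apply: f'z; left].
  by apply: (analytic_mul_y LG L2f') => // i j i0; [apply: Gz; right|apply: f'z; right].
have [h Hh hP] := proj_exists z1 w1 hGf.
have E : (fun p => (blaschke z p.1 * blaschke w p.2)^*%C * (G p * f' p)) = fmul phi f'.
  by apply/funext => p; rewrite /fmul /phi /b mulrA.
rewrite E in hP.
have Lphi : Linf_le phi (1 * cG) := LinfM Lb LG ler01.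
have L2phif : L2 (fmul phi f').
  by have := L2_Linf L2f' Lphi; congr Defs.L2; apply/funext => p; rewrite /fmul mulrC.
have L2h : L2 h by case: hP => -[].
have L2r : L2 (fsub (fmul phi f') h) by exact: L2B.
have r_le : nsq (fsub (fmul phi f') h) <= nsq f'.
  have := hankel hf' hP; rewrite mul1r !norm2E ler_sqrt ?nsq_ge0 //.
(* Against [psi] the function [phi f'] gives back <G f, g>, while the projection [h] gives <u b_1,
   g> with u = h b_2 e^{-iNy}. This u is analytic in x, so the second pairing is 0 by [gz]. *)
pose psi p := (b p)^*%C * (ey N p * g p).
have L2psi : L2 psi.
  have := L2_Linf (L2_Linf Lg Le) Lb; congr Defs.L2; apply/funext => p.
  by rewrite /psi /b; ring.
have nf : nsq f' = nsq f.
  rewrite /nsq; congr Re; congr cint2; apply/funext => p.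
  by rewrite /f' cconjM mulrACA eK mulr1.
have ng : nsq psi = nsq g.
  rewrite /nsq; congr Re; congr cint2; apply/funext => p.
  rewrite /psi; move: (b p) (bK p) => B BK.
  by rewrite !cconjM cconjK mulrACA [_^*%C * B]mulrC BK mul1r mulrACA eK mul1r.
have := Re_inner_le L2r L2psi; rewrite ng.
rewrite innerBl //.
have -> : inner (fmul phi f') psi = inner (fun p => G p * f p) g.
  congr cint2; apply/funext => p.
  rewrite /fmul /phi /psi /f'; move: (b p) (bK p) => B BK.
  rewrite !cconjM cconjK -[RHS]mul1r -BK -[RHS]mul1r -(eK p); ring.
have -> : inner h psi = 0.
  have [[ch Lh] hz] := Hh.
  have Lu := Linf_mul (Linf_mul Lh (Linf_blaschke_y w1)) (Linf_chr2 R 0 (- N)).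
  rewrite -[RHS](gz _ _ Lu).
    congr cint2; apply/funext => p.
    rewrite /psi /b !cconjM !cconjK -[chr2 0 (- N) p]/(ey (- N) p) (hf_emJ (hardy_y R 0)); ring.
  move=> m k m0.
  rewrite -hat_y (hatG_shift (hardy_y R m)) hat_y.
  by apply: (blaschke_zero_y w1 (Linf_I2 Lh)) => l; apply: hz; left.
by rewrite subr0 => /le_trans; apply; rewrite lerD2r -nf.
Qed.

(** A trigonometric approximation keeps the x-frequencies nonnegative and has finitely many
    y-frequencies, so a shift [N] exists for it; the error is controlled by [Re_inner_le_scale]. *)
Lemma hankel_test f g : L2 f -> (forall m k, m < 0 -> fhat f m k = 0) -> L2 g ->
  (forall u cu, Linf_le u cu -> (forall m k, m < 0 -> fhat u m k = 0) ->
     inner (fun p => u p * blaschke z p.1) g = 0) ->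
  2 * Re (inner (fun p => G p * f p) g) <= nsq f + nsq g.
Proof.
have arith (r1 r2 nt nf ng x y e : R) : r1 <= nt + ng -> r2 <= x -> nt <= nf + y ->
    x + y <= e -> r1 + r2 <= e + (nf + ng) by lra.
move=> Lf fz Lg gz; have [[cG LG] Gz] := hG.
(* [K] is the sum of the coefficients of [d] in the estimates [e1] and [e2], so the whole
   perturbation is d K <= e. *)
pose K := `|cG| ^+ 2 + nsq g + 1 + nsq f + 1.
have K0 : 0 < K by rewrite /K ltr_wpDl // !addr_ge0 ?sqr_ge0 ?nsq_ge0.
apply/ler_addgt0Pl => e e0.
pose d := Num.min 1 (e / K).
have d0 : 0 < d by rewrite lt_min ltr01 divr_gt0.
have d1 : d <= 1 by rewrite ge_min lexx.
have de : d * K <= e by rewrite -ler_pdivlMr // ge_min lexx orbT.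
have [s sP hs] := @nsq_dense_spectrum R f (d ^+ 2) (fun x => 0 <= x.1) Lf (exprn_gt0 2 d0)
  (fun m k mk => fz m k (ltac:(by rewrite ltNge))).
set t := tpoly s in hs.
have [ct Lt] := Linf_tpoly s.
have L2t : L2 t := Linf_L2 Lt.
have [N hN] : exists N : int, forall q, q \in s -> - N <= q.2.2.
  elim: (s) => [|q l [N hN]]; first by exists 0.
  exists (Num.max N (- q.2.2)) => x; rewrite inE oppr_max opprK => /orP[/eqP ->|/hN h].
    by rewrite ge_min lexx orbT.
  by rewrite ge_min h.
have tz m k : m < 0 \/ k < - N -> fhat t m k = 0.
  move=> mk; rewrite fhat_tpoly big1_seq // => q /= qs.
  have q1 := allP sP q qs; have q2 := hN q qs.
  case: (altP (q.2.1 =P m)) => [qm|_]; last by rewrite mulr0.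
  case: (altP (q.2.2 =P k)) => [qk|_]; last by rewrite mulr0.
  by case: mk; rewrite -?qm -?qk ltNge ?q1 ?q2.
have main := hankel_test_shift Lt tz Lg gz.
set D' := (fun p => f p - t p) in hs.
have LD : L2 D' by exact: L2B.
have LGm (h : T2 -> C) : L2 h -> L2 (fun p => G p * h p).
  by move=> hh; have := L2_Linf hh LG; congr Defs.L2; apply/funext => p; rewrite mulrC.
have -> : (fun p => G p * f p) = (fun p => G p * t p + G p * D' p).
  by apply/funext => p; rewrite /D'; ring.
rewrite (innerDl (LGm _ L2t) (LGm _ LD) Lg) cReD mulrDr.
have LG' : Linf_le G `|cG|.
  by split; [exact: LG.1|apply: filterS LG.2 => p h /h /le_trans; apply; exact: ler_norm].
have e1 : 2 * Re (inner (fun p => G p * D' p) g) <= d * (`|cG| ^+ 2 + nsq g).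
  apply: le_trans (Re_inner_le_scale (LGm _ LD) Lg d0) _.
  rewrite mulrDr lerD2r ler_pdivrMl // mulrCA mulrA -expr2.
  apply: le_trans (nsq_mul_le LD LG' (normr_ge0 _)) _.
  by rewrite mulrC ler_wpM2r ?sqr_ge0.
have e2 : nsq t <= nsq f + d * (1 + nsq f + 1).
  have -> : t = (fun p => f p + -1 * D' p) by apply/funext => p; rewrite /D'; ring.
  have LN := L2Z (-1) LD.
  rewrite nsqD // nsqZ // cabsN cabs1 expr1n mul1r -addrA lerD2l.
  have := Re_inner_le_scale LN Lf d0; rewrite nsqZ // cabsN cabs1 expr1n mul1r.
  rewrite innerC // cReJ => h.
  have h2 : d^-1 * nsq D' <= d by rewrite ler_pdivrMl // -expr2.
  have h3 : d ^+ 2 <= d by rewrite expr2 ger_pMl.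
  rewrite !mulrDr mulr1; apply: lerD; last exact: le_trans hs h3.
  by apply: le_trans h _; rewrite lerD2r.
have e3 : d * (`|cG| ^+ 2 + nsq g) + d * (1 + nsq f + 1) <= e.
  by apply: le_trans de; rewrite -mulrDr /K !addrA.
exact: (arith _ _ _ _ _ _ _ _ main e1 e2 e3).
Qed.

End Test.
End HankelTest.

(** * Reality and continuity of the Pick form *)

Section PickFormReal.
Variable R : realType.
Local Notation C := R[i].
Local Notation Re := (@complex.Re R).
Variables (n : nat) (z g : 'I_n -> C).

Lemma pick_formJ v : (pick_form z g v)^*%C = pick_form z g v.
Proof.
rewrite /pick_form cconj_sum; under eq_bigr do rewrite cconj_sum.
rewrite exchange_big; apply: eq_bigr => j _; apply: eq_bigr => k _.
rewrite !(cconjM, cconjV, cconjB, cconjK, rmorph1).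
by rewrite [(g k)^*%C * _]mulrC [(z k)^*%C * _]mulrC; ring.
Qed.

Lemma pick_form_ge0E v : (0 <= pick_form z g v) = (0 <= Re (pick_form z g v)).
Proof.
have := pick_formJ v; case: (pick_form z g v) => a b [] /eqP.
by rewrite lecE /= eq_sym -addr_eq0 -mulr2n mulrn_eq0 /= => /eqP ->; rewrite eqxx.
Qed.

Definition ratC (q : rat * rat) : C := (ratr q.1 +i* ratr q.2)%C.

Lemma ratC_dense (x : C) (d : R) : 0 < d -> exists q, cabs (x - ratC q) <= d.
Proof.
move=> d0; have d2 : 0 < d / 2 by rewrite divr_gt0.
have approx (r : R) : exists q : rat, `|r - ratr q| <= d / 2.
  have rd : r < r + d / 2 by rewrite ltrDl.
  have [q] := rat_in_itvoo rd; rewrite in_itv /= => /andP[h1 h2]; exists q.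
  by rewrite distrC ger0_norm ?subr_ge0 ?(ltW h1) // lerBlDl ltW.
case: x => a b'; have [q hq] := approx a; have [r hr] := approx b'; exists (q, r).
apply: le_trans (cabs_le_ReIm _) _.
by rewrite [leRHS]splitr; apply: lerD.
Qed.

(* The form is continuous in [v], so it suffices to test a countable dense set. *)
Lemma pick_pos_rat :
  (forall c : {ffun 'I_n -> rat * rat}, 0 <= pick_form z g (fun j => ratC (c j))) ->
  pick_pos z g.
Proof.
move=> hc v; rewrite pick_form_ge0E; apply/ler_addgt0Pl => e e0.
pose M j k := (1 - g j * (g k)^*%C) / (1 - z j * (z k)^*%C).
pose A := \sum_j \sum_k cabs (M j k).
pose V := \sum_j cabs (v j).
have A0 : 0 <= A by apply: sumr_ge0 => j _; apply: sumr_ge0 => k _; exact: cabs_ge0.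
have V0 : 0 <= V by apply: sumr_ge0 => j _; exact: cabs_ge0.
have vV j : cabs (v j) <= V.
  by rewrite /V (bigD1 j) //= lerDl; apply: sumr_ge0 => k _; exact: cabs_ge0.
pose B := A * (V + V + 1) + 1.
have B0 : 0 < B by rewrite /B ltr_wpDl // mulr_ge0 // !addr_ge0.
pose d := Num.min 1 (e / B).
have d0 : 0 < d by rewrite lt_min ltr01 divr_gt0.
have d1 : d <= 1 by rewrite ge_min lexx.
have /choice [c hcv] : forall j, exists q, cabs (v j - ratC q) <= d by move=> j; exact: ratC_dense.
have := hc [ffun j => c j]; rewrite pick_form_ge0E.
set u := fun j => _; have uc j : cabs (v j - u j) <= d by rewrite /u ffunE.
have uV j : cabs (u j) <= V + 1.
  have -> : u j = v j + - (v j - u j) by ring.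
  by apply: le_trans (cabsD _ _) _; rewrite cabsN lerD // (le_trans (uc j)).
have : cabs (pick_form z g u - pick_form z g v) <= e.
  apply: (@le_trans _ _ (d * B)); last by rewrite -ler_pdivlMr // ge_min lexx orbT.
  apply: (@le_trans _ _ (\sum_j \sum_k cabs (M j k) * (d * (V + V + 1)))).
    rewrite /pick_form -sumrB; apply: le_trans (cabs_sum _ _ _) _; apply: ler_sum => j _.
    rewrite -sumrB; apply: le_trans (cabs_sum _ _ _) _; apply: ler_sum => k _.
    (* One vector is changed at a time; |u_k| <= V + 1 and |v_j| <= V account for the factor V + V +
       1. *)
    have -> : (u j)^*%C * M j k * u k - (v j)^*%C * M j k * v k =
      M j k * (- (v j - u j)^*%C * u k + - ((v j)^*%C * (v k - u k))) by rewrite cconjB; ring.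
    rewrite cabsM ler_wpM2l ?cabs_ge0 //; apply: le_trans (cabsD _ _) _.
    rewrite !(cabsN, cabsM, cabsJ) -addrA [V + 1]addrC [V + _]addrC mulrDr; apply: lerD.
      by apply: ler_pM; rewrite ?cabs_ge0 // addrC.
    by rewrite mulrC; apply: ler_pM; rewrite ?cabs_ge0.
  under eq_bigr do rewrite -mulr_suml.
  by rewrite -mulr_suml -/A mulrCA ler_wpM2l ?(ltW d0) // /B lerDl.
move=> h1 h2.
have h3 : Re (pick_form z g u) - Re (pick_form z g v) <= e.
  have -> : Re (pick_form z g u) - Re (pick_form z g v) = Re (pick_form z g u - pick_form z g v).
    by case: (pick_form z g u) (pick_form z g v) => [? ?] [? ?].
  apply: le_trans (ler_norm _) _; exact: le_trans (normr_Re_le _) h1.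
by lra.
Qed.

End PickFormReal.

(** * The Pick condition from the Hankel bound *)

Section PickOfHankel.
Variable R : realType.
Local Notation C := R[i].
Local Notation T1 := (measurableTypeR R).
Local Notation T2 := (T2 R).
Local Notation S := (@sqT R).
Local Notation mD := (@measurable_sqT2 R).
Local Notation mS := (@measurable_sqT R).
Local Notation Linf_le := (@Linf_le R).
Local Notation I2 := (@I2 R).
Local Notation I1 := (@I1 R).
Local Notation fhat := (@fhat R).
Local Notation inner := (@inner R).
Local Notation ex := (@ex R).
Local Notation e1 := (@e1 R).
Local Notation Ix := (@Ix R).
Local Notation cint1 := (@cint1 R).
Local Notation cint2 := (@cint2 R).
Local Notation ext1 := (@ext1 R).
Local Notation Re := (@complex.Re R).

Lemma I1_ae_eq f g : I1 f -> mfunC g -> {ae leb R, forall y, S y -> f y = g y} -> I1 g.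
Proof.
move=> If mg e.
apply: (integrableC_dom mS mg (integrable_cabs mS If)).
by apply: filterS e => y h Sy; rewrite -h // cabs_le_ReIm.
Qed.

Lemma Linf_sum J (s : seq J) (F : J -> T2 -> C) : (forall i, exists c, Linf_le (F i) c) ->
  exists c, Linf_le (fun p => \sum_(i <- s) F i p) c.
Proof.
move=> hF; elim: s => [|i s [c hc]].
  by exists 0; apply: Linf_bnd => [|p]; [under eq_fun do rewrite big_nil; exact: mfunC_cst|rewrite big_nil cabs0].
have [ci hi] := hF i; exists (ci + c).
by under [X in Defs.Linf_le X]eq_fun do rewrite big_cons; exact: LinfD.
Qed.

Lemma cint2_sum J (s : seq J) (F : J -> T2 -> C) : (forall i, I2 (F i)) ->
  cint2 (fun x => \sum_(i <- s) F i x) = \sum_(i <- s) cint2 (F i).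
Proof.
move=> hF; rewrite cint2E (@Cint_sum _ _ _ _ _ mD (@mu2_sqT2_fin R) _ s F hF) mulr_sumr.
by apply: eq_bigr => i _; rewrite cint2E.
Qed.

Lemma cReB (x y : C) : Re (x - y) = Re x - Re y.
Proof. by case: x y => [? ?] [? ?]. Qed.

Lemma cint1B f g : I1 f -> I1 g -> cint1 (fun x => f x - g x) = cint1 f - cint1 g.
Proof. by move=> hf hg; rewrite !cint1E (CintB mS) // mulrBr. Qed.

Section Kernels.
Variables (n : nat) (z : 'I_n -> C).
Hypothesis z1 : forall j, cabs (z j) < 1.

(** Kernels in x with coefficients depending on y: both the data G(z_k, y) and an indicator in y
    enter through the coefficients. *)
Definition szego_y (a : 'I_n -> T1 -> C) (p : T2) : C := szego z (a^~ p.2) p.1.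

Lemma szego_yE a p : szego_y a p = \sum_k a k p.2 / (1 - (z k)^*%C * ex 1 p).
Proof. by apply: eq_bigr => k _; rewrite -ex_expi e1_expi. Qed.

Lemma szego_I1_lower v : I1 (szego z v) /\ lower cint1 e1 (szego z v) 0.
Proof.
have H := hardy_1 R.
suff : forall s : seq 'I_n, I1 (fun x => \sum_(k <- s) v k / (1 - (z k)^*%C * e1 1 x)) /\
    lower cint1 e1 (fun x => \sum_(k <- s) v k / (1 - (z k)^*%C * e1 1 x)) 0 by exact.
elim=> [|k s [ih1 ih2]].
  have -> : (fun x => \sum_(k <- [::]) v k / (1 - (z k)^*%C * e1 1 x)) = (fun x => 0 * 1).
    by apply/funext => x; rewrite big_nil mul0r.
  split; [exact: (hf_clsZ H _ (I1_cst1 R))|exact: (lowerZ H _ (I1_cst1 R) (@lower_cst1 R))].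
have -> : (fun x => \sum_(k <- k :: s) v k / (1 - (z k)^*%C * e1 1 x)) =
   (fun x => v k * (1 / (1 - (z k)^*%C * e1 1 x)) + \sum_(k <- s) v k / (1 - (z k)^*%C * e1 1 x)).
  by apply/funext => x; rewrite big_cons mul1r.
have zk : cabs (z k)^*%C < 1 by rewrite cabsJ.
have h1 := hf_clsV H 1 zk (I1_cst1 R).
have h2 := hf_clsZ H (v k) h1.
split; first exact: (hf_clsD H h2 ih1).
apply: (lowerD H h2 ih1 _ ih2); apply: (lowerZ H _ h1).
exact: (lower_div H zk (I1_cst1 R) (lower_cst1 R)).
Qed.

Section Coefficients.
Variable a : 'I_n -> T1 -> C.
Hypothesis La : forall k, exists c, Linf_le (fun p => a k p.2) c.

Lemma Linf_szego_y : exists c, Linf_le (szego_y a) c.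
Proof.
have [c hc] := @Linf_sum _ (index_enum 'I_n) (fun k p => a k p.2 * (1 - (z k)^*%C * ex 1 p)^-1)
  (fun k => let: ex_intro c hc := La k in
    ex_intro _ _ (Linf_mul hc (Linf_cauchy 1 0 (zJ1 z1 k)))).
by exists c; move: hc; congr Defs.Linf_le; apply/funext => p; rewrite szego_yE.
Qed.

Lemma szego_y_analytic m k : m < 0 -> fhat (szego_y a) m k = 0.
Proof.
have [c hc] := Linf_szego_y; apply: (analytic_of_slices hc).
apply: aeW => y _; have [_ h] := szego_I1_lower (a^~ y); exact h.
Qed.

Lemma mfunC_coef k : mfunC (a k).
Proof. by have [c [mc _]] := La k; exact: (mfunC_section 0 (mfunC_sw mc)). Qed.

(** Pairing with the kernel at z_k evaluates at z_k, where the Blaschke product vanishes. This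
    supplies the orthogonality hypothesis of [hankel_test]. *)
Lemma inner_blaschke_szego_y u c : Linf_le u c -> (forall m k, m < 0 -> fhat u m k = 0) ->
  inner (fun p => u p * blaschke z p.1) (szego_y a) = 0.
Proof.
move=> Lu uz.
pose F k p := u p * (a k p.2)^*%C * blaschke z p.1 / (1 - z k * ex (-1) p).
have Iua k : I2 (fun p => u p * (a k p.2)^*%C).
  by have [ck hk] := La k; exact: (I2_Linf (Linf_I2 Lu) (LinfJ hk)).
have IF k : I2 (F k).
  apply: (hf_clsV (hardy_x R 0)) => //.
  exact: (I2_Linf (Iua k) (Linf_blaschke_x z1)).
have -> : inner (fun p => u p * blaschke z p.1) (szego_y a) = \sum_k cint2 (F k).
  rewrite -(cint2_sum (index_enum 'I_n) IF); congr cint2; apply/funext => p.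
  rewrite /szego_y szegoJ mulr_sumr; apply: eq_bigr => k _.
  by rewrite -e1N_expi exN_expi /F; ring.
rewrite big1 // => k _; have [ck hk] := La k.
have := @extG_blaschke_x R n z z1 (fun p => u p * (a k p.2)^*%C) 0 k (Iua k).
have -> : cint2 (F k) = extG (Ix 0) ex (z k) (fun p => (u p * (a k p.2)^*%C) * blaschke z p.1).
  by rewrite /extG /Ix; congr cint2; apply/funext => p; rewrite oppr0 chr2_0 mulr1.
apply=> m m0; apply: (analytic_mul_x Lu _ uz) => //.
  exact: (Linf_L2 (LinfJ hk)).
move=> i j i0; rewrite (fhat_snd (g := fun y => (a k y)^*%C)) ?lt_eqF ?mul0r //.
exact: (Linf_I2 (LinfJ hk)).
Qed.

End Coefficients.

(** Fubini's theorem, with [cint1_szego] on almost every slice. *)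
Lemma inner_szego_y (H : T2 -> C) c a a' : Linf_le H c -> (forall m k, m < 0 -> fhat H m k = 0) ->
  (forall k, exists c, Linf_le (fun p => a k p.2) c) ->
  (forall k, exists c, Linf_le (fun p => a' k p.2) c) ->
  let X y := \sum_j \sum_k (a' j y)^*%C * (ext1 H (z j) y / (1 - z j * (z k)^*%C)) * a k y in
  I1 X /\ inner (fun p => H p * szego_y a p) (szego_y a') = cint1 X.
Proof.
move=> LH Hz La La' X.
have [ca hca] := Linf_szego_y La; have [ca' hca'] := Linf_szego_y La'.
have Iq : I2 (fun p => H p * szego_y a p * (szego_y a' p)^*%C).
  exact: (I2_Linf (I2_Linf (Linf_I2 LH) hca) (LinfJ hca')).
have [If ->] : I1 (fun y => cint1 (fun x => H (x, y) * szego_y a (x, y) * (szego_y a' (x, y))^*%C)) /\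
  inner (fun p => H p * szego_y a p) (szego_y a') =
  cint1 (fun y => cint1 (fun x => H (x, y) * szego_y a (x, y) * (szego_y a' (x, y))^*%C)) :=
  cint2_Fubini Iq.
have mX : mfunC X.
  apply: (@mfunC_sum _ _ R) => j; apply: (@mfunC_sum _ _ R) => k.
  apply: mfunCM; last exact: mfunC_coef.
  apply: mfunCM; first by apply: mfunCJ; exact: mfunC_coef.
  by apply: mfunCM; [apply: mfunC_ext1 => //; exact: LH.1|exact: mfunC_cst].
have e : {ae leb R, forall y, S y ->
    cint1 (fun x => H (x, y) * szego_y a (x, y) * (szego_y a' (x, y))^*%C) = X y}.
  apply: filterS2 (section_Linf1 LH) (slices_analytic LH Hz) => y h1 h2 Sy.
  have hx j : extG cint1 e1 (z j) (fun x => H (x, y)) = ext1 H (z j) y by rewrite ext1E.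
  have := cint1_szego z1 (a'^~ y) (a^~ y) (Linf1_I1 (h1 Sy)) (h2 Sy).
  under [X in _ = X]eq_bigr => j _ do under eq_bigr => k _ do rewrite hx.
  rewrite -/(X y) => <-; congr cint1; apply/funext => x.
  by rewrite mulrAC -mulrA.
split; first exact: (I1_ae_eq If mX e).
by apply: ae_eq_cint1 => //; exact: If.1.
Qed.

End Kernels.

Section Hankel.
Variables (n : nat) (z w : 'I_n -> C) (G : T2 -> C).
Hypotheses (z1 : forall j, cabs (z j) < 1) (w1 : forall j, cabs (w j) < 1).
Hypothesis hG : Hinf G.
Hypothesis hankel : hankel_norm_le (fun p => (blaschke z p.1 * blaschke w p.2)^*%C * G p) 1.
Let q v y := pick_form z (fun j => ext1 G (z j) y) v.

Lemma mfunC_pick v : mfunC (q v).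
Proof.
have [[cG LG] _] := hG.
have mg j : mfunC (fun y => ext1 G (z j) y) by apply: mfunC_ext1 => //; exact: LG.1.
apply: (@mfunC_sum _ _ R) => j; apply: (@mfunC_sum _ _ R) => k.
apply: mfunCM; last exact: mfunC_cst.
apply: mfunCM; first exact: mfunC_cst.
apply: mfunCM; last exact: mfunC_cst.
apply: mfunCB; first exact: mfunC_cst.
by apply: mfunCM => //; exact: mfunCJ.
Qed.

Lemma hankel_pick_integral (B : T1 -> bool) v : measurable_fun setT B ->
  let ind y : C := if B y then 1 else 0 in
  I1 (fun y => ind y * q v y) /\ 0 <= Re (cint1 (fun y => ind y * q v y)).
Proof.
move=> mB ind; have [[cG LG] Gz] := hG.
pose gam j y := ext1 G (z j) y.
have mind : mfunC ind by apply: (mfunC_if mB); exact: mfunC_cst.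
have Lind : Linf_le (fun p => ind p.2) 1.
  by apply: Linf_bnd => [|p]; [exact: mfunC_snd|rewrite /ind; case: ifP; rewrite ?cabs1 ?cabs0].
pose a k y := ind y * ((gam k y)^*%C * v k).
pose a' k y := ind y * v k.
have La k : exists c, Linf_le (fun p => a k p.2) c.
  have [K hK] := Linf_ext1 (z1 k) LG.
  have Lv : Linf_le (fun=> v k) (cabs (v k)) by apply: Linf_bnd => //; exact: mfunC_cst.
  by eexists; exact: (Linf_mul Lind (Linf_mul (LinfJ hK) Lv)).
have La' k : exists c, Linf_le (fun p => a' k p.2) c.
  have Lv : Linf_le (fun=> v k) (cabs (v k)) by apply: Linf_bnd => //; exact: mfunC_cst.
  by eexists; exact: (Linf_mul Lind Lv).
have [ca hca] := Linf_szego_y z1 La; have [ca' hca'] := Linf_szego_y z1 La'.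
have GX m k : m < 0 -> fhat G m k = 0 by move=> m0; apply: Gz; left.
have L1 : Linf_le (fun=> 1) 1 by apply: Linf_bnd => [|p]; [exact: mfunC_cst|rewrite cabs1].
have one_x m k : m < 0 -> fhat (fun=> 1) m k = 0.
  move=> m0; rewrite (@fhat_snd R (fun=> 1)) ?lt_eqF ?mul0r //; exact: (Linf_I2 L1).
have e1E j y : ext1 (fun=> 1) (z j) y = 1 by rewrite ext1E ext1_cst1.
have [IX EX] := inner_szego_y z1 LG GX La La'.
have [IA EA] := inner_szego_y z1 L1 one_x La' La'.
have [IF EF] := inner_szego_y z1 L1 one_x La La.
set X := (fun y => _) in IX EX; set A := (fun y => _) in IA EA; set F := (fun y => _) in IF EF.
have indK y : ind y * ind y = ind y by rewrite /ind; case: ifP; rewrite ?mul1r ?mul0r.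
have indJ y : (ind y)^*%C = ind y by rewrite /ind; case: ifP; rewrite ?rmorph1 ?raddf0.
(* With the coefficients [a] and [a'], |f|^2 and <G f, g> are integrals of the same function, so 2
   Re <G f, g> <= |f|^2 + |g|^2 leaves |g|^2 - |f|^2 >= 0, the integral of the Pick form. *)
have FX : F = X.
  apply/funext => y; apply: eq_bigr => j _; apply: eq_bigr => k _.
  by rewrite e1E /a /a' /gam !cconjM cconjK !indJ; ring.
have AX : (fun y => ind y * q v y) = (fun y => A y - X y).
  apply/funext => y; rewrite /A /X -sumrB /q /pick_form mulr_sumr; apply: eq_bigr => j _.
  rewrite -sumrB mulr_sumr; apply: eq_bigr => k _.
  rewrite e1E /a /a' /gam !cconjM !indJ -[in LHS](indK y); ring.
split; first by rewrite AX; exact: (integrableCB mS IA IX).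
have main := hankel_test z1 w1 hG hankel (Linf_L2 hca) (szego_y_analytic z1 La) (Linf_L2 hca')
  (inner_blaschke_szego_y z1 La').
have mul1E b : (fun p => (1 : C) * szego_y z b p) = szego_y z b by apply/funext => p; rewrite mul1r.
rewrite mul1E in EA; rewrite mul1E FX in EF.
move: main; rewrite /nsq EX EA EF => main.
rewrite AX cint1B // cReB; lra.
Qed.

Lemma hankel_pick_form_ae v : {ae leb R, forall y, S y -> 0 <= q v y}.
Proof.
pose B y := Re (q v y) < 0.
have mB : measurable_fun setT B.
  by apply: measurable_fun_ltr; [exact: (mfunC_pick v).1|exact: measurable_cst].
have [Iq q0] := hankel_pick_integral v mB.
set k := (fun y => _) in Iq q0.
pose h y := Re (k y).
(* [h] is the negative part of the form with its sign; its integral is both <= 0 and >= 0, so it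
   vanishes almost everywhere. *)
have hle y : h y <= 0.
  by rewrite /h /k /B; case: ifPn => [/ltW|_]; rewrite ?mul1r ?mul0r.
have ih : (leb R).-integrable S (EFin \o h) := Iq.2.1.
have i0 : (\int[leb R]_(y in S) `|(h y)%:E|)%E = 0%E.
  have -> : (\int[leb R]_(y in S) `|(h y)%:E|)%E = (\int[leb R]_(y in S) (- (h y)%:E))%E.
    by apply: eq_integral => y _; rewrite abse_EFin ler0_norm.
  rewrite (integralN (integrable_add_def mS ih)).
  have hf := integrable_fin_num mS ih.
  have hz : Rintegral (leb R) S h = 0.
    apply/le_anti; apply/andP; split.
      rewrite -oppr_ge0 -[- _]mulN1r -RintegralZl //; [|exact: mS].
      by apply: Rintegral_ge0 => y _; rewrite mulN1r oppr_ge0 hle.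
    have p0 : 0 < (2 * pi : R)^-1 by rewrite invr_gt0 mulr_gt0 // pi_gt0.
    by move: q0; rewrite /Defs.cint1 /= (pmulr_rge0 _ p0).
  by rewrite -(fineK hf) -[fine _]/(Rintegral (leb R) S h) hz oppe0.
have mh : measurable_fun S (EFin \o h) by exact: (measurable_int _ ih).
have := (ae_eq_integral_abs (leb R) mS mh).1 i0.
apply: filterS => y hy Sy; have := hy Sy => /= -[].
rewrite /q pick_form_ge0E /h /k /B -/(q v y); case: ifPn; last by rewrite -leNgt.
by move=> qn; rewrite mul1r => q00; move: qn; rewrite q00 ltxx.
Qed.

(** The exceptional null set depends on the vector, so only countably many vectors are tested and
    [pick_pos_rat] provides the others. *)
Lemma hankel_pick : {ae leb R, forall y, S y -> pick_pos z (fun j => ext1 G (z j) y)}.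
Proof.
have h : {ae leb R, forall y, forall m : nat, S y ->
    if @unpickle {ffun 'I_n -> rat * rat} m is Some c then
      0 <= q (fun j => ratC R (c j)) y else true}.
  apply: ae_foralln => m; case: unpickle => [c|]; last by apply: aeW.
  by apply: filterS (hankel_pick_form_ae (fun j => ratC R (c j))) => y hy /hy.
apply: filterS h => y hy Sy; apply: pick_pos_rat => c.
by have := hy (pickle c) Sy; rewrite pickleK.
Qed.

End Hankel.
End PickOfHankel.

(** * Symmetry of the Hankel condition and multiples of b *)

Section Final.
Variable R : realType.
Local Notation C := R[i].
Local Notation Linf_le := (@Linf_le R).
Local Notation L2 := (@L2 R).
Local Notation I2 := (@I2 R).
Local Notation fhat := (@fhat R).
Local Notation Ix := (@Ix R).
Local Notation cint2 := (@cint2 R).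
Local Notation ext12 := (@ext12 R).
Local Notation sw := (@sw R).

(** The exchange of coordinates is unitary, preserves H^2 and carries projections to projections. *)
Lemma hankel_norm_le_sw phi c0 c : Linf_le phi c0 -> hankel_norm_le phi c ->
  hankel_norm_le (phi \o sw) c.
Proof.
move=> Lphi hk f hf h [hh hp].
have Lpf : L2 (fmul (phi \o sw) f).
  by have := L2_Linf hf.1 (Linf_sw Lphi); congr Defs.L2; apply/funext => p; rewrite /fmul mulrC.
have Lr : L2 (fsub (fmul (phi \o sw) f) h) by exact: (L2B Lpf hh.1).
have E : fsub (fmul phi (f \o sw)) (h \o sw) = fsub (fmul (phi \o sw) f) h \o sw.
  by apply/funext => -[].
have P : is_projH2 (fmul phi (f \o sw)) (h \o sw).
  split; first exact: H2_sw.
  move=> u hu; rewrite E -(sw_comp u) inner_sw //; last exact: L2_sw hu.1.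
  by apply: hp; exact: H2_sw.
have := hk _ (H2_sw hf) _ P; rewrite E !norm2E (nsq_sw Lr) (nsq_sw hf.1) //.
Qed.

Section OneSide.
Variables (n : nat) (z w : 'I_n -> C).
Hypotheses (z1 : forall j, cabs (z j) < 1) (w1 : forall j, cabs (w j) < 1).

Lemma blaschke2_analytic h : Linf h -> (forall m k, m < 0 \/ k < 0 -> fhat h m k = 0) ->
  forall m k, m < 0 \/ k < 0 -> fhat (fun p => blaschke z p.1 * blaschke w p.2 * h p) m k = 0.
Proof.
move=> [c /Linf_I2 Ih] hz m k mk.
have -> : (fun p => blaschke z p.1 * blaschke w p.2 * h p) =
    (fun p => h p * blaschke z p.1 * blaschke w p.2) by apply/funext => p; ring.
have I1h := I2_Linf Ih (Linf_blaschke_x z1).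
case: mk => [m0|k0].
  apply: (blaschke_zero_y w1 I1h) => l.
  by apply: (blaschke_lower_x z1 Ih (m0 := 0)) => // i i0; apply: hz; left.
apply: (blaschke_lower_y w1 I1h (m0 := 0)) => // i i0.
by apply: (blaschke_zero_x z1 Ih) => l; apply: hz; right.
Qed.

(** The kernel in y is absorbed first: it leaves the function analytic in x, and what remains is an
    evaluation in x, at y-frequency 0, of a multiple of the Blaschke product. *)
Lemma ext12_blaschke_root h k v : cabs v < 1 -> Linf h ->
  (forall m l, m < 0 -> fhat h m l = 0) ->
  ext12 (fun p => blaschke z p.1 * blaschke w p.2 * h p) (z k) v = 0.
Proof.
move=> v1 [c /Linf_I2 Ih] hz.
pose f0 p := h p * blaschke w p.2.
have If0 : I2 f0 by exact: (I2_Linf Ih (Linf_blaschke_y w1)).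
have If := hf_clsV (hardy_y R 0) (-1) v1 If0.
rewrite -[RHS](@extG_blaschke_x R n z z1 _ 0 k If).
  rewrite /Defs.ext12 /extG /Ix; congr cint2; apply/funext => p.
  by rewrite oppr0 chr2_0 mulr1 -exN_expi -eyN_expi /f0 invfM; ring.
move=> m m0; rewrite -hat_y.
apply: (upper_div (hardy_y R m) v1 If0 (m0 := 0)) => // l _; rewrite hat_y.
by apply: (blaschke_zero_y w1 Ih) => i; exact: hz.
Qed.

End OneSide.
End Final.

Unset Implicit Arguments.

Theorem theorem3p1 (R : realType) (n : nat) (z w : 'I_n -> R[i]) (G : T2 R -> R[i]) :
  (forall j, `|z j| < 1) -> (forall j, `|w j| < 1) ->
  injective z -> injective w ->
  Hinf G ->
  let b : T2 R -> R[i] := fun p => blaschke z p.1 * blaschke w p.2 in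
  let phi : T2 R -> R[i] := fun p => (b p)^*%C * G p in
  let cond_i : Prop :=
    {ae leb R, forall y : R, sqT y ->
       psd (\matrix_(j < n, k < n)
              ((1 - ext1 G (z j) y * (ext1 G (z k) y)^*%C) / (1 - z j * (z k)^*%C)))}
    /\ {ae leb R, forall x : R, sqT x ->
       psd (\matrix_(j < n, k < n)
              ((1 - ext2 G x (w j) * (ext2 G x (w k))^*%C) / (1 - w j * (w k)^*%C)))} in
  let cond_ii : Prop := hankel_norm_le phi 1 in
  let cond_iii : Prop :=
    exists F : T2 R -> R[i],
      [/\ H2 F,
          forall k (v : R[i]), `|v| < 1 -> ext12 F (z k) v = ext12 G (z k) v,
          forall k (u : R[i]), `|u| < 1 -> ext12 F u (w k) = ext12 G u (w k) &
          bmo_r_le (fun p => (b p)^*%C * F p) 1] in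
  let cond_iv : Prop :=
    exists F1 F2 : T2 R -> R[i],
      [/\ Linf_le F1 1, Linf_le F2 1,
          (forall m n : int, m < 0 -> fhat F1 m n = 0),
          (forall m n : int, n < 0 -> fhat F2 m n = 0) &
          forall k,
            {ae leb R, forall y : R, sqT y -> ext1 F1 (z k) y = ext1 G (z k) y}
            /\ {ae leb R, forall x : R, sqT x -> ext2 F2 x (w k) = ext2 G x (w k)}] in
  [/\ (cond_ii -> cond_iii),
      (cond_ii -> cond_iv),
      (cond_iii -> hankel_norm_le phi (Num.sqrt 2)),
      (cond_iv -> hankel_norm_le phi (Num.sqrt 2)) &
      (cond_i <-> cond_iv)].
Proof.
move=> z1' w1' zinj winj hG b phi cond_i cond_ii cond_iii cond_iv.
have z1 j : cabs (z j) < 1 by rewrite -ltc_norm1.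
have w1 j : cabs (w j) < 1 by rewrite -ltc_norm1.
have [[c LG] Gz] := hG.
have LGs := Linf_sw LG.
have i_iv : cond_i <-> cond_iv.
  split=> [[hz hw]|[F1 [F2 [L1 L2' F1x F2y E]]]]; last first.
    split.
      have := interpolation_pick z1 L1 F1x (fun j => (E j).1).
      by apply: filterS => y h Sy; apply/psd_pick_form; exact: h.
    have F2x m k : m < 0 -> fhat (F2 \o @sw R) m k = 0.
      by move=> m0; rewrite fhat_sw ?F2y //; exact: Linf_I2 L2'.
    have := @interpolation_pick R n w (G \o @sw R) w1 (F2 \o @sw R) (Linf_sw L2') F2x (fun j => (E j).2).
    by apply: filterS => y h Sy; apply/psd_pick_form; exact: h.
  have pz : {ae leb R, forall y, sqT y -> pick_pos z (fun j => ext1 G (z j) y)}.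
    by apply: filterS hz => y h Sy; apply/psd_pick_form; exact: h.
  have pw : {ae leb R, forall y, sqT y -> pick_pos w (fun j => ext1 (G \o @sw R) (w j) y)}.
    by apply: filterS hw => y h Sy; apply/psd_pick_form; exact: h.
  have [F1 [L1 F1x E1]] := pick_interpolation z1 zinj LG pz.
  have [F2 [L2' F2x E2]] := pick_interpolation w1 winj LGs pw.
  exists F1, (F2 \o @sw R); split => //.
  - exact: Linf_sw.
  - by move=> m k k0; rewrite fhat_sw ?F2x //; exact: Linf_I2 L2'.
  - by move=> j; split; [exact: E1|exact: E2].
have Lb := Linf_blaschkeJ2 z1 w1.
have Lphi : Linf_le phi (1 * c) := LinfM Lb LG ler01.
have ii_i : cond_ii -> cond_i.
  move=> hk; split.
    have := hankel_pick z1 w1 hG hk.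
    by apply: filterS => y h Sy; apply/psd_pick_form; exact: h.
  have hk' : hankel_norm_le (fun p => (blaschke w p.1 * blaschke z p.2)^*%C * (G \o @sw R) p) 1.
    have := hankel_norm_le_sw Lphi hk; congr hankel_norm_le; apply/funext => -[x y].
    by rewrite /phi /b /= [blaschke z _ * _]mulrC.
  have := hankel_pick w1 z1 (Hinf_sw hG) hk'.
  by apply: filterS => y h Sy; apply/psd_pick_form; exact: h.
split => //.
- move=> hii.
  (* These interpolants provide the bounded symbols of BMO_r, whereas the function [F] of (iii)
     comes from the projection. *)
  have [F1 [F2 [L1 L2' F1x F2y E]]] := i_iv.1 (ii_i hii).
  have [h [Lh hz] [hH hp]] := proj_exists z1 w1 hG.
  have [ch Lch] := Lh.
  have bhz := blaschke2_analytic z1 w1 Lh hz.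
  have Lb1 : Linf_le b 1.
    by have := LinfJ Lb; congr Defs.Linf_le; apply/funext => p; rewrite cconjK.
  have Lbh : Linf_le (fun p => b p * h p) (1 * ch) := LinfM Lb1 Lch ler01.
  (* The subtracted term vanishes at the nodes, so [F] interpolates [G]; and conj b F = phi - h has
     no coefficient in the positive quadrant. *)
  pose F p := G p - b p * h p.
  have LF : L2 F by exact: (L2B (Linf_L2 LG) (Linf_L2 Lbh)).
  exists F; split.
  + split => // m k mk; rewrite fhatB; [|exact: Linf_L2 LG|exact: Linf_L2 Lbh].
    by rewrite Gz // bhz // subrr.
  + move=> k v /[!ltc_norm1] v1.
    rewrite ext12B //; [|exact: Linf_I2 LG|exact: Linf_I2 Lbh].
    rewrite (ext12_blaschke_root z1 w1 k v1 Lh) ?subr0 // => m l m0.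
    by apply: hz; left.
  + move=> k u /[!ltc_norm1] u1.
    rewrite ext12B //; [|exact: Linf_I2 LG|exact: Linf_I2 Lbh].
    have -> : ext12 (fun p => b p * h p) u (w k) = 0; last by rewrite subr0.
    rewrite -(ext12_sw (Linf_I2 Lbh)) //.
    have hsz m l : m < 0 -> fhat (h \o @sw R) m l = 0.
      by move=> m0; rewrite fhat_sw; [apply: hz; right|exact: Linf_I2 Lch].
    have -> : (fun p => b p * h p) \o @sw R =
        (fun p => blaschke w p.1 * blaschke z p.2 * (h \o @sw R) p).
      by apply/funext => -[x y]; rewrite /b /= [blaschke z _ * _]mulrC.
    exact: (ext12_blaschke_root w1 z1 k u1 (ex_intro _ _ (Linf_sw Lch)) hsz).
  have psiE : (fun p => (b p)^*%C * F p) = fsub phi h.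
    apply/funext => p; rewrite /F /fsub /phi mulrBr mulrA [(b p)^*%C * b p]mulrC.
    by rewrite (bK z1 w1) mul1r.
  rewrite psiE => eps e0.
  have Lweak (H : T2 R -> R[i]) : Linf_le H 1 -> Linf_le H (1 + eps).
    by move=> [mH bH]; split => //; apply: filterS bH => p hb Dp; rewrite (le_trans (hb Dp)) // lerDl ltW.
  have LbF (H : T2 R -> R[i]) : Linf_le H 1 -> Linf_le (fun p => (b p)^*%C * H p) 1.
    by move=> LH; have := LinfM Lb LH ler01; rewrite mulr1.
  have Lr : L2 (fsub phi h) := L2B (Linf_L2 Lphi) (Linf_L2 Lch).
  have Lz : Linf_le (fun=> 0 : R[i]) 1.
    by apply: Linf_bnd => [|p]; [exact: mfunC_cst|rewrite cabs0].
  have coef (H : T2 R -> R[i]) m k : Linf_le H 1 -> fhat h m k = 0 ->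
      fhat (fun p => (b p)^*%C * (H p - G p)) m k = 0 ->
      fhat (fsub (fsub phi h) (fun p => (b p)^*%C * H p)) m k = 0.
    move=> LH h0 e.
    have LHG : L2 (fun p => (b p)^*%C * (H p - G p)).
      have := L2_Linf (L2B (Linf_L2 LH) (Linf_L2 LG)) Lb; congr Defs.L2; apply/funext => p; exact: mulrC.
    (* Both terms are analytic in the variable concerned: [h] lies in H^2, and H - G vanishes at the
       nodes, hence survives division by [b]. *)
    have -> : fsub (fsub phi h) (fun p => (b p)^*%C * H p) =
        (fun p => -1 * h p - (b p)^*%C * (H p - G p)).
      by apply/funext => p; rewrite /fsub /phi; ring.
    have Lh2 := Linf_L2 Lch.
    by rewrite fhatB; [|exact: L2Z|exact: LHG]; rewrite fhatZ ?h0 ?e ?mulr0 ?subr0.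
  (* The symbol for the positive quadrant is 0 because phi - h is orthogonal to H^2. *)
  exists (fun=> 0), (fun p => (b p)^*%C * F1 p), (fun p => (b p)^*%C * F2 p); split.
  + exact: Lweak.
  + exact: (Lweak _ (LbF _ L1)).
  + exact: (Lweak _ (LbF _ L2')).
  split.
  + split; first exact: (L2B Lr (Linf_L2 (LbF _ L1))).
    move=> m k m0; apply: coef => //; first by apply: hz; left.
    apply: (blaschkeJ2_analytic_x z1 w1 zinj) => //.
    * exact: (I2B (Linf_I2 L1) (Linf_I2 LG)).
    * move=> i j i0; rewrite fhatB; [|exact: Linf_L2 L1|exact: Linf_L2 LG].
      by rewrite F1x // Gz ?subrr //; left.
    * by move=> i j; apply: (extG_x_eq (z1 i) L1 LG); exact: (E i).1.
  + split; first exact: (L2B Lr (Linf_L2 (LbF _ L2'))).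
    move=> m k k0; apply: coef => //; first by apply: hz; right.
    apply: (blaschkeJ2_analytic_y z1 w1 winj) => //.
    * exact: (I2B (Linf_I2 L2') (Linf_I2 LG)).
    * move=> i j i0; rewrite fhatB; [|exact: Linf_L2 L2'|exact: Linf_L2 LG].
      by rewrite F2y // Gz ?subrr //; right.
    * by move=> i j; apply: (extG_x_eq (w1 i) (Linf_sw L2') LGs); exact: (E i).2.
  + move=> m k m0 k0.
    have -> : fsub (fsub phi h) (fun=> 0) = fsub phi h.
      by apply/funext => p; rewrite /fsub subr0.
    by rewrite -inner_chr2; apply: hp; exact: H2_chr2.
- by move=> /ii_i /i_iv.
- move=> [F [hF Ez Ew bmo]].
  apply: (interp_bound_bmo z1 w1 zinj winj hG hF _ _ bmo) => k v v1.
  + by apply: Ez; rewrite ltc_norm1.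
  + by apply: Ew; rewrite ltc_norm1.
- move=> [F1 [F2 [L1 L2' F1x F2y E]]].
  exact: (interp_bound_Linf z1 w1 zinj winj hG L1 L2' F1x F2y E).
Qed.
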